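(* There is at most one entropy solution of the problem $\partial_t u+\nabla\cdot\mathbf{f}(u)=\sum_{i,j}\partial^2_{x_ix_j}\mathbf{A}_{ij}(u)$ on $(0,\infty)\times\mathcal{G}_d$, $u(0,\cdot)=u_0\in L^\infty(\mathcal{G}_d)$. More specifically, if $u,v$ are entropy solutions with initial data $u_0,v_0\in L^\infty(\mathcal{G}_d)$, then for a.e. $t>0$, $$\int_{\mathcal{G}_d}|u(t,\omega)-v(t,\omega)|\,d\mathfrak{m}(\omega)\le\int_{\mathcal{G}_d}|u_0(\omega)-v_0(\omega)|\,d\mathfrak{m}(\omega).$$
   Context: Standing setting: $\mathbf{f}:\mathbb{R}\to\mathbb{R}^d$ smooth; $\mathbf{A}(u)=(\mathbf{A}_{ij}(u))$ smooth symmetric with derivative $A(u)=(a_{ij}(u))$ nonnegative definite; smooth $\sigma_{ik}$ with $a_{ij}=\sum_k\sigma_{ik}\sigma_{jk}$; $\beta_{ik}(u)=\int^u\sigma_{ik}$. $\mathcal{G}_d$ is the Bohr compactification of $\mathbb{R}^d$ (compact abelian group containing $\mathbb{R}^d$ densely; $C(\mathcal{G}_d)\cong\mathrm{AP}(\mathbb{R}^d)$, the sup-norm closure of trigonometric polynomials), with normalized Haar measure $\mathfrak{m}$. Partial derivatives on $\mathcal{G}_d$: $\partial_{x_i}f(\omega)=\lim_{h\to0}(f(\omega+he_i)-f(\omega))/h$ with $e_i\in\mathbb{R}^d\subset\mathcal{G}_d$; test functions $C_0^\infty((0,\infty)\times\mathcal{G}_d)$ are compactly supported with all iterated derivatives continuous;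 distributional derivatives and inequalities are defined by integration by parts against them w.r.t. $dt\,d\mathfrak{m}$. An entropy solution with initial datum $w_0$ is $w\in L^\infty((0,\infty)\times\mathcal{G}_d)$ with: (i) $\sum_i\partial_{x_i}\beta_{ik}(w)\in L^2((0,\infty)\times\mathcal{G}_d)$; (ii) for $\psi\in C(\mathbb{R})$, $\sum_i\partial_{x_i}\beta^\psi_{ik}(w)=\psi(w)\sum_i\partial_{x_i}\beta_{ik}(w)\in L^2$, $(\beta^\psi_{ik})'=\psi\beta'_{ik}$; (iii) for every convex $C^2$ $\eta$, with $\mathbf{q}'=\eta'\mathbf{f}'$, $r'_{ij}=\eta'a_{ij}$: $\partial_t\eta(w)+\nabla_x\cdot\mathbf{q}(w)-\sum\partial^2_{x_ix_j}r_{ij}(w)\le-\eta''(w)\sum_k(\sum_i\partial_{x_i}\beta_{ik}(w))^2$ in distributions; (iv) $\int_{\mathcal{G}_d}|w(t)-w_0|d\mathfrak{m}\to0$ as $t\to0^+$. *)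

(* Defs.v *)
From HB Require Import structures.
From mathcomp Require Import all_boot all_order all_algebra.
From mathcomp Require Import all_classical all_reals all_analysis.
Set Implicit Arguments. Unset Strict Implicit. Unset Printing Implicit Defensive.
Import Order.TTheory GRing.Theory Num.Theory.
Import numFieldNormedType.Exports.
Local Open Scope classical_set_scope.
Local Open Scope ring_scope.

(* The underlying type of a topological abelian group, pointed by 0, so that
   it can carry a measurable structure. *)
Definition ptd (G : topologicalZmodType) : Type := G.
HB.instance Definition _ (G : topologicalZmodType) := Choice.on (ptd G).
HB.instance Definition _ (G : topologicalZmodType) :=
  isPointed.Build (ptd G) (0 : G).

Section Defs.
Variables (R : realType) (d : nat).

Definition dotv (x y : 'rV[R]_d) : R := \sum_(i < d) x ord0 i * y ord0 i.

Definition trig_poly (s : seq ('rV[R]_d * R * R)) (x : 'rV[R]_d) : R :=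
  \sum_(p <- s) (p.1.2 * cos (dotv p.1.1 x) + p.2 * sin (dotv p.1.1 x)).

Definition almost_periodic (f : 'rV[R]_d -> R) : Prop :=
  forall e : R, 0 < e -> exists s, forall x, `|f x - trig_poly s x| <= e.

Variable G : topologicalZmodType.

Definition baire_gen : set (set (ptd G)) :=
  [set A | exists F : G -> R, continuous F /\
           exists O : set R, open O /\ A = F @^-1` O].

Definition is_bohr_compactification (iota : 'rV[R]_d -> G) : Prop :=
  [/\ compact [set: G], hausdorff_space G,
      (forall x y, iota (x + y) = iota x + iota y) /\ continuous iota,
      closure (range iota) = [set: G] &
      (forall F : G -> R, continuous F -> almost_periodic (F \o iota)) /\
      (forall f, almost_periodic f ->
         exists F : G -> R, continuous F /\ F \o iota = f)].

Definition GB := g_sigma_algebraType baire_gen.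

Definition is_haar (m : probability GB R) : Prop :=
  forall (x : G) (A : set GB), measurable A ->
    m ((fun y : G => y + x) @^-1` A) = m A.

Variable iota : 'rV[R]_d -> G.

Definition Dom {T : Type} : set (R * T) := [set p | 0 < p.1].

Definition dirshift (j : option 'I_d) (h : R) (p : R * G) : R * G :=
  match j with
  | None => (p.1 + h, p.2)
  | Some i => (p.1, p.2 + iota (h *: delta_mx ord0 i))
  end.

Definition diffquot (j : option 'I_d) (phi : R * G -> R) (p : R * G) :=
  fun h : R => (phi (dirshift j h p) - phi p) / h.

Definition pd_exists (j : option 'I_d) (phi : R * G -> R) : Prop :=
  forall p, cvg (diffquot j phi p @ 0^').

(* partial derivative (meaningful where pd_exists holds) *)
Definition pd (j : option 'I_d) (phi : R * G -> R) : R * G -> R :=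
  fun p => lim (diffquot j phi p @ 0^').

Fixpoint smooth_n (n : nat) (phi : R * G -> R) : Prop :=
  match n with
  | 0 => continuous phi
  | n'.+1 => continuous phi /\
      forall j, pd_exists j phi /\ smooth_n n' (pd j phi)
  end.

Definition test_fun (phi : R * G -> R) : Prop :=
  (forall n, smooth_n n phi) /\
  compact (closure [set p | phi p != 0]) /\
  closure [set p | phi p != 0] `<=` Dom.

Definition smooth_real (g : R -> R) : Prop :=
  forall n x, derivable (derive1n n g) x 1.

Definition convex_real (g : R -> R) : Prop :=
  forall x y l : R, 0 <= l <= 1 ->
    g (l * x + (1 - l) * y) <= l * g x + (1 - l) * g y.

Definition C2_real (g : R -> R) : Prop :=
  (forall x, derivable g x 1) /\ (forall x, derivable (derive1 g) x 1) /\
  continuous (derive1 (derive1 g)).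

Variable m : probability GB R.

Local Notation leb := (@lebesgue_measure R).
Local Notation mu := (leb \x m)%E.

Definition Linf_G (w0 : GB -> R) : Prop :=
  measurable_fun [set: GB] w0 /\ exists M : R, {ae m, forall x, `|w0 x| <= M}.

Definition Linf_prod (w : R * GB -> R) : Prop :=
  measurable_fun Dom w /\ exists M : R, {ae mu, forall p, Dom p -> `|w p| <= M}.

Definition L2_prod (g : R * GB -> R) : Prop :=
  measurable_fun Dom g /\ (\int[mu]_(p in Dom) ((g p) ^+ 2)%:E < +oo)%E.

Variables (f : 'I_d -> R -> R) (A : 'I_d -> 'I_d -> R -> R)
          (sigma beta : 'I_d -> 'I_d -> R -> R).

Definition amat (i j : 'I_d) : R -> R := derive1 (A i j).

Definition entropy_solution (w : R * GB -> R) (w0 : GB -> R) : Prop :=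
  Linf_prod w /\
  exists g : 'I_d -> R * GB -> R,
  (* (i) sum_i d_{x_i} beta_ik(w) = g_k in L^2 *)
  [/\ (forall k, L2_prod (g k)),
      (forall k phi, test_fun phi ->
         (\int[mu]_(p in Dom) (\sum_i beta i k (w p) * pd (Some i) phi p)%:E
          = - \int[mu]_(p in Dom) (g k p * phi p)%:E)%E),
      (forall psi : R -> R, continuous psi ->
       forall betapsi : 'I_d -> 'I_d -> R -> R,
       (forall i k (x : R), is_derive x 1 (betapsi i k) (psi x * sigma i k x)) ->
       forall k phi, test_fun phi ->
         (\int[mu]_(p in Dom) (\sum_i betapsi i k (w p) * pd (Some i) phi p)%:E
          = - \int[mu]_(p in Dom) (psi (w p) * g k p * phi p)%:E)%E),
      (forall eta : R -> R, convex_real eta -> C2_real eta ->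
       forall (q : 'I_d -> R -> R) (r : 'I_d -> 'I_d -> R -> R),
       (forall i (x : R), is_derive x 1 (q i) (derive1 eta x * derive1 (f i) x)) ->
       (forall i j (x : R), is_derive x 1 (r i j) (derive1 eta x * amat i j x)) ->
       forall phi, test_fun phi -> (forall p, 0 <= phi p) ->
         (\int[mu]_(p in Dom)
             (derive1 (derive1 eta) (w p) * (\sum_k (g k p) ^+ 2) * phi p)%:E
          <= \int[mu]_(p in Dom)
             (eta (w p) * pd None phi p
              + \sum_i q i (w p) * pd (Some i) phi p
              + \sum_i \sum_j r i j (w p) * pd (Some i) (pd (Some j) phi) p)%:E)%E) &
      (forall e : R, 0 < e -> exists delta : R, 0 < delta /\
         {ae leb, forall t, 0 < t < delta ->
            (\int[m]_x `|w (t, x) - w0 x|%:E < e%:E)%E })].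

End Defs.

(* Main.v *)
(* Kruzhkov's doubling of variables for degenerate parabolic equations, in the
   form of Chen and Karlsen. The equation for u(t, x) is tested with the entropy
   eta(. - v(s, y)) and the one for v(s, y) with eta(u(t, x) - .), where eta is a
   smooth convex approximation of the absolute value. The two parabolic
   dissipations and the cross term supplied by the chain rule add up to a
   square; the flux and diffusion terms cancel as eta approaches the absolute
   value, because the test function depends on x - y only. With the test function
   al(t + s) ka(t - s) S(x - y), where S is a nonnegative trigonometric
   polynomial of mean 1 concentrated near 0, what remains is an inequality for
   |u(t, x) - v(s, y)|. As G need not be metrizable, v is not evaluated at
   Lebesgue points in x: it is approximated in L1 by functions with a modulus
   of continuity in (t - s, x - y), to which S is adapted. In the limit the map
   D(t) = \int |u(t, x) - v(t, x)| dm is nonincreasing in the sense of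
   distributions on (0, +oo), and the initial conditions bound it near 0. *)
Require Import Defs.
From HB Require Import structures.
From mathcomp Require Import all_boot all_order all_algebra.
From mathcomp Require Import all_classical all_reals all_analysis.
From mathcomp Require Import measurable_realfun ring lra.
Set Implicit Arguments. Unset Strict Implicit. Unset Printing Implicit Defensive.
Import Order.TTheory GRing.Theory Num.Theory.
Import numFieldNormedType.Exports.
Local Open Scope classical_set_scope.
Local Open Scope ring_scope.

(** * Antiderivatives and separable functions *)

Section Antiderivatives.
Context {R : realType}.
Implicit Types (f g F G : R -> R) (a b c x y : R).

(** The obstacle throughout is joint measurability and boundedness in the doubled variables. In the
    values of the solutions it is met by taking eta'' polynomial: then eta (x - y), its derivatives
    and the fluxes built from them are finite sums of products of continuous functions of one
    variable, a class stable under antiderivatives in x that vanish on the diagonal. In the group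
    variables it is met by trigonometric polynomials: the addition formulas turn S (x - y) into a
    finite sum of products, and freezing either variable leaves a trigonometric polynomial, whose
    derivatives are computed on coefficients. Both cancellations, of the fluxes and of the diffusion
    against the cross term, hold up to a constant times e at every pair of values bounded by M; so e
    tends to 0 while the test function stays fixed, and no derivative of S has to be controlled
    afterwards. The derivative of [ka] disappears because d/dt and d/ds act on it with opposite
    signs. In the collapse only the marginals of the kernel and the modulus of the approximant of v
    enter. *)

Definition deriv_of F f := forall x, is_derive x (1 : R) F (f x).

Lemma deriv_of_ext F f g : deriv_of F f -> f =1 g -> deriv_of F g.
Proof. by move=> + fg x => /(_ x); rewrite fg. Qed.

Lemma deriv_of_cst c : deriv_of (fun=> c) (fun=> 0).
Proof. by move=> x; exact: is_derive_cst. Qed.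

Lemma deriv_of_id : deriv_of id (fun=> 1).
Proof. by move=> x; exact: is_derive_id. Qed.

Lemma deriv_ofD F f G g : deriv_of F f -> deriv_of G g ->
  deriv_of (fun x => F x + G x) (fun x => f x + g x).
Proof. by move=> Ff Gg x; exact: is_deriveD. Qed.

Lemma deriv_ofB F f G g : deriv_of F f -> deriv_of G g ->
  deriv_of (fun x => F x - G x) (fun x => f x - g x).
Proof. by move=> Ff Gg x; exact: is_deriveB. Qed.

Lemma deriv_ofZ c F f : deriv_of F f ->
  deriv_of (fun x => c * F x) (fun x => c * f x).
Proof. by move=> Ff x; exact: is_deriveZ. Qed.

Lemma deriv_ofN F f : deriv_of F f -> deriv_of (fun x => - F x) (fun x => - f x).
Proof. by move=> Ff x; exact: is_deriveN. Qed.

Lemma deriv_ofM F f G g : deriv_of F f -> deriv_of G g ->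
  deriv_of (fun x => F x * G x) (fun x => F x * g x + f x * G x).
Proof.
move=> Ff Gg x; rewrite [f x * _]mulrC.
exact: (@is_deriveM _ _ F G x 1 (f x) (g x) (Ff x) (Gg x)).
Qed.

Lemma deriv_of_affine k c : deriv_of (fun x => k * x + c) (fun=> k).
Proof.
have := deriv_ofD (deriv_ofZ k deriv_of_id) (deriv_of_cst c).
by move/deriv_of_ext; apply => x; rewrite mulr1 addr0.
Qed.

Lemma deriv_of_comp F f G g : deriv_of F f -> deriv_of G g ->
  deriv_of (fun x => F (G x)) (fun x => f (G x) * g x).
Proof. by move=> Ff Gg x; exact: is_derive1_comp. Qed.

Lemma deriv_of_comp_affine k c F f : deriv_of F f ->
  deriv_of (fun x => F (k * x + c)) (fun x => k * f (k * x + c)).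
Proof.
move=> Ff; have := deriv_of_comp Ff (deriv_of_affine k c).
by move/deriv_of_ext; apply => x; rewrite mulrC.
Qed.

Lemma deriv_of_shift c F f : deriv_of F f ->
  deriv_of (fun x => F (x - c)) (fun x => f (x - c)).
Proof.
move=> Ff; have := @deriv_of_comp_affine 1 (- c) _ _ Ff.
have E (H : R -> R) : (fun x => H (1 * x - c)) = fun x => H (x - c).
  by apply/funext => x; rewrite mul1r.
by rewrite E; move/deriv_of_ext; apply => x; rewrite !mul1r.
Qed.

Lemma deriv_of_refl c F f : deriv_of F f ->
  deriv_of (fun x => F (c - x)) (fun x => - f (c - x)).
Proof.
move=> Ff; have := @deriv_of_comp_affine (-1) c _ _ Ff.
have E (H : R -> R) : (fun x => H (-1 * x + c)) = fun x => H (c - x).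
  by apply/funext => x; rewrite mulN1r addrC.
by rewrite E; move/deriv_of_ext; apply => x; rewrite !mulN1r addrC.
Qed.

Lemma deriv_ofX n F f : deriv_of F f ->
  deriv_of (fun x => F x ^+ n.+1) (fun x => n.+1%:R * F x ^+ n * f x).
Proof.
move=> Ff x; have := @is_deriveX _ _ F n.+1 x 1 (f x) (Ff x).
by rewrite exprfctE.
Qed.

Lemma deriv_of_sum (I : Type) (s : seq I) (F f : I -> R -> R) :
  (forall i, deriv_of (F i) (f i)) ->
  deriv_of (fun x => \sum_(i <- s) F i x) (fun x => \sum_(i <- s) f i x).
Proof.
move=> Ff; elim: s => [|i s ih].
  have -> : (fun x => \sum_(i <- [::]) F i x) = cst 0.
    by apply/funext => x; rewrite big_nil.
  by apply: deriv_of_ext (deriv_of_cst 0) _ => x; rewrite big_nil.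
have -> : (fun x => \sum_(j <- i :: s) F j x) = fun x => F i x + \sum_(j <- s) F j x.
  by apply/funext => x; rewrite big_cons.
by apply: deriv_of_ext (deriv_ofD (Ff i) ih) _ => x; rewrite big_cons.
Qed.

Lemma deriv_of_continuous F f : deriv_of F f -> continuous F.
Proof.
move=> Ff x; apply: differentiable_continuous; apply/derivable1_diffP.
by case: (Ff x).
Qed.

Lemma deriv_ofE F f : deriv_of F f -> derive1 F = f.
Proof. by move=> Ff; apply/funext => x; rewrite derive1E; case: (Ff x). Qed.

Lemma deriv_of_derivable F f : deriv_of F f -> forall x, derivable F x 1.
Proof. by move=> Ff x; case: (Ff x). Qed.

(* Differentiating G - F and G + F reduces the bound to monotonicity. *)
Lemma deriv_of_dominated F f G g a b : a <= b ->
  deriv_of F f -> deriv_of G g -> (forall x, a <= x <= b -> `|f x| <= g x) ->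
  `|F b - F a| <= G b - G a.
Proof.
move=> ab Ff Gg fg.
have mono H h : deriv_of H h -> (forall x, a <= x <= b -> 0 <= h x) -> H a <= H b.
  move=> Hh h0.
  have [|c /[!in_itv]/= cab E] := @MVT_segment _ H h a b ab (fun x _ => Hh x).
    by apply: continuous_subspaceT; exact: deriv_of_continuous Hh.
  by rewrite -subr_ge0 E mulr_ge0 ?subr_ge0 ?h0.
have h1 : G a - F a <= G b - F b.
  apply: (mono (fun x => G x - F x)); first exact: deriv_ofB.
  by move=> x /fg; rewrite ler_norml => /andP[]; lra.
have h2 : G a + F a <= G b + F b.
  apply: (mono (fun x => G x + F x)); first exact: deriv_ofD.
  by move=> x /fg; rewrite ler_norml => /andP[]; lra.
by rewrite ler_norml; lra.
Qed.

Lemma deriv_of_nondecreasing G g a b : a <= b -> deriv_of G g ->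
  (forall x, a <= x <= b -> 0 <= g x) -> G a <= G b.
Proof.
move=> ab Gg g0.
have h : `|0 - 0 : R| <= G b - G a.
  apply: (deriv_of_dominated ab (deriv_of_cst 0) Gg) => x /g0.
  by rewrite normr0.
by move: h; rewrite subrr normr0 subr_ge0.
Qed.

Lemma deriv_of_inj F G f : deriv_of F f -> deriv_of G f ->
  forall a, F a = G a -> F = G.
Proof.
move=> Ff Gf a FGa; apply/funext => x.
have D := deriv_ofB Ff Gf.
have E y z : y <= z -> F z - G z = F y - G y.
  move=> yz; have h : `|(F z - G z) - (F y - G y)| <= 0 - 0.
    apply: (deriv_of_dominated yz D (deriv_of_cst 0)) => w _.
    by rewrite subrr normr0.
  by move: h; rewrite subrr normr_le0 subr_eq0 => /eqP.
apply/eqP; rewrite -subr_eq0; apply/eqP.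
by have [/E ->|/ltW/E <-] := leP a x; rewrite FGa subrr.
Qed.

Lemma continuous_integrable_itv f a b : continuous f ->
  (@lebesgue_measure R).-integrable `[a, b] (EFin \o f).
Proof.
move=> cf; apply: continuous_compact_integrable; first exact: segment_compact.
exact: continuous_subspaceT.
Qed.

(** The fundamental theorem applies to integrals starting to the left of the point of
    differentiation, so the base point [N x] moves with x, to the left of both x and 0. The
    difference of the integrals up to x and up to 0 does not depend on it. *)
Lemma continuous_antiderivative f : continuous f ->
  exists F, deriv_of F f /\ F 0 = 0.
Proof.
move=> cf; pose mu := @lebesgue_measure R.
pose I (a x : R) : R := \int[mu]_(t in `[a, x]) f t.
pose N (x : R) := - (`|x| + 1).
pose F x := I (N x) x - I (N x) 0.
have key a b x : a <= b -> b <= x -> I a x = I a b + I b x.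
  move=> ab bx; rewrite -[LHS](subrK (I a b)) addrC; congr (_ + _).
  rewrite /I Rintegral_itvB ?bnd_simp//; last exact: continuous_integrable_itv.
  rewrite Rintegral_itv_obnd_cbnd//.
  apply: integrableS (continuous_integrable_itv b x cf) => //.
  exact: subset_itv_oc_cc.
have FE a x : a <= - `|x| - 1 -> F x = I a x - I a 0.
  move=> ax; rewrite /F (@key a (N x) x) ?(@key a (N x) 0)//.
  - by rewrite opprD addrACA subrr add0r.
  - by rewrite /N opprD.
  - by rewrite /N; have := normr_ge0 x; lra.
  - by rewrite /N opprD.
  - by rewrite /N; have := ler_norm (- x); rewrite normrN; lra.
exists F; split; last by rewrite /F subrr.
move=> x.
(* One unit to the left of [N x], so that [FE] applies with this fixed base point to all y within
   distance 1 of x. *)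
pose a := - `|x| - 2.
have [] := @continuous_FTC1_closed _ f a x (x + 1).
- by lra.
- exact: continuous_integrable_itv.
- by rewrite /a; have := ler_norm (- x); rewrite normrN; lra.
- exact: cf.
move=> dI IE.
have dD : is_derive x (1 : R) (fun y => I a y - I a 0) (f x).
  have dIa : is_derive x (1 : R) (I a) (f x).
    by apply: DeriveDef; [exact: dI|move: IE; rewrite derive1E].
  by have := is_deriveB dIa (deriv_of_cst (I a 0) x); rewrite subr0.
apply: near_eq_is_derive dD.
near=> y; rewrite (FE a)//.
rewrite /a.
have : `|y - x| < 1.
  near: y; apply/nbhs_ballP; exists 1 => //= z; by rewrite /ball/= distrC.
by have := ler_dist_dist y x; have := ler_norm (`|y| - `|x|); lra.
Unshelve. all: by end_near. Qed.

End Antiderivatives.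

Section Separable.
Context {R : realType}.

(** Finite sums of products a(x) b(y), an algebraic tensor product: measurability, local boundedness
    and integration in one variable reduce to continuous functions on R, without any theory of
    integrals depending on a parameter. *)
Inductive sep : (R -> R -> R) -> Prop :=
| sep_prod (a b : R -> R) : continuous a -> continuous b -> sep (fun x y => a x * b y)
| sep_add (h k : R -> R -> R) : sep h -> sep k -> sep (fun x y => h x y + k x y).

Lemma sep_ext h k : (forall x y, h x y = k x y) -> sep h -> sep k.
Proof.
move=> hk sh; suff <- : h = k by [].
by apply/funext => x; apply/funext => y.
Qed.

Lemma sep_left (a : R -> R) : continuous a -> sep (fun x y => a x).
Proof.
move=> ca; apply: (@sep_ext (fun x y => a x * (fun=> 1) y)).
  by move=> x y; rewrite mulr1.
by apply: sep_prod => //; exact: cst_continuous.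
Qed.

Lemma sep_right (b : R -> R) : continuous b -> sep (fun x y => b y).
Proof.
move=> cb; apply: (@sep_ext (fun x y => (fun=> 1) x * b y)).
  by move=> x y; rewrite mul1r.
by apply: sep_prod => //; exact: cst_continuous.
Qed.

Lemma sepM h k : sep h -> sep k -> sep (fun x y => h x y * k x y).
Proof.
elim=> [a b ca cb|h1 h2 _ ih1 _ ih2] sk.
  elim: sk => [a' b' ca' cb'|k1 k2 _ ih1 _ ih2].
    apply: (@sep_ext (fun x y => (a x * a' x) * (b y * b' y))).
      by move=> x y; rewrite mulrACA.
    by apply: sep_prod => x; [exact: continuousM (ca x) (ca' x)|
                              exact: continuousM (cb x) (cb' x)].
  apply: sep_ext (sep_add ih1 ih2) => x y; by rewrite -mulrDr.
apply: sep_ext (sep_add (ih1 sk) (ih2 sk)) => x y; by rewrite mulrDl.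
Qed.

Lemma sepZ c h : sep h -> sep (fun x y => c * h x y).
Proof. by move=> sh; apply: (sepM (sep_left _) sh); exact: cst_continuous. Qed.

Lemma sepB h k : sep h -> sep k -> sep (fun x y => h x y - k x y).
Proof.
move=> sh sk; apply: sep_ext (sep_add sh (sepZ (-1) sk)) => x y.
by rewrite mulN1r.
Qed.

Lemma sepX n h : sep h -> sep (fun x y => h x y ^+ n).
Proof.
move=> sh; elim: n => [|n ih].
  by apply: (@sep_ext (fun=> fun=> 1)) => //; apply: sep_left; exact: cst_continuous.
by apply: sep_ext (sepM sh ih) => x y; rewrite exprS.
Qed.

Lemma sep_swap h : sep h -> sep (fun x y => h y x).
Proof.
elim=> [a b ca cb|h1 h2 _ ih1 _ ih2]; last exact: sep_add.
by apply: sep_ext (sep_prod cb ca) => x y; rewrite mulrC.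
Qed.

Lemma sep_sum (I : Type) (s : seq I) (h : I -> R -> R -> R) :
  (forall i, sep (h i)) -> sep (fun x y => \sum_(i <- s) h i x y).
Proof.
move=> sh; elim: s => [|i s ih].
  apply: (@sep_ext (fun=> fun=> 0)); first by move=> x y; rewrite big_nil.
  by apply: sep_left; exact: cst_continuous.
by apply: sep_ext (sep_add (sh i) ih) => x y; rewrite big_cons.
Qed.

Lemma sep_continuousl h : sep h -> forall y, continuous (h^~ y).
Proof.
elim=> [a b ca cb|h1 h2 _ ih1 _ ih2] y x.
  by apply: continuousM; [exact: ca|exact: cst_continuous].
by apply: continuousD; [exact: ih1|exact: ih2].
Qed.

(** For a(x) b(y) and P' = a, take b(y) (P x - P y). Vanishing on the diagonal normalizes Q to the
    integral from y to x, as for Kruzhkov's entropy fluxes. *)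
Lemma sep_antiderivative h : sep h -> exists Q, [/\ sep Q,
  forall y, deriv_of (Q^~ y) (h^~ y) & forall y, Q y y = 0].
Proof.
elim=> [a b ca cb|h1 h2 _ [Q1 [s1 d1 z1]] _ [Q2 [s2 d2 z2]]].
  have [P [dP _]] := continuous_antiderivative ca.
  have cP := deriv_of_continuous dP.
  exists (fun x y => b y * (P x - P y)); split.
  - by apply: sepM; [exact: sep_right|apply: sepB; [exact: sep_left|exact: sep_right]].
  - move=> y; have := deriv_ofZ (b y) (deriv_ofB dP (deriv_of_cst (P y))).
    by move/deriv_of_ext; apply => x; rewrite subr0 mulrC.
  - by move=> y; rewrite subrr mulr0.
exists (fun x y => Q1 x y + Q2 x y); split; first exact: sep_add.
- by move=> y; exact: deriv_ofD.
- by move=> y; rewrite z1 z2 addr0.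
Qed.

Lemma continuous_bounded_itv (a : R -> R) (M : R) : continuous a ->
  exists C, 0 <= C /\ forall x, `|x| <= M -> `|a x| <= C.
Proof.
move=> ca.
have cna : continuous (fun x => `|a x|).
  by move=> x; apply: continuous_comp; [exact: ca|exact: norm_continuous].
have [M0|M0] := ltP M 0.
  by exists 0; split => // x xM; have := normr_ge0 x; lra.
have [||c _ ac] := @EVT_max R (fun x => `|a x|) (- M) M.
- by lra.
- exact: continuous_subspaceT.
exists `|a c|; split => // x; rewrite ler_norml => xM; apply: ac.
by rewrite in_itv.
Qed.

Lemma sep_bounded h (M : R) : sep h ->
  exists C, forall x y, `|x| <= M -> `|y| <= M -> `|h x y| <= C.
Proof.
elim=> [a b ca cb|h1 h2 _ [C1 H1] _ [C2 H2]].
  have [C1 [_ H1]] := continuous_bounded_itv M ca.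
  have [C2 [_ H2]] := continuous_bounded_itv M cb.
  exists (C1 * C2) => x y xM yM.
  by rewrite normrM ler_pM//; [exact: H1|exact: H2].
exists (C1 + C2) => x y xM yM.
by rewrite (le_trans (ler_normD _ _))// lerD//; [exact: H1|exact: H2].
Qed.

Lemma sep_measurable h d (T : measurableType d) (D : set T) (u v : T -> R) :
  sep h -> measurable_fun D u -> measurable_fun D v ->
  measurable_fun D (fun p => h (u p) (v p)).
Proof.
move=> + mu mv; elim=> [a b ca cb|h1 h2 _ ih1 _ ih2].
  apply: measurable_funM.
  - by apply: measurableT_comp mu; exact: continuous_measurable_fun.
  - by apply: measurableT_comp mv; exact: continuous_measurable_fun.
exact: measurable_funD.
Qed.

End Separable.

(** * Smooth convex approximations of the absolute value *)

Section EntropyKernel.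
Context {R : realType}.
Implicit Types (eta F f : R -> R).

(** [eta] replaces the absolute value on [-B, B], where B will be 2M, a bound for |u - v|, and [e]
    bounds the defect there. To the right of B no bound is claimed, which leaves room for a
    polynomial eta''. The one-sided bounds suffice by parity, and eta <= |.| on [-B, B] follows from
    eta' <= 1. *)
Record kernel (B e : R) (eta eta1 eta2 : R -> R) : Prop := Kernel {
  kernel_deriv : deriv_of eta eta1;
  kernel_deriv1 : deriv_of eta1 eta2;
  kernel_ge0 : forall z, 0 <= eta2 z;
  kernel2N : forall z, eta2 (- z) = eta2 z;
  kernel1N : forall z, eta1 (- z) = - eta1 z;
  kernelN : forall z, eta (- z) = eta z;
  kernel0 : eta 0 = 0;
  kernel1_le1 : forall z, z <= B -> eta1 z <= 1;
  kernel_close : forall z, 0 <= z <= B -> z - eta z <= e;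
  kernel_sep : sep (fun x y => eta (x - y));
  kernel_sep1 : sep (fun x y => eta1 (x - y));
  kernel_sep2 : sep (fun x y => eta2 (x - y));
  kernel_cont : continuous eta2 }.

Lemma deriv_of_even F f : deriv_of F f -> F 0 = 0 -> (forall z, f (- z) = f z) ->
  forall z, F (- z) = - F z.
Proof.
move=> dF F0 fe z.
have d1 : deriv_of (fun z => F (0 - z)) (fun z => - f z).
  by apply: deriv_of_ext (deriv_of_refl 0 dF) _ => x; rewrite sub0r fe.
have := @deriv_of_inj _ _ _ _ d1 (deriv_ofN dF) 0.
rewrite subr0 F0 oppr0 => /(_ erefl) E.
by have := congr1 (fun h => h z) E; rewrite /= sub0r.
Qed.

Lemma deriv_of_odd F f : deriv_of F f -> (forall z, f (- z) = - f z) ->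
  forall z, F (- z) = F z.
Proof.
move=> dF fo z.
have d1 : deriv_of (fun z => F (0 - z)) f.
  by apply: deriv_of_ext (deriv_of_refl 0 dF) _ => x; rewrite sub0r fo opprK.
have := @deriv_of_inj _ _ _ _ d1 dF 0.
rewrite subr0 => /(_ erefl) E.
by have := congr1 (fun h => h z) E; rewrite /= sub0r.
Qed.

Lemma sep_shift_antiderivative F f : deriv_of F f -> F 0 = 0 ->
  sep (fun x y => f (x - y)) -> sep (fun x y => F (x - y)).
Proof.
move=> dF F0 /sep_antiderivative[Q [sQ dQ Q0]].
apply: sep_ext sQ => x y.
have := @deriv_of_inj _ _ _ _ (dQ y) (deriv_of_shift y dF) y.
rewrite subrr F0 => /(_ (Q0 y)) E.
by have := congr1 (fun h => h x) E.
Qed.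

(** When eta 0 = 0 the primitive is the first moment of eta'' over [0, z], integrated by parts. At z
    = B with eta' B = 1 it equals the defect B - eta B, and it also measures the error of freezing a
    Lipschitz factor under eta''. *)
Lemma deriv_of_moment eta eta1 eta2 : deriv_of eta eta1 -> deriv_of eta1 eta2 ->
  deriv_of (fun z => z * eta1 z - eta z) (fun z => z * eta2 z).
Proof.
move=> d0 d1; apply: deriv_of_ext (deriv_ofB (deriv_ofM deriv_of_id d1) d0) _.
by move=> z; rewrite mul1r addrK.
Qed.

Lemma bernoulli_ineq (x : R) n : 0 <= x <= 1 -> 1 - n%:R * x <= (1 - x) ^+ n.
Proof.
move=> /andP[x0 x1]; elim: n => [|n ih]; first by rewrite mul0r subr0 expr0.
rewrite exprS -natr1.
have h : (1 - x) * (1 - n%:R * x) <= (1 - x) * (1 - x) ^+ n.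
  by rewrite ler_wpM2l// subr_ge0.
apply: le_trans h; have := mulr_ge0 (ler0n R n) (mulr_ge0 x0 x0); nra.
Qed.

(* eta'' is a multiple of (1 - (z/B)^2)^(2n^2): its mass concentrates near 0
   on [-B, B], and being a polynomial it makes eta (x - y) separable. *)
Lemma kernel_exists (B e : R) : 0 < B -> 0 < e ->
  exists eta eta1 eta2, kernel B e eta eta1 eta2.
Proof.
move=> B0 e0.
(* The defect at B will come out as at most B / (n + 1). *)
have [n nBe] : exists n : nat, B / e < n.+1%:R.
  by exists (Num.truncn (B / e)); rewrite truncnS_gt.
have {}nBe : B / n.+1%:R <= e.
  by rewrite ler_pdivrMr// mulrC -ler_pdivrMr// ltW.
have n1 : 1 <= n.+1%:R :> R by rewrite ler1n.
have Nne : n.+1%:R != 0 :> R by rewrite pnatr_eq0.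
pose m := (n.+1 ^ 2)%N.
pose b (z : R) : R := 1 - (z / B) ^+ 2.
pose phi (z : R) : R := (b z ^+ 2) ^+ m.
have db : deriv_of b (fun z => - (2 * z / B ^+ 2)).
  have := deriv_ofB (deriv_of_cst 1)
    (deriv_ofX 1 (deriv_of_comp_affine B^-1 0 deriv_of_id)).
  have -> : (fun x => 1 - id (B^-1 * x + 0) ^+ 2) = b.
    by apply/funext => x; rewrite /b addr0 mulrC.
  move/deriv_of_ext; apply => x; rewrite /= expr1 addr0 mulr1 sub0r.
  by congr (- _); rewrite expr2 invfM; ring.
have cphi : continuous phi.
  have db2 := deriv_ofX m.-1 (deriv_ofX 1 db).
  have : continuous (fun x => (b x ^+ 2) ^+ m.-1.+1) := deriv_of_continuous db2.
  by rewrite prednK ?expn_gt0.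
have [P [dP P0]] := continuous_antiderivative cphi.
have phi0 z : 0 <= phi z by rewrite exprn_ge0// sqr_ge0.
have phiN z : phi (- z) = phi z by rewrite /phi /b mulNr sqrrN.
have sphi : sep (fun x y => phi (x - y)).
  apply: sepX; apply: sepX; apply: sepB; first by apply: sep_left; exact: cst_continuous.
  apply: sepX; apply: sep_ext (sepZ B^-1 (sepB (sep_left (fun x => cvg_id)) (sep_right (fun x => cvg_id)))).
  by move=> x y; rewrite mulrC.
(* On [0, w] with w = B / (2 (n + 1)), Bernoulli's inequality gives phi x >= 1 - 2m (x/B)^2 >= 1/2,
   since m = (n + 1)^2. Hence P B >= w / 2. *)
have PB : B / (4 * n.+1%:R) <= P B.
  pose w := B / (2 * n.+1%:R).
  have w0 : 0 <= w by rewrite divr_ge0// ltW.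
  have wB : w <= B.
    by rewrite /w ler_pdivrMr// ler_peMr ?(ltW B0)//; lra.
  have PwB : P w <= P B by apply: (deriv_of_nondecreasing wB dP) => x _.
  apply: le_trans PwB.
  have := @deriv_of_nondecreasing _ _ _ 0 w w0
    (deriv_ofB dP (deriv_of_comp_affine 2^-1 0 deriv_of_id)).
  rewrite P0 /= mulr0 addr0 !subr0 => h.
  rewrite -subr_ge0; have -> : B / (4 * n.+1%:R) = 2^-1 * w + 0.
    rewrite /w addr0 !invfM; have -> : (4 : R) = 2 * 2 by lra.
    by rewrite invfM; ring.
  apply: h => x /andP[x0 xw].
  rewrite mulr1 /phi -exprM subr_ge0.
  have t01 : 0 <= (x / B) ^+ 2 <= 1.
    rewrite sqr_ge0 expr_le1//; last by rewrite divr_ge0// ltW.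
    by rewrite ler_pdivrMr// mul1r (le_trans xw).
  apply: le_trans (bernoulli_ineq (2 * m) t01).
  have -> : (2^-1 : R) = 1 - 2^-1 by lra.
  rewrite lerD2l lerN2.
  have xB : x / B <= (2 * n.+1%:R)^-1.
    by rewrite ler_pdivrMr// mulrC.
  have : (x / B) ^+ 2 <= ((2 * n.+1%:R)^-1) ^+ 2.
    by rewrite lerXn2r// nnegrE ?invr_ge0// divr_ge0// ltW.
  move/(ler_wpM2l (ler0n R (2 * m))) => /le_trans; apply.
  rewrite natrM natrX le_eqVlt; apply/orP; left; apply/eqP.
  by move: Nne; move: (n.+1%:R : R) => N Nne; field.
have PB0 : 0 < P B.
  by apply: lt_le_trans PB; rewrite divr_gt0// mulr_gt0.
pose c := (P B)^-1.
have c0 : 0 <= c by rewrite invr_ge0 ltW.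
pose eta1 z := c * P z; pose eta2 z := c * phi z.
have d1 : deriv_of eta1 eta2 by exact: deriv_ofZ.
have [eta [d0 eta0]] := continuous_antiderivative (deriv_of_continuous d1).
have eta2N z : eta2 (- z) = eta2 z by rewrite /eta2 phiN.
have eta10 : eta1 0 = 0 by rewrite /eta1 P0 mulr0.
have eta1N := deriv_of_even d1 eta10 eta2N.
have sep2 : sep (fun x y => eta2 (x - y)) by exact: sepZ.
have sep1 := sep_shift_antiderivative d1 eta10 sep2.
have le1 z : z <= B -> eta1 z <= 1.
  move=> zB; have -> : 1 = eta1 B by rewrite /eta1 mulVf// gt_eqF.
  by apply: (deriv_of_nondecreasing zB d1) => x _; rewrite mulr_ge0.
exists eta, eta1, eta2; split => //.
- by move=> z; rewrite mulr_ge0.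
- exact: deriv_of_odd d0 eta1N.
- move=> z /andP[z0 zB].
  have h1 : z - eta z <= B - eta B.
    apply: (@deriv_of_nondecreasing _ (fun z => z - eta z) _ _ _ zB
      (deriv_ofB deriv_of_id d0)) => x /andP[_ xB].
    by rewrite subr_ge0 le1.
  apply: le_trans h1 _.
  have dm := deriv_of_moment d0 d1.
  (* As b' = -2z / B^2, the function -k b^(2m+1) is a primitive of z b^(2m). The first moment over
     [0, B] is therefore c k: k is of order 1/n^2 while P B is at least of order 1/n, so the
     quotient is of order 1/n. *)
  pose k : R := B ^+ 2 / (2 * (2 * m).+1%:R).
  have dK : deriv_of (fun z => - (c * k) * b z ^+ (2 * m).+1) (fun z => z * eta2 z).
    apply: deriv_of_ext (deriv_ofZ (- (c * k)) (deriv_ofX (2 * m) db)) _ => x.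
    rewrite /eta2 /phi -exprM.
    rewrite /k; field.
    rewrite gt_eqF//= pnatr_eq0//=.
  have E : (fun z => - (c * k) * b z ^+ (2 * m).+1 + c * k) =
           (fun z => z * eta1 z - eta z).
    apply: (@deriv_of_inj _ _ _ (fun z => z * eta2 z + 0) _ _ 0).
    - exact: deriv_ofD dK (deriv_of_cst _).
    - by apply: deriv_of_ext dm _ => x; rewrite addr0.
    - rewrite mul0r eta0 subr0 /b mul0r expr0n/= subr0 expr1n mulr1.
      by rewrite addNr.
  have /= := congr1 (fun h => h B) E.
  rewrite /b divff ?gt_eqF// expr1n subrr expr0n mulr0 add0r.
  rewrite /eta1 mulVf ?gt_eqF// mulr1 => <-.
  apply: le_trans nBe.
  rewrite /c mulrC ler_pdivrMr//.
  have n0 : 0 < n.+1%:R :> R by rewrite ltr0n.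
  apply: (@le_trans _ _ (B / n.+1%:R * (B / (4 * n.+1%:R)))); last first.
    by rewrite ler_wpM2l// divr_ge0// ltW.
  rewrite /k; have -> : B / n.+1%:R * (B / (4 * n.+1%:R)) = B ^+ 2 / (4 * n.+1%:R ^+ 2).
    by move: Nne; move: (n.+1%:R : R) => N Nne; field.
  rewrite ler_wpM2l ?sqr_ge0// lef_pV2 ?posrE ?mulr_gt0 ?exprn_gt0//.
  have -> : (2 * m).+1%:R = 2 * n.+1%:R ^+ 2 + 1 :> R by rewrite -natr1 natrM natrX.
  by have := sqr_ge0 (n.+1%:R : R); lra.
- exact: sep_shift_antiderivative d0 eta0 sep1.
- exact: (sep_continuousl (y := 0) (sepZ c (sep_left cphi))).
Qed.

Lemma kernel_abs B e eta eta1 eta2 : kernel B e eta eta1 eta2 ->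
  forall z, `|z| <= B -> `| `|z| - eta z | <= e.
Proof.
move=> K z zB.
have -> : eta z = eta `|z|.
  by have [z0|z0] := leP 0 z; [rewrite ger0_norm|rewrite ltr0_norm// (kernelN K)].
rewrite ger0_norm; first by apply: (kernel_close K); rewrite normr_ge0.
rewrite subr_ge0.
have := @deriv_of_nondecreasing _ (fun z => z - eta z) _ 0 `|z| (normr_ge0 z)
  (deriv_ofB deriv_of_id (kernel_deriv K)).
rewrite (kernel0 K) !subr0 subr_ge0; apply => x /andP[_ xz].
by rewrite subr_ge0 (kernel1_le1 K)// (le_trans xz).
Qed.

End EntropyKernel.

(** * Flux and diffusion estimates for one smoothed entropy *)

Section EntropyEstimates.
Context {R : realType}.

(** The tangent at p = l x + (1 - l) y lies below eta because eta' is monotone; average the tangent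
    inequality at x and y. *)
Lemma convex_of_deriv2 (eta eta1 eta2 : R -> R) :
  deriv_of eta eta1 -> deriv_of eta1 eta2 -> (forall x, 0 <= eta2 x) ->
  convex_real eta.
Proof.
move=> d0 d1 pos x y l /andP[l0 l1]; set p := l * x + (1 - l) * y.
have incr a b : a <= b -> eta1 a <= eta1 b.
  by move=> ab; apply: (deriv_of_nondecreasing ab d1) => z _.
have tangent z : eta p + eta1 p * (z - p) <= eta z.
  have dg := deriv_ofB d0 (deriv_ofZ (eta1 p) deriv_of_id).
  have [pz|/ltW zp] := leP p z.
    have := @deriv_of_nondecreasing _ _ _ _ _ pz dg; rewrite /= => h.
    suff : eta p - eta1 p * p <= eta z - eta1 p * z by rewrite mulrBr; lra.
    by apply: h => w /andP[pw _]; rewrite mulr1 subr_ge0 incr.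
  have := @deriv_of_nondecreasing _ _ _ _ _ zp (deriv_ofN dg); rewrite /= => h.
  suff : - (eta z - eta1 p * z) <= - (eta p - eta1 p * p) by rewrite mulrBr; lra.
  by apply: h => w /andP[_ pw]; rewrite mulr1 opprB subr_ge0 incr.
have hx := ler_wpM2l l0 (tangent x).
have l1' : 0 <= 1 - l by rewrite subr_ge0.
have hy := ler_wpM2l l1' (tangent y).
apply: le_trans (lerD hx hy).
rewrite le_eqVlt; apply/orP; left; apply/eqP; rewrite /p; ring.
Qed.

Lemma C2_of_deriv2 (eta eta1 eta2 : R -> R) :
  deriv_of eta eta1 -> deriv_of eta1 eta2 -> continuous eta2 -> C2_real eta.
Proof.
move=> d0 d1 c2; split; first exact: deriv_of_derivable d0.
rewrite (deriv_ofE d0); split; first exact: deriv_of_derivable d1.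
by rewrite (deriv_ofE d1).
Qed.

Variables (M e : R) (eta eta1 eta2 : R -> R).
Hypothesis K : kernel (2 * M) e eta eta1 eta2.

(** For v <= u the difference is the integral over [v, u] of (eta'(x - v) - eta'(u - x)) h(x). Two
    numbers a, b <= 1 satisfy |a - b| <= 2 - a - b, so the integrand is dominated by C (2 - eta'(x -
    v) - eta'(u - x)), whose integral is 2C (u - v - eta(u - v)) <= 2Ce. *)
Lemma kernel_flux_symm (Q : R -> R -> R) (h : R -> R) (C : R) :
  (forall c, deriv_of (Q^~ c) (fun x => eta1 (x - c) * h x)) ->
  (forall c, Q c c = 0) -> (forall x, `|x| <= M -> `|h x| <= C) ->
  forall u v, `|u| <= M -> `|v| <= M -> `|Q u v - Q v u| <= 2 * C * e.
Proof.
move=> dQ Q0 hC.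
suff wlg u v : v <= u -> `|u| <= M -> `|v| <= M -> `|Q u v - Q v u| <= 2 * C * e.
  by move=> u v uM vM; have [/wlg|/ltW/wlg] := leP v u; [|rewrite distrC]; apply.
move=> vu uM vM.
have dF := deriv_ofD (dQ v) (dQ u).
have dG := deriv_ofZ C (deriv_ofB (deriv_ofZ 2 deriv_of_id)
  (deriv_ofB (deriv_of_shift v (kernel_deriv K)) (deriv_of_refl u (kernel_deriv K)))).
have C0 : 0 <= C by apply: le_trans (normr_ge0 (h u)) (hC u uM).
have := deriv_of_dominated vu dF dG.
rewrite /= !Q0 !subrr (kernel0 K) add0r addr0 => H.
have /andP[u1 u2] : - M <= u <= M by rewrite -ler_norml.
have /andP[v1 v2] : - M <= v <= M by rewrite -ler_norml.
apply: (le_trans (H _)) => [x /andP[vx xu]|].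
  have xM : `|x| <= M by rewrite ler_norml; lra.
  rewrite -mulrDl normrM mulrC.
  apply: ler_pM => //; first exact: hC.
  have -> : eta1 (x - u) = - eta1 (u - x) by rewrite -(kernel1N K) opprB.
  have a1 : eta1 (x - v) <= 1 by apply: (kernel1_le1 K); lra.
  have a2 : eta1 (u - x) <= 1 by apply: (kernel1_le1 K); lra.
  by rewrite ler_norml; lra.
have cl : u - v - eta (u - v) <= e by apply: (kernel_close K); lra.
rewrite -mulrBr -mulrA mulrCA ler_wpM2l//; lra.
Qed.

(** With s frozen at z, Bf x z would be eta'(x - z) s z; the Lipschitz bound makes the error at most
    L times the first moment of eta'', hence at most L e. Integrating against s', Rf v u is then
    close to the integral of eta'(u - w) s w s' w for w from u to v, which is - Q v u since eta' is
    odd. This is how the cross term, after two uses of the chain rule, cancels the diffusion. *)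
Lemma kernel_mixed (Bf Rf Q : R -> R -> R) (s s' : R -> R) (C L : R) :
  (forall z, deriv_of (Bf^~ z) (fun x => eta2 (x - z) * s x)) ->
  (forall z, Bf z z = 0) ->
  (forall x, deriv_of (Rf^~ x) (fun z => Bf x z * s' z)) ->
  (forall x, Rf x x = 0) ->
  (forall c, deriv_of (Q^~ c) (fun x => eta1 (x - c) * (s x * s' x))) ->
  (forall c, Q c c = 0) ->
  (forall x, `|x| <= M -> `|s' x| <= C) -> 0 <= L ->
  (forall x y, `|x| <= M -> `|y| <= M -> `|s x - s y| <= L * `|x - y|) ->
  forall u v, `|u| <= M -> `|v| <= M -> `|Rf v u + Q v u| <= 2 * M * (C * (L * e)).
Proof.
move=> dB B0 dR R0 dQ Q0 sC L0 sL.
have eta10 : eta1 0 = 0.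
  by have := kernel1N K 0; rewrite oppr0 => /eqP; rewrite -subr_eq0 opprK -mulr2n mulrn_eq0/= => /eqP.
have bd x z : `|x| <= M -> `|z| <= M -> `|Bf x z - eta1 (x - z) * s z| <= L * e.
  move=> xM zM.
  have dF := deriv_ofB (dB z) (deriv_ofM (deriv_of_shift z (kernel_deriv1 K)) (deriv_of_cst (s z))).
  pose m y := (y - z) * eta1 (y - z) - eta (y - z).
  have dm : deriv_of m (fun y => (y - z) * eta2 (y - z)).
    exact: deriv_of_shift (deriv_of_moment (kernel_deriv K) (kernel_deriv1 K)).
  have m0 : m z = 0 by rewrite /m subrr (kernel0 K) mul0r subrr.
  have /andP[x1 x2] : - M <= x <= M by rewrite -ler_norml.
  have /andP[z1 z2] : - M <= z <= M by rewrite -ler_norml.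
  have mle : m x <= e.
    have meven : m x = `|x - z| * eta1 `|x - z| - eta `|x - z|.
      rewrite /m; have [xz|xz] := leP 0 (x - z); first by rewrite ger0_norm.
      by rewrite ltr0_norm// (kernelN K) (kernel1N K) mulrNN.
    have xzB : `|x - z| <= 2 * M by rewrite ler_norml; lra.
    rewrite meven; apply: le_trans (kernel_close K (z := `|x - z|) _); last by rewrite normr_ge0.
    by rewrite lerD2r ler_piMr// (kernel1_le1 K).
  have bound w : `|w| <= M ->
      `|eta2 (w - z) * s w - ((eta1 (w - z)) * 0 + eta2 (w - z) * s z)| <=
      L * (`|w - z| * eta2 (w - z)).
    move=> wM; rewrite mulr0 add0r -mulrBr normrM ger0_norm ?(kernel_ge0 K)//.
    by rewrite mulrA mulrC ler_wpM2r ?(kernel_ge0 K)// sL.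
  have [zx|/ltW xz] := leP z x.
    have := deriv_of_dominated zx dF (deriv_ofZ L dm).
    rewrite B0 subrr eta10 mul0r !subr0 m0 mulr0 subr0 => H.
    apply: le_trans; last by apply: (ler_wpM2l L0 mle).
  apply: H => //.
    move=> w /andP[zw wx]; apply: le_trans (bound w _) _; first by rewrite ler_norml; lra.
    by rewrite ger0_norm// subr_ge0.
  have := deriv_of_dominated xz dF (deriv_ofZ (- L) dm).
  rewrite B0 subrr eta10 mul0r subrr m0 mulr0 sub0r sub0r normrN mulNr opprK => H.
  apply: le_trans; last by apply: (ler_wpM2l L0 mle).
  apply: H => //.
  move=> w /andP[zw wx]; apply: le_trans (bound w _) _; first by rewrite ler_norml; lra.
  by rewrite ler0_norm ?subr_le0// mulNr mulrN mulNr.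
move=> u v uM vM.
have M0 : 0 <= M by apply: le_trans uM.
have C0 : 0 <= C by apply: le_trans (normr_ge0 (s' u)) (sC u uM).
have Le0 : 0 <= L * e.
  by apply: le_trans (bd u u uM uM); rewrite normr_ge0.
have dF := deriv_ofD (dR u) (dQ u).
have dG := deriv_ofZ (C * (L * e)) deriv_of_id.
have bound w : `|w| <= M -> `|Bf u w * s' w + eta1 (w - u) * (s w * s' w)| <= C * (L * e).
  move=> wM; have -> : eta1 (w - u) = - eta1 (u - w) by rewrite -(kernel1N K) opprB.
  rewrite mulrA mulNr -mulrDl mulrC normrM ler_pM//; first exact: sC.
  exact: bd.
have /andP[u1 u2] : - M <= u <= M by rewrite -ler_norml.
have /andP[v1 v2] : - M <= v <= M by rewrite -ler_norml.
have CL0 : 0 <= C * (L * e) by rewrite mulr_ge0.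
have [uv|/ltW vu] := leP u v.
  have := deriv_of_dominated uv dF dG.
  rewrite R0 Q0 addr0 subr0 -mulrBr/= => H.
  have : `|Rf v u + Q v u| <= C * (L * e) * (v - u).
    apply: H => w /andP[uw wv]; rewrite mulr1; apply: bound.
    by rewrite ler_norml; lra.
  by move=> /le_trans; apply; rewrite [leRHS]mulrC ler_wpM2l//; lra.
have := deriv_of_dominated vu dF dG.
rewrite R0 Q0 addr0 sub0r normrN -mulrBr/= => H.
have : `|Rf v u + Q v u| <= C * (L * e) * (u - v).
  apply: H => w /andP[uw wv]; rewrite mulr1; apply: bound.
  by rewrite ler_norml; lra.
move=> /le_trans; apply; rewrite [leRHS]mulrC ler_wpM2l//; lra.
Qed.

End EntropyEstimates.

(** * Entropies together with their fluxes and chain-rule functions *)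

Section EntropyFamily.
Context {R : realType} (n : nat).
Implicit Types (f a : R -> R).

Lemma finite_bound (I : finType) (P : I -> R -> Prop) :
  (forall i, exists C, 0 <= C /\ P i C) ->
  (forall i C C', C <= C' -> P i C -> P i C') ->
  exists C, 0 <= C /\ forall i, P i C.
Proof.
move=> /choice[C HC] mono; exists (\sum_i C i); split.
  by apply: sumr_ge0 => i _; have [] := HC i.
move=> i; apply: mono (HC i).2; rewrite (bigD1 i)//= lerDl.
by apply: sumr_ge0 => j _; have [] := HC j.
Qed.

Lemma lipschitz_of_deriv (s ds : R -> R) (M : R) : deriv_of s ds -> continuous ds ->
  exists L, 0 <= L /\
    forall x y, `|x| <= M -> `|y| <= M -> `|s x - s y| <= L * `|x - y|.
Proof.
move=> dss /(continuous_bounded_itv M)[L [L0 HL]]; exists L; split => //.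
suff wlg x y : y <= x -> `|x| <= M -> `|y| <= M -> `|s x - s y| <= L * `|x - y|.
  move=> x y xM yM; have [yx|/ltW xy] := leP y x; first exact: wlg.
  by rewrite (distrC (s x)) (distrC x); exact: wlg.
move=> yx xM yM; rewrite [in leRHS]ger0_norm ?subr_ge0// mulrBr.
apply: (deriv_of_dominated yx dss (deriv_ofZ L deriv_of_id)) => z /andP[yz zx].
rewrite mulr1; apply: HL.
have /andP[x1 x2] : - M <= x <= M by rewrite -ler_norml.
have /andP[y1 y2] : - M <= y <= M by rewrite -ler_norml.
by rewrite ler_norml; lra.
Qed.

Variables (f' : 'I_n -> R -> R) (sigma dsigma : 'I_n -> 'I_n -> R -> R).
Hypothesis cf' : forall i, continuous (f' i).
Hypothesis dsigmaP : forall i k, deriv_of (sigma i k) (dsigma i k).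
Hypothesis cdsigma : forall i k, continuous (dsigma i k).

(** [q] and [r] are the fluxes of the entropy eta(. - c). [b] is the chain-rule function for psi =
    eta''(. - c), and [rho i k j l] the one for psi = b i k c, to be applied to the other solution.
    The sum in [ef_rsymm] is the total coefficient of the second derivatives of the test function
    once everything is added up. *)
Record entropy_family (M e C : R) (eta eta1 eta2 : R -> R)
  (q : 'I_n -> R -> R -> R) (r b : 'I_n -> 'I_n -> R -> R -> R)
  (rho : 'I_n -> 'I_n -> 'I_n -> 'I_n -> R -> R -> R) : Prop := EntropyFamily {
  ef_kernel : kernel (2 * M) e eta eta1 eta2;
  ef_qsep : forall i, sep (q i);
  ef_q : forall i c, deriv_of (q i ^~ c) (fun x => eta1 (x - c) * f' i x);
  ef_rsep : forall i j, sep (r i j);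
  ef_r : forall i j c, deriv_of (r i j ^~ c)
    (fun x => eta1 (x - c) * \sum_k sigma i k x * sigma j k x);
  ef_bsep : forall i k, sep (b i k);
  ef_b : forall i k c, deriv_of (b i k ^~ c) (fun x => eta2 (x - c) * sigma i k x);
  ef_rhosep : forall i k j l, sep (rho i k j l);
  ef_rho : forall i k j l c, deriv_of (rho i k j l ^~ c)
    (fun z => b i k c z * sigma j l z);
  ef_qsymm : forall i x y, `|x| <= M -> `|y| <= M ->
    `|q i x y - q i y x| <= C * e;
  ef_rsymm : forall i j x y, `|x| <= M -> `|y| <= M ->
    `|r i j x y + r i j y x + 2 * \sum_k rho i k j k y x| <= C * e }.

Lemma entropy_family_exists (M : R) : 0 < M -> exists C, 0 <= C /\
  forall e, 0 < e -> exists eta eta1 eta2 q r b rho,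
    entropy_family M e C eta eta1 eta2 q r b rho.
Proof.
move=> M0.
have csigma i k : continuous (sigma i k) := deriv_of_continuous (@dsigmaP i k).
have [Cf [Cf0 HCf]] : exists C, 0 <= C /\
    forall i, forall x, `|x| <= M -> `|f' i x| <= C.
  apply: (@finite_bound _ (fun i C => forall x, `|x| <= M -> `|f' i x| <= C)).
    by move=> i; have [C [C0 HC]] := continuous_bounded_itv M (@cf' i); exists C.
  by move=> i C C' CC' HC x /HC/le_trans; apply.
have [Cs [Cs0 HCs]] : exists C, 0 <= C /\
    forall ik : 'I_n * 'I_n, forall x, `|x| <= M -> `|sigma ik.1 ik.2 x| <= C.
  apply: (@finite_bound _ (fun ik C => forall x, `|x| <= M -> `|sigma ik.1 ik.2 x| <= C)).
    move=> i; have [C [C0 HC]] := continuous_bounded_itv M (@csigma i.1 i.2).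
    by exists C.
  by move=> i C C' CC' HC x /HC/le_trans; apply.
have [L [L0 HL]] : exists C, 0 <= C /\
    forall ik : 'I_n * 'I_n, forall x y, `|x| <= M -> `|y| <= M ->
    `|sigma ik.1 ik.2 x - sigma ik.1 ik.2 y| <= C * `|x - y|.
  apply: (@finite_bound _ (fun ik C => forall x y, `|x| <= M -> `|y| <= M ->
    `|sigma ik.1 ik.2 x - sigma ik.1 ik.2 y| <= C * `|x - y|)).
    by move=> i; exact: lipschitz_of_deriv (@dsigmaP i.1 i.2) (@cdsigma i.1 i.2).
  move=> i C C' CC' HC x y xM yM; apply: le_trans (HC _ _ xM yM) _.
  by rewrite ler_wpM2r.
(* Error of one index k in the diffusion: the flux asymmetry for sigma_ik sigma_jk, plus twice the
   error of [kernel_mixed]. *)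
pose D := 2 * (Cs * Cs) + 2 * (2 * M * (Cs * L)).
have D0 : 0 <= D by rewrite /D addr_ge0// !mulr_ge0// ltW.
exists (2 * Cf + n%:R * D); split; first by rewrite addr_ge0// mulr_ge0.
move=> e e0.
have [|eta [eta1 [eta2 K]]] := @kernel_exists R (2 * M) e _ e0; first by rewrite mulr_gt0.
have sg i k : sep (fun x c => sigma i k x) by exact: sep_left.
have /choice[q Hq] : forall i, exists Q, [/\ sep Q,
    (forall c, deriv_of (Q^~ c) (fun x => eta1 (x - c) * f' i x)) &
    forall c, Q c c = 0].
  by move=> i; exact: sep_antiderivative (sepM (kernel_sep1 K) (sep_left (@cf' i))).
have /choice[r0 Hr0] : forall ijk : 'I_n * 'I_n * 'I_n, exists Q, [/\ sep Q,
    (forall c, deriv_of (Q^~ c)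
     (fun x => eta1 (x - c) * (sigma ijk.1.1 ijk.2 x * sigma ijk.1.2 ijk.2 x))) &
    forall c, Q c c = 0].
  by move=> i; exact: sep_antiderivative (sepM (kernel_sep1 K) (sepM (sg _ _) (sg _ _))).
have /choice[b Hb] : forall ik : 'I_n * 'I_n, exists Q, [/\ sep Q,
    (forall c, deriv_of (Q^~ c) (fun x => eta2 (x - c) * sigma ik.1 ik.2 x)) &
    forall c, Q c c = 0].
  by move=> i; exact: sep_antiderivative (sepM (kernel_sep2 K) (sg _ _)).
have /choice[rho Hrho] : forall I : ('I_n * 'I_n) * ('I_n * 'I_n), exists Q, [/\ sep Q,
    (forall c, deriv_of (Q^~ c) (fun z => b I.1 c z * sigma I.2.1 I.2.2 z)) &
    forall c, Q c c = 0].
  move=> I; have [sb _ _] := Hb I.1.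
  exact: sep_antiderivative (sepM (sep_swap sb) (sg _ _)).
exists eta, eta1, eta2, q, (fun i j x c => \sum_k r0 (i, j, k) x c),
  (fun i k => b (i, k)), (fun i k j l => rho ((i, k), (j, l))).
split.
- exact: K.
- by move=> i; have [] := Hq i.
- by move=> i; have [] := Hq i.
- by move=> i j; apply: sep_sum => k; have [] := Hr0 (i, j, k).
- move=> i j c.
  have dr k : deriv_of (r0 (i, j, k) ^~ c)
      (fun x => eta1 (x - c) * (sigma i k x * sigma j k x)).
    by have [_ dr _] := Hr0 (i, j, k); exact: dr.
  apply: deriv_of_ext (deriv_of_sum (index_enum 'I_n) dr) _.
  by move=> x /=; rewrite mulr_sumr.
- by move=> i k; have [] := Hb (i, k).
- by move=> i k; have [] := Hb (i, k).
- by move=> i k j l; have [] := Hrho ((i, k), (j, l)).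
- by move=> i k j l; have [] := Hrho ((i, k), (j, l)).
- move=> i x y xM yM; have [_ dq q0] := Hq i.
  apply: le_trans (kernel_flux_symm K dq q0 (HCf i) xM yM) _.
  by rewrite ler_wpM2r ?(ltW e0)// lerDl mulr_ge0.
- move=> i j x y xM yM.
  (* The symmetric sum r(x, y) + r(y, x) is not small; it is rewritten as the small asymmetry r(x,
     y) - r(y, x) plus 2 r(y, x), which cancels against 2 rho(y, x). *)
  have -> : \sum_k r0 (i, j, k) x y + \sum_k r0 (i, j, k) y x +
      2 * \sum_k rho ((i, k), (j, k)) y x =
      \sum_k (r0 (i, j, k) x y - r0 (i, j, k) y x +
              2 * (rho ((i, k), (j, k)) y x + r0 (i, j, k) y x)).
    by rewrite !big_split/= sumrN -mulr_sumr big_split/=; ring.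
  apply: le_trans (ler_norm_sum _ _ _) _.
  have -> : (2 * Cf + n%:R * D) * e = 2 * Cf * e + \sum_(k < n) D * e.
    by rewrite sumr_const card_ord -mulr_natr; ring.
  have T k : `|r0 (i, j, k) x y - r0 (i, j, k) y x +
              2 * (rho ((i, k), (j, k)) y x + r0 (i, j, k) y x)| <= D * e.
    have [_ dr r00] := Hr0 (i, j, k).
    have [_ db b0] := Hb (i, k).
    have [_ drho rho0] := Hrho ((i, k), (j, k)).
    have H1 := kernel_flux_symm K dr r00.
    have {}H1 : `|r0 (i, j, k) x y - r0 (i, j, k) y x| <= 2 * (Cs * Cs) * e.
      apply: H1 => // z zM; rewrite normrM ler_pM//.
        exact: (HCs (i, k)).
      exact: (HCs (j, k)).
    have H2 := kernel_mixed K db b0 drho rho0 dr r00 (HCs (j, k)) L0 (HL (i, k)) xM yM.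
    apply: le_trans (ler_normD _ _) _; rewrite /D [in leRHS]mulrDl lerD//.
    have -> : 2 * (2 * M * (Cs * L)) * e = 2 * (2 * M * (Cs * (L * e))) by ring.
    by rewrite normrM (ger0_norm (ler0n R 2)) ler_wpM2l.
  apply: (@le_trans _ _ (\sum_(k < n) D * e)); first by apply: ler_sum => k _; exact: T.
  by rewrite lerDr !mulr_ge0// ltW.
Qed.

End EntropyFamily.

(** * Real-valued integrals and Fubini *)

Section RealIntegrals.
Context {R : realType}.

Definition integ d (T : measurableType d) (m : {measure set T -> \bar R})
  (f : T -> R) : Prop := m.-integrable setT (EFin \o f).

Definition bounded_meas d (T : measurableType d) (f : T -> R) : Prop :=
  measurable_fun setT f /\ exists C, forall x, `|f x| <= C.

Section OneMeasure.
Context d (T : measurableType d) (m : {measure set T -> \bar R}).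
Implicit Types (f g : T -> R).
Local Notation integ := (integ m).

Lemma integ_meas f : integ f -> measurable_fun setT f.
Proof. by move=> /integrableP[/measurable_EFinP]. Qed.

Lemma integ_ext f g : f =1 g -> integ f -> integ g.
Proof. by move=> /funext ->. Qed.

Lemma integD f g : integ f -> integ g -> integ (fun x => f x + g x).
Proof. by move=> h k; exact: (integrableD _ h k). Qed.

Lemma integB f g : integ f -> integ g -> integ (fun x => f x - g x).
Proof. by move=> h k; exact: (integrableB _ h k). Qed.

Lemma integZ c f : integ f -> integ (fun x => c * f x).
Proof. by move=> h; exact: (integrableZl _ c h). Qed.

Lemma integ0 : integ (fun=> 0).
Proof. exact: integrable0. Qed.

Lemma integ_sum (I : Type) (s : seq I) (f : I -> T -> R) :
  (forall i, integ (f i)) -> integ (fun x => \sum_(i <- s) f i x).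
Proof.
move=> If; elim: s => [|i s ih].
  by apply: integ_ext integ0 => x; rewrite big_nil.
by apply: integ_ext (integD (If i) ih) => x; rewrite big_cons.
Qed.

Lemma integ_le f g : measurable_fun setT f -> (forall x, `|f x| <= g x) ->
  integ g -> integ f.
Proof.
move=> mf fg ig; apply: le_integrable ig => //; first exact/measurable_EFinP.
by move=> x _ /=; rewrite lee_fin (le_trans (fg x))// ler_norm.
Qed.

Lemma integ_norm f : integ f -> integ (fun x => `|f x|).
Proof. by move=> h; exact: (integrable_norm h). Qed.

Lemma integM f g : bounded_meas f -> integ g -> integ (fun x => f x * g x).
Proof.
move=> [mf [C fC]] ig.
have C0 : 0 <= `|C| by [].
apply: (@integ_le _ (fun x => `|C| * `|g x|)).
- by apply: measurable_funM => //; exact: integ_meas ig.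
- by move=> x; rewrite normrM ler_wpM2r// (le_trans (fC x))// ler_norm.
- by apply: integZ; exact: integ_norm.
Qed.

Lemma bmD f g : bounded_meas f -> bounded_meas g -> bounded_meas (fun x => f x + g x).
Proof.
move=> [mf [C fC]] [mg [D gD]]; split; first exact: measurable_funD.
by exists (C + D) => x; rewrite (le_trans (ler_normD _ _))// lerD.
Qed.

Lemma bmM f g : bounded_meas f -> bounded_meas g -> bounded_meas (fun x => f x * g x).
Proof.
move=> [mf [C fC]] [mg [D gD]]; split; first exact: measurable_funM.
by exists (C * D) => x; rewrite normrM ler_pM.
Qed.

Lemma bm_cst c : bounded_meas (fun _ : T => c).
Proof. by split; [exact: measurable_cst|exists `|c|]. Qed.

Lemma bmN f : bounded_meas f -> bounded_meas (fun x => - f x).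
Proof.
move=> [mf [C fC]]; split; last by exists C => x; rewrite normrN.
exact: measurable_funN.
Qed.

Lemma bmB f g : bounded_meas f -> bounded_meas g -> bounded_meas (fun x => f x - g x).
Proof. by move=> bf bg; exact: bmD bf (bmN bg). Qed.

Lemma bm_norm f : bounded_meas f -> bounded_meas (fun x => `|f x|).
Proof.
move=> [mf [C fC]]; split; last by exists C => x; rewrite normr_id.
exact: measurableT_comp.
Qed.

Lemma bm_sum (I : Type) (s : seq I) (f : I -> T -> R) :
  (forall i, bounded_meas (f i)) -> bounded_meas (fun x => \sum_(i <- s) f i x).
Proof.
move=> If; elim: s => [|i s ih].
  rewrite (_ : (fun x => _) = cst 0); last by apply/funext => x; rewrite big_nil.
  exact: bm_cst.
rewrite (_ : (fun x => _) = fun x => f i x + \sum_(j <- s) f j x).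
  exact: bmD.
by apply/funext => x; rewrite big_cons.
Qed.

Lemma RintD f g : integ f -> integ g ->
  (\int[m]_x (f x + g x) = \int[m]_x f x + \int[m]_x g x)%R.
Proof. by move=> h k; exact: RintegralD. Qed.

Lemma RintB f g : integ f -> integ g ->
  (\int[m]_x (f x - g x) = \int[m]_x f x - \int[m]_x g x)%R.
Proof. by move=> h k; exact: RintegralB. Qed.

Lemma RintZ c f : integ f -> (\int[m]_x (c * f x) = c * \int[m]_x f x)%R.
Proof. by move=> h; exact: RintegralZl. Qed.

Lemma RintN f : integ f -> (\int[m]_x (- f x) = - \int[m]_x f x)%R.
Proof.
move=> h; rewrite -mulN1r -RintZ//; apply: eq_Rintegral => x _.
by rewrite mulN1r.
Qed.

Lemma Rint0 : (\int[m]_x (fun=> 0 : R) x = 0)%R.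
Proof. by rewrite /Rintegral integral0. Qed.

Lemma Rint_sum (I : Type) (s : seq I) (f : I -> T -> R) :
  (forall i, integ (f i)) ->
  (\int[m]_x (\sum_(i <- s) f i x) = \sum_(i <- s) \int[m]_x f i x)%R.
Proof.
move=> If; elim: s => [|i s ih].
  rewrite big_nil -[RHS]Rint0; apply: eq_Rintegral => x _; by rewrite big_nil.
rewrite big_cons -ih -RintD//; last exact: integ_sum.
by apply: eq_Rintegral => x _; rewrite big_cons.
Qed.

Lemma Rint_le f g : integ f -> integ g -> (forall x, f x <= g x) ->
  (\int[m]_x f x <= \int[m]_x g x)%R.
Proof. by move=> h k fg; apply: le_Rintegral. Qed.

Lemma Rint_norm_le f g : integ f -> integ g -> (forall x, `|f x| <= g x) ->
  (`| \int[m]_x f x | <= \int[m]_x g x)%R.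
Proof.
move=> h k fg; apply: le_trans (le_normr_Rintegral measurableT h) _.
by apply: Rint_le => //; exact: integ_norm.
Qed.

Hypothesis mfin : (m setT < +oo)%E.

Lemma bm_integ f : bounded_meas f -> integ f.
Proof.
move=> [mf [C fC]]; apply: measurable_bounded_integrable => //.
exists C; split; first by rewrite num_real.
by move=> D CD x _ /=; rewrite (le_trans (fC x))// ltW.
Qed.

Lemma integ_of_sq f : measurable_fun setT f -> integ (fun x => f x ^+ 2) -> integ f.
Proof.
move=> mf i2; apply: (@integ_le _ (fun x => 1 + f x ^+ 2)) => //.
  by move=> x; rewrite ler_norml; nra.
apply: integD i2; exact/bm_integ/bm_cst.
Qed.

End OneMeasure.

Section TwoMeasures.
Context d1 d2 (T1 : measurableType d1) (T2 : measurableType d2).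
Variables (m1 : {sigma_finite_measure set T1 -> \bar R})
          (m2 : {sigma_finite_measure set T2 -> \bar R}).
Local Notation m12 := (m1 \x m2)%E.

Lemma finite_prod : (m1 setT < +oo -> m2 setT < +oo -> m12 setT < +oo)%E.
Proof.
by move=> h1 h2; rewrite -setXTT product_measure1E// lte_mul_pinfty// ge0_fin_numE.
Qed.

Variable F : T1 * T2 -> R.
Hypothesis iF : integ m12 F.

Let fine_integ d (T : measurableType d) (m : {measure set T -> \bar R})
  (f : T -> \bar R) : m.-integrable setT f -> integ m (fine \o f) /\
  \int[m]_x fine (f x) = fine (\int[m]_x f x)%E.
Proof.
move=> intf; have mf := measurable_int _ intf.
have mff : measurable_fun setT (fine \o f) by exact: measurableT_comp mf.
split.
  apply: le_integrable intf => //; first exact/measurable_EFinP.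
  by move=> x _ /=; case: (f x) => [r| |]//=; rewrite ?normr0 leey.
rewrite /Rintegral; congr fine; apply: ae_eq_integral => //.
  exact/measurable_EFinP.
have := integrable_ae measurableT intf.
apply: filterS => x h Tx; rewrite fineK//; exact: h.
Qed.

Lemma Rfubini1_integ : integ m1 (fun x => \int[m2]_y F (x, y)).
Proof. by have [] := fine_integ (integrable_fubini_F iF). Qed.

Lemma Rfubini1 : \int[m1]_x (\int[m2]_y F (x, y)) = \int[m12]_z F z.
Proof.
have [_ ->] := fine_integ (integrable_fubini_F iF).
by rewrite /Rintegral; congr fine; exact: integral12_prod_meas1.
Qed.

Let integrable_G : m2.-integrable setT (fubini_G m1 (EFin \o F)).
Proof.
have mF : measurable_fun setT (EFin \o F) := measurable_int _ iF.
have mnF : measurable_fun setT (abse \o (EFin \o F)) by exact: measurableT_comp.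
apply/integrableP; split; first exact: (measurable_fubini_G iF).
have h := (integrable21ltyP m1 m2 mF).1 iF.
apply: le_lt_trans h.
apply: ge0_le_integral => //.
- by apply: measurableT_comp => //; exact: (measurable_fubini_G iF).
- apply: (@measurable_fun_fubini_tonelli_G _ _ _ _ _ m1 (abse \o (EFin \o F))) => //.
  by move=> z; exact: abse_ge0.
- move=> y _; apply: le_abse_integral => //; exact: measurableT_comp.
Qed.

Lemma Rfubini2_integ : integ m2 (fun y => \int[m1]_x F (x, y)).
Proof. by have [] := fine_integ integrable_G. Qed.

Lemma Rfubini2 : \int[m2]_y (\int[m1]_x F (x, y)) = \int[m12]_z F z.
Proof.
have [_ ->] := fine_integ integrable_G.
by rewrite /Rintegral; congr fine; exact: integral21_prod_meas1.
Qed.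

End TwoMeasures.

Section Lifting.
Context d1 d2 (T1 : measurableType d1) (T2 : measurableType d2).
Variables (m1 : {sigma_finite_measure set T1 -> \bar R})
          (m2 : {sigma_finite_measure set T2 -> \bar R}).
Hypotheses (fin1 : (m1 setT < +oo)%E) (fin2 : (m2 setT < +oo)%E).
Local Notation m12 := (m1 \x m2)%E.

Lemma integ_tensor f g : integ m1 f -> integ m2 g ->
  integ m12 (fun z => f z.1 * g z.2).
Proof.
move=> i1 i2.
have mm : measurable_fun setT (fun z : T1 * T2 => f z.1 * g z.2).
  apply: measurable_funM.
    by apply: measurableT_comp (integ_meas i1) _; exact: measurable_fst.
  by apply: measurableT_comp (integ_meas i2) _; exact: measurable_snd.
apply/integrable12ltyP; first exact/measurable_EFinP.
have E x : (\int[m2]_y `|(f x * g y)%:E| = `|f x|%:E * \int[m2]_y `|(g y)%:E|)%E.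
  rewrite -ge0_integralZl//.
  - by apply: eq_integral => y _ /=; rewrite -EFinM normrM.
  - by apply/measurable_EFinP/measurableT_comp => //; exact: integ_meas i2.
under eq_integral do rewrite /= E.
have [mf1 lt1] := integrableP _ _ _ i1.
have [mf2 lt2] := integrableP _ _ _ i2.
rewrite ge0_integralZr//.
- by apply: lte_mul_pinfty => //; rewrite ?ge0_fin_numE ?integral_ge0.
- by apply/measurable_EFinP/measurableT_comp => //; exact: integ_meas i1.
- exact: integral_ge0.
Qed.

Lemma integ_lift1 f : integ m1 f -> integ m12 (fun z => f z.1).
Proof.
move=> i1; apply: integ_ext (integ_tensor i1 (bm_integ fin2 (bm_cst _ 1))) => z.
by rewrite mulr1.
Qed.

Lemma integ_lift2 g : integ m2 g -> integ m12 (fun z => g z.2).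
Proof.
move=> i1; apply: integ_ext (integ_tensor (bm_integ fin1 (bm_cst _ 1)) i1) => z.
by rewrite mul1r.
Qed.

Lemma bm_section1 (F : T1 * T2 -> R) x : bounded_meas F -> bounded_meas (fun y : T2 => F (x, y)).
Proof.
move=> [mF [C FC]]; split; last by exists C.
exact: measurableT_comp.
Qed.

Lemma bm_section2 (F : T1 * T2 -> R) y : bounded_meas F -> bounded_meas (fun x : T1 => F (x, y)).
Proof.
move=> [mF [C FC]]; split; last by exists C.
exact: measurableT_comp.
Qed.

Lemma bm_lift1 (f : T1 -> R) : bounded_meas f -> bounded_meas (fun z : T1 * T2 => f z.1).
Proof.
by move=> [mf [C fC]]; split; [exact: measurableT_comp|exists C].
Qed.

Lemma bm_lift2 (f : T2 -> R) : bounded_meas f -> bounded_meas (fun z : T1 * T2 => f z.2).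
Proof.
by move=> [mf [C fC]]; split; [exact: measurableT_comp|exists C].
Qed.

End Lifting.

End RealIntegrals.

(** * Doubling of variables *)

Section WeakFormulations.
Context {R : realType} (n : nat) d (X : measurableType d).
Variables (nu : {measure set X -> \bar R}) (f' : 'I_n -> R -> R)
  (sigma : 'I_n -> 'I_n -> R -> R).

(** The test function and its derivatives enter as independent functions [ph], [pt], [px], [pxx], so
    the doubling argument runs on an abstract measure space and needs no differential structure. *)
Definition weak_entropy (w : X -> R) (g : 'I_n -> X -> R) (ph pt : X -> R)
    (px : 'I_n -> X -> R) (pxx : 'I_n -> 'I_n -> X -> R) : Prop :=
  forall (eta eta1 eta2 : R -> R) (q : 'I_n -> R -> R) (r : 'I_n -> 'I_n -> R -> R),
  deriv_of eta eta1 -> deriv_of eta1 eta2 -> continuous eta2 ->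
  (forall x, 0 <= eta2 x) ->
  (forall i, deriv_of (q i) (fun x => eta1 x * f' i x)) ->
  (forall i j, deriv_of (r i j)
    (fun x => eta1 x * \sum_k sigma i k x * sigma j k x)) ->
  \int[nu]_p (eta2 (w p) * (\sum_k g k p ^+ 2) * ph p) <=
  \int[nu]_p (eta (w p) * pt p + \sum_i q i (w p) * px i p +
              \sum_i \sum_j r i j (w p) * pxx i j p).

Definition weak_chain (w : X -> R) (g : 'I_n -> X -> R) (ph : X -> R)
    (px : 'I_n -> X -> R) : Prop :=
  forall (psi : R -> R) (b : 'I_n -> 'I_n -> R -> R), continuous psi ->
  (forall i k, deriv_of (b i k) (fun x => psi x * sigma i k x)) ->
  forall k, \int[nu]_p (\sum_i b i k (w p) * px i p) =
    - \int[nu]_p (psi (w p) * g k p * ph p).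

End WeakFormulations.

Section Doubling.
Context {R : realType} (n : nat) d (X : measurableType d).
Variables (nu : {sigma_finite_measure set X -> \bar R}).
Hypothesis nufin : (nu setT < +oo)%E.
Local Notation nu2 := (nu \x nu)%E.
Variables (f' : 'I_n -> R -> R) (sigma dsigma : 'I_n -> 'I_n -> R -> R).
Hypothesis cf' : forall i, continuous (f' i).
Hypothesis dsigmaP : forall i k, deriv_of (sigma i k) (dsigma i k).
Hypothesis cdsigma : forall i k, continuous (dsigma i k).

Variables (M : R) (u v : X -> R) (g h : 'I_n -> X -> R).
Hypotheses (M0 : 0 < M) (mu : measurable_fun setT u) (mv : measurable_fun setT v).
Hypotheses (uM : forall p, `|u p| <= M) (vM : forall p, `|v p| <= M).
Hypotheses (mg : forall k, measurable_fun setT (g k))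
  (mh : forall k, measurable_fun setT (h k)).
Hypotheses (g2 : forall k, integ nu (fun p => g k p ^+ 2))
  (h2 : forall k, integ nu (fun p => h k p ^+ 2)).

Variables (ph pt ps : X * X -> R) (px : 'I_n -> X * X -> R)
  (pxx : 'I_n -> 'I_n -> X * X -> R).
Hypotheses (bph : bounded_meas ph) (bpt : bounded_meas pt) (bps : bounded_meas ps)
  (bpx : forall i, bounded_meas (px i))
  (bpxx : forall i j, bounded_meas (pxx i j)).
Hypothesis ph0 : forall z, 0 <= ph z.

(* The kernel depends on the space variables through their difference, so that
   its y-derivatives are - px and pxx, and its mixed derivatives are - pxx. *)
Hypothesis entropy_u : forall y, weak_entropy nu f' sigma u g
  (fun x => ph (x, y)) (fun x => pt (x, y)) (fun i x => px i (x, y))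
  (fun i j x => pxx i j (x, y)).
Hypothesis entropy_v : forall x, weak_entropy nu f' sigma v h
  (fun y => ph (x, y)) (fun y => ps (x, y)) (fun i y => - px i (x, y))
  (fun i j y => pxx i j (x, y)).
Hypothesis chain_u : forall y, weak_chain nu sigma u g
  (fun x => ph (x, y)) (fun i x => px i (x, y)).
Hypothesis chain_v : forall x i, weak_chain nu sigma v h
  (fun y => px i (x, y)) (fun j y => - pxx i j (x, y)).

Let fin2 : (nu2 setT < +oo)%E. Proof. exact: finite_prod. Qed.

Let bmsep k : sep k -> bounded_meas (fun z : X * X => k (u z.1) (v z.2)).
Proof.
move=> sk; split.
  by apply: sep_measurable => //; apply: measurableT_comp.
by have [C HC] := sep_bounded M sk; exists C => z; exact: HC.
Qed.

Section FixedEpsilon.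
Variables (e C : R) (eta eta1 eta2 : R -> R)
  (q : 'I_n -> R -> R -> R) (r b : 'I_n -> 'I_n -> R -> R -> R)
  (rho : 'I_n -> 'I_n -> 'I_n -> 'I_n -> R -> R -> R).
Hypothesis e0 : 0 < e.
Hypothesis EF : entropy_family f' sigma M e C eta eta1 eta2 q r b rho.
Let K := ef_kernel EF.

Let E2 z := eta2 (u z.1 - v z.2).
Let bE2 : bounded_meas E2. Proof. exact: bmsep (kernel_sep2 K). Qed.

Let ig k : integ nu (g k). Proof. exact: integ_of_sq. Qed.
Let ih k : integ nu (h k). Proof. exact: integ_of_sq. Qed.

(** [GG] and [HH] are the two dissipations, [GH] their cross term, [BU] and [BV] the right-hand
    sides of the two entropy inequalities. [BX] and [BR] are the cross term after one and after two
    uses of the chain rule. *)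
Let GG z := E2 z * (\sum_k g k z.1 ^+ 2) * ph z.
Let HH z := E2 z * (\sum_k h k z.2 ^+ 2) * ph z.
Let GH k z := E2 z * g k z.1 * h k z.2 * ph z.
Let BU z := eta (u z.1 - v z.2) * pt z + \sum_i q i (u z.1) (v z.2) * px i z +
  \sum_i \sum_j r i j (u z.1) (v z.2) * pxx i j z.
Let BV z := eta (u z.1 - v z.2) * ps z + \sum_i q i (v z.2) (u z.1) * - px i z +
  \sum_i \sum_j r i j (v z.2) (u z.1) * pxx i j z.
Let BX i k z := b i k (u z.1) (v z.2) * h k z.2 * px i z.
Let BR i k z := \sum_j rho i k j k (v z.2) (u z.1) * pxx i j z.

Let iGG : integ nu2 GG.
Proof.
apply: (@integ_ext _ _ _ nu2 (fun z => (E2 z * ph z) * \sum_k g k z.1 ^+ 2)).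
  by move=> z; rewrite /GG mulrAC.
apply: integM; first exact: bmM.
exact: (integ_lift1 nufin (integ_sum _ g2)).
Qed.

Let iHH : integ nu2 HH.
Proof.
apply: (@integ_ext _ _ _ nu2 (fun z => (E2 z * ph z) * \sum_k h k z.2 ^+ 2)).
  by move=> z; rewrite /HH mulrAC.
apply: integM; first exact: bmM.
exact: (integ_lift2 nufin (integ_sum _ h2)).
Qed.

Let iGH k : integ nu2 (GH k).
Proof.
apply: (@integ_ext _ _ _ nu2 (fun z => (E2 z * ph z) * (g k z.1 * h k z.2))).
  by move=> z; rewrite /GH; ring.
by apply: integM; [exact: bmM|exact: integ_tensor].
Qed.

Let bBU : bounded_meas BU.
Proof.
apply: bmD; first apply: bmD.
- by apply: bmM => //; exact: bmsep (kernel_sep K).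
- by apply: bm_sum => i; apply: bmM => //; exact: bmsep (ef_qsep EF i).
- apply: bm_sum => i; apply: bm_sum => j; apply: bmM => //.
  exact: bmsep (ef_rsep EF i j).
Qed.

Let bBV : bounded_meas BV.
Proof.
apply: bmD; first apply: bmD.
- by apply: bmM => //; exact: bmsep (kernel_sep K).
- apply: bm_sum => i; apply: bmM; last exact: bmN.
  exact: (bmsep (sep_swap (ef_qsep EF i))).
- apply: bm_sum => i; apply: bm_sum => j; apply: bmM => //.
  exact: (bmsep (sep_swap (ef_rsep EF i j))).
Qed.

Let bBR i k : bounded_meas (BR i k).
Proof.
apply: bm_sum => j; apply: bmM => //.
exact: (bmsep (sep_swap (ef_rhosep EF i k j k))).
Qed.

Let iBX i k : integ nu2 (BX i k).
Proof.
apply: (@integ_ext _ _ _ nu2 (fun z => (b i k (u z.1) (v z.2) * px i z) * h k z.2)).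
  by move=> z; rewrite /BX mulrAC.
apply: integM; last exact: integ_lift2.
by apply: bmM => //; exact: bmsep (ef_bsep EF i k).
Qed.

(** The entropy inequality for u with the constant v y, integrated over y. *)
Let GG_le : \int[nu2]_z GG z <= \int[nu2]_z BU z.
Proof.
rewrite -!Rfubini2; [|exact: bm_integ|exact: iGG].
apply: Rint_le; [exact: Rfubini2_integ|exact/Rfubini2_integ/bm_integ|move=> y].
apply: (entropy_u y (eta := fun x => eta (x - v y)) (eta1 := fun x => eta1 (x - v y))
  (eta2 := fun x => eta2 (x - v y)) (q := fun i x => q i x (v y))
  (r := fun i j x => r i j x (v y))).
- exact: deriv_of_shift (kernel_deriv K).
- exact: deriv_of_shift (kernel_deriv1 K).
- exact: (sep_continuousl (y := v y) (kernel_sep2 K)).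
- by move=> x; exact: kernel_ge0 K _.
- by move=> i; exact: ef_q EF i (v y).
- by move=> i j; exact: ef_r EF i j (v y).
Qed.

Let HH_le : \int[nu2]_z HH z <= \int[nu2]_z BV z.
Proof.
rewrite -!Rfubini1; [|exact: bm_integ|exact: iHH].
apply: Rint_le; [exact: Rfubini1_integ|exact/Rfubini1_integ/bm_integ|move=> x].
have -> : \int[nu]_y HH (x, y) =
    \int[nu]_y (eta2 (v y - u x) * (\sum_k h k y ^+ 2) * ph (x, y)).
  by apply: eq_Rintegral => y _; rewrite /HH /E2/= -(kernel2N K) opprB.
have -> : \int[nu]_y BV (x, y) = \int[nu]_y (eta (v y - u x) * ps (x, y) +
    \sum_i q i (v y) (u x) * - px i (x, y) +
    \sum_i \sum_j r i j (v y) (u x) * pxx i j (x, y)).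
  by apply: eq_Rintegral => y _; rewrite /BV /= -(kernelN K) opprB.
apply: (entropy_v x (eta := fun y => eta (y - u x)) (eta1 := fun y => eta1 (y - u x))
  (eta2 := fun y => eta2 (y - u x)) (q := fun i y => q i y (u x))
  (r := fun i j y => r i j y (u x))).
- exact: deriv_of_shift (kernel_deriv K).
- exact: deriv_of_shift (kernel_deriv1 K).
- exact: (sep_continuousl (y := u x) (kernel_sep2 K)).
- by move=> y; exact: kernel_ge0 K _.
- by move=> i; exact: ef_q EF i (u x).
- by move=> i j; exact: ef_r EF i j (u x).
Qed.

(** For fixed y the factor h_k(y) is a constant, and the chain rule for u with psi = eta''(. - v y)
    moves the derivative carried by g_k onto the test function. *)
Let GH_eq k : \int[nu2]_z GH k z = - \sum_i \int[nu2]_z BX i k z.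
Proof.
rewrite -(Rint_sum _ (fun i => iBX i k)) -(Rfubini2 (iGH k)).
have iS : integ nu2 (fun z => \sum_i BX i k z) by exact: integ_sum.
rewrite -(Rfubini2 iS) -RintN; last exact: Rfubini2_integ iS.
apply: eq_Rintegral => y _.
have cb : continuous (fun x => eta2 (x - v y)).
  exact: (sep_continuousl (y := v y) (kernel_sep2 K)).
have := chain_u y (b := fun i k x => b i k x (v y)) cb (fun i k => ef_b EF i k (v y)) k.
have ib : integ nu (fun x => \sum_i b i k (u x) (v y) * px i (x, y)).
  apply: bm_integ => //; apply: bm_sum => i; apply: (bm_section2 y (F := fun z => b i k (u z.1) (v z.2) * px i z)).
  by apply: bmM => //; exact: bmsep (ef_bsep EF i k).
have ic : integ nu (fun x => eta2 (u x - v y) * g k x * ph (x, y)).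
  apply: (@integ_ext _ _ _ nu (fun x => (eta2 (u x - v y) * ph (x, y)) * g k x)).
    by move=> x; rewrite mulrAC.
  apply: integM => //; apply: (bm_section2 y (F := fun z => E2 z * ph z)).
  exact: bmM.
move=> E.
have -> : \int[nu]_x GH k (x, y) =
    h k y * \int[nu]_x (eta2 (u x - v y) * g k x * ph (x, y)).
  by rewrite -RintZ//; apply: eq_Rintegral => x _; rewrite /GH /E2/=; ring.
have -> : \int[nu]_x (\sum_i BX i k (x, y)) =
    h k y * \int[nu]_x (\sum_i b i k (u x) (v y) * px i (x, y)).
  rewrite -RintZ//; apply: eq_Rintegral => x _; rewrite mulr_sumr.
  by apply: eq_bigr => i _; rewrite /BX/=; ring.
by rewrite E mulrN opprK.
Qed.

(** For fixed x this is the chain rule for v with psi = b i k (u x), tested with [px i]. Its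
    y-derivatives are - pxx, which absorbs the sign of the integration by parts. *)
Let BX_eq i k : \int[nu2]_z BX i k z = \int[nu2]_z BR i k z.
Proof.
rewrite -(Rfubini1 (iBX i k)) -(Rfubini1 (bm_integ fin2 (bBR i k))).
apply: eq_Rintegral => x _.
have cb : continuous (fun y => b i k (u x) y).
  exact: (sep_continuousl (y := u x) (sep_swap (ef_bsep EF i k))).
have := chain_v x i (b := fun j l y => rho i k j l y (u x)) cb
  (fun j l => ef_rho EF i k j l (u x)) k.
have -> : \int[nu]_y (\sum_j rho i k j k (v y) (u x) * - pxx i j (x, y)) =
    \int[nu]_y (- BR i k (x, y)).
  apply: eq_Rintegral => y _; rewrite /BR -sumrN; apply: eq_bigr => j _.
  by rewrite mulrN.
rewrite RintN; first by move/oppr_inj => ->.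
by apply: bm_integ => //; exact: bm_section1.
Qed.

Let W z := `|pt z| + `|ps z| + C * (\sum_i `|px i z|) +
  C * (\sum_i \sum_j `|pxx i j z|).

Let bW : bounded_meas W.
Proof.
apply: bmD; first apply: bmD; first by apply: bmD; exact: bm_norm.
  by apply: bmM; [exact: bm_cst|apply: bm_sum => i; exact: bm_norm].
apply: bmM; first exact: bm_cst.
by apply: bm_sum => i; apply: bm_sum => j; exact: bm_norm.
Qed.

(** Collecting terms, [px] has the antisymmetrized flux as coefficient and [pxx] the combination of
    [ef_rsymm]; both are O(e), so only the time derivatives survive, with eta replaced by the
    absolute value at cost e. *)
Let pointwise z : BU z + BV z + 2 * \sum_k \sum_i BR i k z <=
  `|u z.1 - v z.2| * (pt z + ps z) + e * W z.
Proof.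
have -> : BU z + BV z + 2 * \sum_k \sum_i BR i k z =
    eta (u z.1 - v z.2) * (pt z + ps z) +
    \sum_i (q i (u z.1) (v z.2) - q i (v z.2) (u z.1)) * px i z +
    \sum_i \sum_j (r i j (u z.1) (v z.2) + r i j (v z.2) (u z.1) +
      2 * \sum_k rho i k j k (v z.2) (u z.1)) * pxx i j z.
  have -> : \sum_k \sum_i BR i k z =
      \sum_i \sum_j (\sum_k rho i k j k (v z.2) (u z.1)) * pxx i j z.
    rewrite exchange_big/=; apply: eq_bigr => i _; rewrite /BR exchange_big/=.
    by apply: eq_bigr => j _; rewrite mulr_suml.
  rewrite mulr_sumr /BU /BV.
  under [X in _ = _ + _ + X]eq_bigr => i _.
    under eq_bigr => j _ do rewrite 2!mulrDl -mulrA.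
    rewrite !big_split/= -mulr_sumr; over.
  under [X in _ = _ + X + _]eq_bigr => i _ do rewrite mulrBl -mulrN.
  by rewrite !big_split/=; ring.
have a1 : eta (u z.1 - v z.2) * (pt z + ps z) <=
    `|u z.1 - v z.2| * (pt z + ps z) + e * (`|pt z| + `|ps z|).
  rewrite -lerBlDl -mulrBl (le_trans (ler_norm _))// normrM ler_pM//.
    rewrite distrC; apply: (kernel_abs K).
    rewrite (le_trans (ler_normB _ _))//.
    by have := uM z.1; have := vM z.2; lra.
  exact: ler_normD.
have a2 : \sum_i (q i (u z.1) (v z.2) - q i (v z.2) (u z.1)) * px i z <=
    e * (C * (\sum_i `|px i z|)).
  rewrite mulrA mulr_sumr; apply: ler_sum => i _.
  rewrite (le_trans (ler_norm _))// normrM ler_wpM2r// [leRHS]mulrC.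
  exact: (ef_qsymm EF).
have a3 : \sum_i \sum_j (r i j (u z.1) (v z.2) + r i j (v z.2) (u z.1) +
      2 * \sum_k rho i k j k (v z.2) (u z.1)) * pxx i j z <=
    e * (C * (\sum_i \sum_j `|pxx i j z|)).
  rewrite mulrA mulr_sumr; apply: ler_sum => i _.
  rewrite mulr_sumr; apply: ler_sum => j _.
  rewrite (le_trans (ler_norm _))// normrM ler_wpM2r// [leRHS]mulrC.
  exact: (ef_rsymm EF).
by rewrite /W; lra.
Qed.

Let iBR : integ nu2 (fun z => \sum_k \sum_i BR i k z).
Proof. by apply: bm_integ => //; apply: bm_sum => k; apply: bm_sum => i. Qed.

Let bmain : bounded_meas (fun z => `|u z.1 - v z.2| * (pt z + ps z)).
Proof.
apply: bmM; last exact: bmD.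
by apply: bm_norm; apply: (@bmsep (fun x y => x - y)); apply: sepB;
  [apply: sep_left|apply: sep_right] => x; exact: cvg_id.
Qed.

(** GG + HH - 2 sum_k GH k is eta'' ph times the sum of (g_k - h_k)^2, hence nonnegative. The
    entropy inequalities bound the first two integrals, the chain rules turn the third into + 2 BR,
    and [pointwise] bounds the total. *)
Lemma doubling_epsilon :
  0 <= \int[nu2]_z (`|u z.1 - v z.2| * (pt z + ps z)) +
       e * \int[nu2]_z (`|pt z| + `|ps z| + C * (\sum_i `|px i z|) +
                        C * (\sum_i \sum_j `|pxx i j z|)).
Proof.
have iGHs : integ nu2 (fun z => \sum_k GH k z) by exact: integ_sum.
have sq : 0 <= \int[nu2]_z (GG z + HH z - 2 * \sum_k GH k z).
  apply: Rintegral_ge0 => z _.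
  have -> : GG z + HH z - 2 * \sum_k GH k z =
      E2 z * ph z * \sum_k (g k z.1 - h k z.2) ^+ 2.
    have -> : \sum_k GH k z = E2 z * ph z * \sum_k g k z.1 * h k z.2.
      by rewrite mulr_sumr; apply: eq_bigr => k _; rewrite /GH; ring.
    have -> : \sum_k (g k z.1 - h k z.2) ^+ 2 = \sum_k g k z.1 ^+ 2 +
        \sum_k h k z.2 ^+ 2 - 2 * \sum_k g k z.1 * h k z.2.
      rewrite mulr_sumr -sumrN -!big_split/=; apply: eq_bigr => k _; ring.
    by rewrite /GG /HH; ring.
  by rewrite !mulr_ge0 ?(kernel_ge0 K)// sumr_ge0// => k _; exact: sqr_ge0.
have E1 : \int[nu2]_z (GG z + HH z - 2 * \sum_k GH k z) =
    \int[nu2]_z GG z + \int[nu2]_z HH z + 2 * \int[nu2]_z (\sum_k \sum_i BR i k z).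
  rewrite (RintB (integD iGG iHH) (integZ 2 iGHs)) (RintD iGG iHH) (RintZ 2 iGHs).
  rewrite -mulrN; congr (_ + 2 * _).
  rewrite (Rint_sum _ iGH) -sumrN.
  rewrite Rint_sum; last by move=> k; apply: bm_integ => //; apply: bm_sum => i.
  apply: eq_bigr => k _; rewrite GH_eq opprK Rint_sum; last first.
    by move=> i; apply: bm_integ.
  by apply: eq_bigr => i _; exact: BX_eq.
have iU := bm_integ fin2 bBU; have iV := bm_integ fin2 bBV.
apply: (le_trans sq); rewrite E1.
apply: (@le_trans _ _ (\int[nu2]_z (BU z + BV z + 2 * \sum_k \sum_i BR i k z))).
  rewrite (RintD (integD iU iV) (integZ 2 iBR)) (RintD iU iV) (RintZ 2 iBR).
  by rewrite lerD2r lerD.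
have iW := bm_integ fin2 bW; have im := bm_integ fin2 bmain.
rewrite -(RintZ e iW) -(RintD im (integZ e iW)).
apply: Rint_le => //; [exact: integD (integD iU iV) (integZ 2 iBR)|].
exact: integD im (integZ e iW).
Qed.

End FixedEpsilon.

Theorem doubling : 0 <= \int[nu2]_z (`|u z.1 - v z.2| * (pt z + ps z)).
Proof.
have [C [C0 HC]] := entropy_family_exists cf' dsigmaP cdsigma M0.
set I := (X in 0 <= X).
pose J := \int[nu2]_z (`|pt z| + `|ps z| + C * (\sum_i `|px i z|) +
                        C * (\sum_i \sum_j `|pxx i j z|)).
have key e : 0 < e -> 0 <= I + e * J.
  move=> e0; have [eta [eta1 [eta2 [q [r [b [rho EF]]]]]]] := HC e e0.
  exact: doubling_epsilon EF.
rewrite leNgt; apply/negP => I0.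
have J0 : 0 <= J.
  apply: Rintegral_ge0 => z _.
  by rewrite !addr_ge0 ?mulr_ge0 ?sumr_ge0// => i _; rewrite sumr_ge0.
(* For this e the right-hand side is I (1 - J / (2 (J + 1))), with a positive second factor, hence
   negative with I. *)
have := key (- I / (2 * (J + 1))).
rewrite divr_gt0 ?oppr_gt0//; last by rewrite mulr_gt0// ltr_wpDl.
move=> /(_ isT); apply/negP; rewrite -ltNge.
have -> : I + - I / (2 * (J + 1)) * J = I * (1 - J / (2 * (J + 1))) by ring.
rewrite nmulr_rlt0// subr_gt0 ltr_pdivrMr; last by rewrite mulr_gt0// ltr_wpDl.
by rewrite mul1r; lra.
Qed.

End Doubling.

(** * Trigonometric polynomials on the Bohr compactification *)

Section Characters.
Context {R : realType} (d : nat) (G : topologicalZmodType).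
Variable iota : 'rV[R]_d -> G.
Hypothesis Hbohr : is_bohr_compactification iota.

Let compactG : compact [set: G]. Proof. by case: Hbohr. Qed.
Let iotaD x y : iota (x + y) = iota x + iota y.
Proof. by case: Hbohr => _ _ [iD _] _ _. Qed.
Let iota_dense : closure (range iota) = [set: G]. Proof. by case: Hbohr. Qed.
Let iota_ap F : continuous F -> almost_periodic (F \o iota).
Proof. by case: Hbohr => _ _ _ _ [ap _]; exact: ap. Qed.
Let iota_ext f : almost_periodic f ->
  exists F : G -> R, continuous F /\ F \o iota = f.
Proof. by case: Hbohr => _ _ _ _ [_ ext]; exact: ext. Qed.

Lemma dense_le (F : G -> R) c : continuous F -> (forall x, F (iota x) <= c) ->
  forall z, F z <= c.
Proof.
move=> cF Fc z.
have cl : closed (F @^-1` [set y | y <= c]).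
  by apply: preimage_closed; [move=> x _; exact: cF|exact: closed_le].
have : [set: G] `<=` F @^-1` [set y | y <= c].
  rewrite -iota_dense; move/closure_id : cl => ->.
  by apply: closureS => _ [x _ <-]; exact: Fc.
by apply.
Qed.

Lemma dense_eq (F1 F2 : G -> R) : continuous F1 -> continuous F2 ->
  (forall x, F1 (iota x) = F2 (iota x)) -> F1 = F2.
Proof.
move=> c1 c2 E; apply/funext => z.
have aux (H1 H2 : G -> R) : continuous H1 -> continuous H2 ->
    (forall x, H1 (iota x) = H2 (iota x)) -> forall z, H1 z <= H2 z.
  move=> k1 k2 EH y; rewrite -subr_le0.
  apply: (@dense_le (fun z => H1 z - H2 z)) => [w|x].
    by apply: (@continuousB _ _ _ H1 H2); [exact: k1|exact: k2].
  by rewrite EH subrr.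
by apply/eqP; rewrite eq_le !aux.
Qed.

Lemma addr_continuousl (y : G) : continuous (fun x : G => x + y).
Proof.
move=> x; apply: (@continuous_comp _ _ _ (fun x => (x, y)) (fun z : G * G => z.1 + z.2)).
  by apply: cvg_pair => /=; [exact: cvg_id|exact: cvg_cst].
exact: add_continuous.
Qed.

Lemma compact_fun_bounded (F : G -> R) : continuous F ->
  exists C : R, 0 <= C /\ forall z, `|F z| <= C.
Proof.
move=> cF.
have cpt : compact (F @` [set: G]).
  by apply: continuous_compact => //; exact: continuous_subspaceT.
have [C [_ HC]] := compact_bounded cpt.
exists (`|C| + 1); split; first by rewrite addr_ge0.
move=> z; apply: (HC (`|C| + 1)); last by exists z.
by rewrite (le_lt_trans (ler_norm C))// ltrDl.
Qed.

Lemma dotvDr (l x y : 'rV[R]_d) : dotv l (x + y) = dotv l x + dotv l y :> R.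
Proof.
by rewrite /dotv -big_split/=; apply: eq_bigr => i _; rewrite mxE mulrDr.
Qed.

Lemma dotvZ_delta (l : 'rV[R]_d) i h : dotv l (h *: delta_mx ord0 i) = l ord0 i * h :> R.
Proof.
rewrite /dotv (bigD1 i)//= big1 ?addr0; first by rewrite !mxE !eqxx mulr1.
by move=> j ji; rewrite !mxE eqxx/= (negbTE ji) !mulr0.
Qed.

Lemma ex_char (l : 'rV[R]_d) : exists CS : (G -> R) * (G -> R),
  [/\ continuous CS.1, continuous CS.2,
    (forall x, CS.1 (iota x) = cos (dotv l x)) &
    (forall x, CS.2 (iota x) = sin (dotv l x))].
Proof.
have [C [cC EC]] : exists F : G -> R, continuous F /\ F \o iota = (fun x => cos (dotv l x)).
  apply: iota_ext => e e0; exists [:: (l, 1, 0)] => x.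
  by rewrite /trig_poly big_seq1/= mul1r mul0r addr0 subrr normr0 ltW.
have [S [cS ES]] : exists F : G -> R, continuous F /\ F \o iota = (fun x => sin (dotv l x)).
  apply: iota_ext => e e0; exists [:: (l, 0, 1)] => x.
  by rewrite /trig_poly big_seq1/= mul1r mul0r add0r subrr normr0 ltW.
exists (C, S); split => //= x.
  by have := congr1 (fun f => f x) EC.
by have := congr1 (fun f => f x) ES.
Qed.

Definition chars (l : 'rV[R]_d) := projT1 (cid (ex_char l)).
(** With [chS], the real and imaginary parts of the character of G that extends x |-> exp(i l.x). *)
Definition chC l : G -> R := (chars l).1.
Definition chS l : G -> R := (chars l).2.

Lemma chC_continuous l : continuous (chC l).
Proof. by rewrite /chC /chars; case: cid => CS []. Qed.

Lemma chS_continuous l : continuous (chS l).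
Proof. by rewrite /chS /chars; case: cid => CS []. Qed.

Lemma chC_iota l x : chC l (iota x) = cos (dotv l x).
Proof. by rewrite /chC /chars; case: cid => CS []. Qed.

Lemma chS_iota l x : chS l (iota x) = sin (dotv l x).
Proof. by rewrite /chS /chars; case: cid => CS []. Qed.

Lemma lin_comb_continuous (T : topologicalType) (F1 F2 : T -> R) (a b : R) :
  continuous F1 -> continuous F2 -> continuous (fun z => a * F1 z + b * F2 z).
Proof.
move=> c1 c2 z; apply: (@continuousD _ _ _ (fun z => a * F1 z) (fun z => b * F2 z)).
  by apply: continuousM; [exact: cst_continuous|exact: c1].
by apply: continuousM; [exact: cst_continuous|exact: c2].
Qed.

(* Both sides are continuous on G, so it is enough to compare them first for
   x and y in the range of iota, then for y alone. *)
Lemma dense_eq2 (F : G -> R) (a1 b1 a2 b2 : G -> R) :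
  continuous F -> continuous a1 -> continuous b1 -> continuous a2 -> continuous b2 ->
  (forall x y, F (iota x + iota y) =
    a1 (iota x) * b1 (iota y) + a2 (iota x) * b2 (iota y)) ->
  forall x y, F (x + y) = a1 x * b1 y + a2 x * b2 y.
Proof.
move=> cF ca1 cb1 ca2 cb2 E x y.
have E1 w : (fun z => F (z + iota w)) = (fun z => b1 (iota w) * a1 z + b2 (iota w) * a2 z).
  apply: dense_eq; first by move=> z; apply: continuous_comp; [exact: addr_continuousl|exact: cF].
    exact: lin_comb_continuous.
  by move=> z; rewrite E !(mulrC _ (_ (iota w))).
have E2 : (fun z => F (z + x)) = (fun z => a1 x * b1 z + a2 x * b2 z).
  apply: dense_eq; first by move=> z; apply: continuous_comp; [exact: addr_continuousl|exact: cF].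
    exact: lin_comb_continuous.
  move=> w; rewrite addrC; have := congr1 (fun f => f x) (E1 w) => /= ->.
  by rewrite !(mulrC _ (_ (iota w))).
by have := congr1 (fun f => f y) E2; rewrite /= addrC.
Qed.

Lemma chCD l x y : chC l (x + y) = chC l x * chC l y - chS l x * chS l y.
Proof.
have cN : continuous (fun y => - chS l y).
  by move=> z; apply: (@continuousN _ _ _ (chS l)); exact: chS_continuous.
rewrite -mulrN; apply: (@dense_eq2 (chC l) (chC l) (chC l) (chS l) (fun y => - chS l y)) => //.
- exact: chC_continuous.
- exact: chC_continuous.
- exact: chC_continuous.
- exact: chS_continuous.
- by move=> {}x {}y; rewrite -iotaD !chC_iota !chS_iota dotvDr cosD mulrN.
Qed.

Lemma chSD l x y : chS l (x + y) = chS l x * chC l y + chC l x * chS l y.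
Proof.
apply: (@dense_eq2 (chS l) (chS l) (chC l) (chC l) (chS l)) => //.
- exact: chS_continuous.
- exact: chS_continuous.
- exact: chC_continuous.
- exact: chC_continuous.
- exact: chS_continuous.
- by move=> {}x {}y; rewrite -iotaD !chC_iota !chS_iota dotvDr sinD.
Qed.

Lemma bohr_map0 : iota 0 = 0.
Proof. by apply: (@addrI _ (iota 0)); rewrite -iotaD !addr0. Qed.

Let dotv0 (l : 'rV[R]_d) : dotv l 0 = 0 :> R.
Proof. by rewrite /dotv big1// => i _; rewrite mxE mulr0. Qed.

Lemma chC0 l : chC l 0 = 1.
Proof. by rewrite -bohr_map0 chC_iota dotv0 cos0. Qed.

Lemma chS0 l : chS l 0 = 0.
Proof. by rewrite -bohr_map0 chS_iota dotv0 sin0. Qed.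

(** The addition formulas at x + (- x) = 0 form a linear system for the two unknown values, with
    determinant chC^2 + chS^2; this equals 1 on the range of [iota], hence everywhere. *)
Lemma chN l x : chC l (- x) = chC l x /\ chS l (- x) = - chS l x.
Proof.
have := chCD l x (- x); have := chSD l x (- x); rewrite subrr chC0 chS0.
have sq z : chC l z ^+ 2 + chS l z ^+ 2 = 1.
  have E : (fun w => chC l w ^+ 2 + chS l w ^+ 2) = (fun=> 1).
    apply: dense_eq => [w|w|w].
    - apply: (@continuousD _ _ _ (fun z => chC l z ^+ 2) (fun z => chS l z ^+ 2)).
        by rewrite /=; apply: (@continuousM _ _ (chC l) (chC l)); exact: chC_continuous.
      by apply: (@continuousM _ _ (chS l) (chS l)); exact: chS_continuous.
    - exact: cst_continuous.
    - by rewrite chC_iota chS_iota cos2Dsin2.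
  exact: (congr1 (fun f => f z) E).
have := sq x; set c := chC l x; set s := chS l x.
set c' := chC l (- x); set s' := chS l (- x) => e1 e2 e3.
split.
  have -> : c' = c' * (c ^+ 2 + s ^+ 2) by rewrite e1 mulr1.
  have -> : c' * (c ^+ 2 + s ^+ 2) = c * (c * c' - s * s') + s * (s * c' + c * s') by ring.
  by rewrite -e3 -e2 mulr0 mulr1 addr0.
have -> : s' = s' * (c ^+ 2 + s ^+ 2) by rewrite e1 mulr1.
have -> : s' * (c ^+ 2 + s ^+ 2) = c * (s * c' + c * s') - s * (c * c' - s * s') by ring.
by rewrite -e3 -e2 mulr0 mulr1 sub0r.
Qed.

Definition tpoly (s : seq ('rV[R]_d * R * R)) (z : G) : R :=
  \sum_(p <- s) (p.1.2 * chC p.1.1 z + p.2 * chS p.1.1 z).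

Lemma tpolyE s z :
  tpoly s z = \sum_(p <- s) (p.1.2 * chC p.1.1 z + p.2 * chS p.1.1 z).
Proof. by []. Qed.

Lemma tpoly_iota s x : tpoly s (iota x) = trig_poly s x.
Proof. by apply: eq_bigr => p _; rewrite chC_iota chS_iota. Qed.

Lemma tpoly_continuous s : continuous (tpoly s).
Proof.
rewrite /tpoly; elim: s => [|p s ih].
  rewrite (_ : (fun z => _) = cst 0); first exact: cst_continuous.
  by apply/funext => z; rewrite big_nil.
rewrite (_ : (fun z => _) = fun z => (p.1.2 * chC p.1.1 z + p.2 * chS p.1.1 z) +
    \sum_(p <- s) (p.1.2 * chC p.1.1 z + p.2 * chS p.1.1 z)); last first.
  by apply/funext => z; rewrite big_cons.
move=> z; apply: (@continuousD _ _ _ (fun z => p.1.2 * chC p.1.1 z + p.2 * chS p.1.1 z)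
  (fun z => \sum_(p <- s) (p.1.2 * chC p.1.1 z + p.2 * chS p.1.1 z))); last exact: ih.
apply: lin_comb_continuous; [exact: chC_continuous|exact: chS_continuous].
Qed.

(** A cos + B sin at frequency l has i-th derivative B l_i cos - A l_i sin. Acting on coefficient
    lists keeps all derivatives inside the class of trigonometric polynomials. *)
Definition tder (i : 'I_d) (s : seq ('rV[R]_d * R * R)) : seq ('rV[R]_d * R * R) :=
  [seq (p.1.1, p.2 * p.1.1 ord0 i, - (p.1.2 * p.1.1 ord0 i)) | p : 'rV[R]_d * R * R <- s].

Lemma tder_comm i j s z : tpoly (tder i (tder j s)) z = tpoly (tder j (tder i s)) z.
Proof.
by rewrite /tpoly !big_map; apply: eq_bigr => p _ /=; ring.
Qed.

(** By the addition formulas, the restriction to the line through z in direction e_i is a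
    combination of cos(l_i h) and sin(l_i h) with coefficients depending on z, an explicit smooth
    function of h. *)
Lemma tpoly_line i s z : exists F f : R -> R,
  [/\ deriv_of F f, (forall h, F h = tpoly s (z + iota (h *: delta_mx ord0 i))) &
      f 0 = tpoly (tder i s) z].
Proof.
exists (fun h => \sum_(p <- s)
    ((p.1.2 * chC p.1.1 z + p.2 * chS p.1.1 z) * cos (p.1.1 ord0 i * h + 0) +
     (p.2 * chC p.1.1 z - p.1.2 * chS p.1.1 z) * sin (p.1.1 ord0 i * h + 0))).
exists (fun h => \sum_(p <- s)
    ((p.1.2 * chC p.1.1 z + p.2 * chS p.1.1 z) *
       (p.1.1 ord0 i * - sin (p.1.1 ord0 i * h + 0)) +
     (p.2 * chC p.1.1 z - p.1.2 * chS p.1.1 z) *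
       (p.1.1 ord0 i * cos (p.1.1 ord0 i * h + 0)))).
have dcos : deriv_of (@cos R) (fun x => - sin x) by move=> x; exact: is_derive_cos.
have dsin : deriv_of (@sin R) cos by move=> x; exact: is_derive_sin.
split.
- apply: deriv_of_sum => p.
  have aff := fun F f => @deriv_of_comp_affine R (p.1.1 ord0 i) 0 F f.
  exact: (deriv_ofD (deriv_ofZ _ (aff _ _ dcos)) (deriv_ofZ _ (aff _ _ dsin))).
- move=> h; apply: eq_bigr => p _.
  by rewrite chCD chSD chC_iota chS_iota dotvZ_delta addr0; ring.
- rewrite /tpoly /tder big_map; apply: eq_bigr => p _ /=.
  by rewrite mulr0 addr0 sin0 cos0; ring.
Qed.

(** Coefficients of z |-> S(z - y); [trefl] does the same for z |-> S(x - z). Freezing one of the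
    doubled variables thus leaves an admissible test function in the other. *)
Definition tshift (y : G) (s : seq ('rV[R]_d * R * R)) : seq ('rV[R]_d * R * R) :=
  [seq (p.1.1, p.1.2 * chC p.1.1 y - p.2 * chS p.1.1 y,
               p.1.2 * chS p.1.1 y + p.2 * chC p.1.1 y) | p : 'rV[R]_d * R * R <- s].

Lemma tshiftE y s z : tpoly (tshift y s) z = tpoly s (z - y).
Proof.
rewrite /tpoly big_map; apply: eq_bigr => p _ /=.
by rewrite chCD chSD (chN _ y).1 (chN _ y).2; ring.
Qed.

Lemma tder_tshift i y s : tder i (tshift y s) = tshift y (tder i s).
Proof.
rewrite /tder /tshift -!map_comp; apply: eq_map => p /=.
by congr (_, _, _); ring.
Qed.

Definition trefl (x : G) (s : seq ('rV[R]_d * R * R)) : seq ('rV[R]_d * R * R) :=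
  [seq (p.1.1, p.1.2 * chC p.1.1 x + p.2 * chS p.1.1 x,
               p.1.2 * chS p.1.1 x - p.2 * chC p.1.1 x) | p : 'rV[R]_d * R * R <- s].

Lemma treflE x s z : tpoly (trefl x s) z = tpoly s (x - z).
Proof.
rewrite /tpoly big_map; apply: eq_bigr => p _ /=.
by rewrite chCD chSD (chN _ z).1 (chN _ z).2; ring.
Qed.

Definition topp (s : seq ('rV[R]_d * R * R)) : seq ('rV[R]_d * R * R) :=
  [seq (p.1.1, - p.1.2, - p.2) | p : 'rV[R]_d * R * R <- s].

Lemma toppE s z : tpoly (topp s) z = - tpoly s z.
Proof.
by rewrite /tpoly big_map -sumrN; apply: eq_bigr => p _ /=; rewrite !mulNr opprD.
Qed.

Lemma tder_trefl i x s : tder i (trefl x s) = trefl x (topp (tder i s)).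
Proof.
rewrite /tder /trefl /topp -!map_comp; apply: eq_map => p /=.
by congr (_, _, _); ring.
Qed.

Lemma tder_topp i s : tder i (topp s) = topp (tder i s).
Proof.
rewrite /tder /topp -!map_comp; apply: eq_map => p /=.
by rewrite !mulNr.
Qed.

(** Almost periodicity of F o iota gives the estimate on the dense range of [iota], and the estimate
    is a closed condition. *)
Lemma tpoly_approx (F : G -> R) e : continuous F -> 0 < e ->
  exists s, forall z, `|F z - tpoly s z| <= e.
Proof.
move=> cF e0; have [s Hs] := iota_ap cF e0; exists s.
apply: (@dense_le (fun z => `|F z - tpoly s z|)) => [z|x].
  apply: (@continuous_comp _ _ _ (fun z => F z - tpoly s z) (fun y => `|y|)).
    2: exact: norm_continuous.
  by apply: (@continuousB _ _ _ F (tpoly s)); [exact: cF|exact: tpoly_continuous].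
by rewrite tpoly_iota; exact: Hs.
Qed.

End Characters.

(** * Test functions: smooth in time, trigonometric in space *)

Section SmoothReal.
Context {R : realType}.
Implicit Types th : R -> R.

Lemma deriv_of_quot (F f : R -> R) : deriv_of F f ->
  forall x, (F (x + h) - F x) / h @[h --> 0^'] --> f x.
Proof.
move=> Ff x; have [dF DF] := Ff x.
have : h^-1 *: ((F \o shift x) (h *: 1) - F x) @[h --> 0^'] --> f x.
  by rewrite -DF; exact: dF.
apply: cvg_trans; apply: near_eq_cvg; apply: nearW => h /=.
by rewrite /GRing.scale/= mulr1 mulrC (addrC x).
Qed.

Lemma smooth_real_deriv th : smooth_real th ->
  deriv_of th (derive1 th) /\ smooth_real (derive1 th).
Proof.
move=> sth; split.
  by move=> x; apply: DeriveDef; [exact: (sth 0%N x)|rewrite derive1E].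
by move=> n x; have := sth n.+1 x; rewrite derive1Sn.
Qed.

End SmoothReal.

Section TestFunctions.
Context {R : realType} (d : nat) (G : topologicalZmodType).
Variable iota : 'rV[R]_d -> G.
Hypothesis Hbohr : is_bohr_compactification iota.
Local Notation tpoly := (tpoly Hbohr).

Definition tensor (th : R -> R) (P : G -> R) : R * G -> R :=
  fun p => th p.1 * P p.2.

Lemma tensor_continuous th P : continuous th -> continuous P ->
  continuous (tensor th P).
Proof.
move=> ct cP p; apply: (@continuousM _ _ (fun p => th p.1) (fun p => P p.2)).
  by apply: continuous_comp; [exact: cvg_fst|exact: ct].
by apply: continuous_comp; [exact: cvg_snd|exact: cP].
Qed.

Lemma pd_of_cvg j (phi psi : R * G -> R) :
  (forall p, diffquot iota j phi p h @[h --> 0^'] --> psi p) ->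
  pd_exists iota j phi /\ pd iota j phi = psi.
Proof.
move=> H; split; first by move=> p; apply/cvg_ex; exists (psi p); exact: H.
by apply/funext => p; apply/cvg_lim; [exact: Rhausdorff|exact: H].
Qed.

Lemma pd_time th th' P : deriv_of th th' ->
  pd_exists iota None (tensor th P) /\
  pd iota None (tensor th P) = tensor th' P.
Proof.
move=> dth; apply: pd_of_cvg => -[t x].
have := deriv_of_quot (deriv_of_ext (deriv_ofZ (P x) dth) (fun z => mulrC _ _)) (x := t).
apply: cvg_trans; apply: near_eq_cvg; apply: nearW => h /=.
by rewrite /diffquot /tensor/= !(mulrC (P x)).
Qed.

Lemma pd_space th s i :
  pd_exists iota (Some i) (tensor th (tpoly s)) /\
  pd iota (Some i) (tensor th (tpoly s)) = tensor th (tpoly (tder i s)).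
Proof.
apply: pd_of_cvg => -[t x].
have [F [f [dF FE f0]]] := tpoly_line Hbohr i s x.
have := deriv_of_quot (deriv_ofZ (th t) dF) (x := 0); rewrite f0.
apply: cvg_trans; apply: near_eq_cvg; apply: nearW => h /=.
by rewrite /diffquot /tensor/= add0r !FE scale0r (bohr_map0 Hbohr) addr0.
Qed.

Lemma smooth_n_tensor n th s : smooth_real th ->
  smooth_n iota n (tensor th (tpoly s)).
Proof.
elim: n th s => [|n ih] th s sth.
  apply: tensor_continuous; last exact: tpoly_continuous.
  exact: deriv_of_continuous (smooth_real_deriv sth).1.
split.
  apply: tensor_continuous; last exact: tpoly_continuous.
  exact: deriv_of_continuous (smooth_real_deriv sth).1.
have [dth sth'] := smooth_real_deriv sth.
case=> [i|].
  by have [ex ->] := pd_space th s i; split => //; exact: ih.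
by have [ex ->] := pd_time (tpoly s) dth; split => //; exact: ih.
Qed.

(** G being compact, [a, b] x G is compact, so only the time factor has to be cut off. *)
Lemma test_fun_tensor th s (a b : R) : smooth_real th -> 0 < a ->
  (forall t, th t != 0 -> a <= t <= b) -> test_fun iota (tensor th (tpoly s)).
Proof.
move=> sth a0 supp; split; first by move=> n; exact: smooth_n_tensor.
pose K : set (R * G) := `[a, b] `*` [set: G].
have cK : compact K.
  apply: compact_setX; first exact: segment_compact.
  by case: Hbohr.
have clK : closed K.
  have -> : K = fst @^-1` `[a, b]%classic.
    by rewrite /K setXT.
  by apply: preimage_closed; [move=> x _; exact: cvg_fst|exact: interval_closed].
have sub : closure [set p | tensor th (tpoly s) p != 0] `<=` K.
  move/closure_id : (clK) => ->; apply: closureS => p /=.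
  rewrite /tensor mulf_eq0 negb_or => /andP[/supp + _].
  by rewrite /K/= in_itv.
split; first by apply: subclosed_compact cK sub; exact: closed_closure.
by move=> p /sub[/= + _]; rewrite in_itv/= => /andP[+ _]; exact: lt_le_trans.
Qed.

End TestFunctions.

(** * Haar integrals and trigonometric mollifiers *)

Lemma compact_cover_inhabited (T : topologicalType) (x : T) :
  compact = @cover_compact T.
Proof.
pose PT : ptopologicalType := HB.pack (Topological.sort T) (isPointed.Build T x).
exact: (@compact_cover PT).
Qed.

Section HaarIntegral.
Context {R : realType} (d : nat) (G : topologicalZmodType).
Variable iota : 'rV[R]_d -> G.
Hypothesis Hbohr : is_bohr_compactification iota.
Variable m : probability (GB R G) R.
Hypothesis Hhaar : is_haar m.
Local Notation tpoly := (tpoly Hbohr).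

Lemma continuous_measurable_GB (F : G -> R) : continuous F ->
  measurable_fun [set: GB R G] (F : GB R G -> R).
Proof.
move=> cF; apply: (measurability _ (RGenOpens.measurableE R)).
move=> _ [_ [a [b ->] <-]]; rewrite setTI; apply: sub_sigma_algebra.
by exists F; split => //; exists `]a, b[%classic; split => //; exact: interval_open.
Qed.

Lemma continuous_bm (F : G -> R) : continuous F ->
  bounded_meas (F : GB R G -> R).
Proof.
move=> cF; split; first exact: continuous_measurable_GB.
by have [C [_ HC]] := compact_fun_bounded Hbohr cF; exists C.
Qed.

(** Measurability for the product sigma-algebra is not read off from continuity of x - y; it comes
    from expanding S(x - y), by the addition formulas, into products of functions of x and of y. *)
Lemma tpoly_diff_bm s : bounded_meas
  (fun z : (measurableTypeR R * GB R G) * (measurableTypeR R * GB R G) => tpoly s ((z.1.2 : G) - (z.2.2 : G))).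
Proof.
have bl (F : G -> R) : continuous F ->
    bounded_meas (fun z : (measurableTypeR R * GB R G) * (measurableTypeR R * GB R G) => F z.1.2).
  move=> cF; have [mF [C HC]] := continuous_bm cF; split; last by exists C.
  by apply: measurableT_comp mF _; apply: measurableT_comp; [exact: measurable_snd|exact: measurable_fst].
have br (F : G -> R) : continuous F ->
    bounded_meas (fun z : (measurableTypeR R * GB R G) * (measurableTypeR R * GB R G) => F z.2.2).
  move=> cF; have [mF [C HC]] := continuous_bm cF; split; last by exists C.
  by apply: measurableT_comp mF _; apply: measurableT_comp; [exact: measurable_snd|exact: measurable_snd].
have -> : (fun z : (measurableTypeR R * GB R G) * (measurableTypeR R * GB R G) => tpoly s ((z.1.2 : G) - (z.2.2 : G))) =
   fun z => \sum_(p <- s)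
     ((p.1.2 * chC Hbohr p.1.1 z.1.2 + p.2 * chS Hbohr p.1.1 z.1.2) * chC Hbohr p.1.1 z.2.2 +
      (p.1.2 * chS Hbohr p.1.1 z.1.2 - p.2 * chC Hbohr p.1.1 z.1.2) * chS Hbohr p.1.1 z.2.2).
  apply/funext => z; rewrite -treflE !tpolyE big_map; apply: eq_bigr => p _ /=.
  by [].
apply: bm_sum => p.
have cC := @chC_continuous _ _ _ _ Hbohr p.1.1; have cS := @chS_continuous _ _ _ _ Hbohr p.1.1.
apply: bmD.
  apply: bmM; last exact: (br _ cC).
  by apply: bmD; apply: bmM; [exact: bm_cst|exact: (bl _ cC)|exact: bm_cst|exact: (bl _ cS)].
apply: bmM; last exact: (br _ cS).
by apply: bmB; apply: bmM; [exact: bm_cst|exact: (bl _ cS)|exact: bm_cst|exact: (bl _ cC)].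
Qed.

Let mfin : (m setT < +oo)%E. Proof. by rewrite probability_setT ltry. Qed.

Lemma measurable_translation (y : G) :
  @measurable_fun _ _ (GB R G) (GB R G) setT (fun x => (x : G) + y).
Proof.
apply: (@measurability _ _ (GB R G) (GB R G) _ _ (@baire_gen R G)); first by [].
move=> _ [_ [F [cF [V [oV ->]]]] <-]; rewrite setTI; apply: sub_sigma_algebra.
exists (fun x => F (x + y)); split.
  by move=> x; apply: continuous_comp; [exact: addr_continuousl|exact: cF].
by exists V.
Qed.

Lemma haar_shift (F : G -> R) (y : G) : continuous F ->
  \int[m]_x F ((x : G) + y) = \int[m]_x F x.
Proof.
move=> cF.
have cFy : continuous (fun x => F (x + y)).
  by move=> x; apply: continuous_comp; [exact: addr_continuousl|exact: cF].
have iFy := bm_integ mfin (continuous_bm cFy).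
rewrite /Rintegral; congr fine.
transitivity (\int[@pushforward _ _ (GB R G) (GB R G) R m
    (fun x => ((x : G) + y)%R)]_x (F x)%:E)%E.
  rewrite integral_pushforward//.
  - exact: measurable_translation.
  - by apply/measurable_EFinP; exact: continuous_measurable_GB.
apply: eq_measure_integral; first exact: measurable_translation.
by move=> mt A mA _; exact: Hhaar.
Qed.

(** The translates of {F > 1/2} cover G, since F 0 = 1. Finitely many suffice, so the sum of the
    corresponding translates of F is at least 1/2 everywhere, while by invariance its integral is a
    multiple of that of F. *)
Lemma haar_pos (F : G -> R) : continuous F -> (forall z, 0 <= F z) -> F 0 = 1 ->
  0 < \int[m]_x F x.
Proof.
move=> cF F0 F01.
have cptG : compact [set: G] by case: Hbohr.
have cFy y : continuous (fun x => F (x + y)).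
  by move=> x; apply: continuous_comp; [exact: addr_continuousl|exact: cF].
rewrite (compact_cover_inhabited 0) in cptG.
have [||D _ Dcov] := cptG G setT (fun y => (fun x => F (x + y)) @^-1` [set r | 2^-1 < r]).
- move=> y _; apply: open_comp; [by move=> x _; exact: cFy|exact: open_gt].
- by move=> x _; exists (- x) => //=; rewrite subrr F01; lra.
have iF y := bm_integ mfin (continuous_bm (cFy y)).
have : 2^-1 <= \int[m]_x (\sum_(y <- finmap.enum_fset D) F ((x : G) + y)).
  have -> : 2^-1 = \int[m]_x ((fun=> 2^-1) x) :> R.
    rewrite Rintegral_cst// -[LHS]mulr1; congr (_ * _).
    exact/esym/(congr1 fine (probability_setT m)).
  apply: Rint_le; [exact/bm_integ/bm_cst|exact: integ_sum|move=> x].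
  have [y /= yD Fxy] := Dcov x Logic.I.
  rewrite (big_rem y)//= (le_trans (ltW Fxy))// lerDl.
  by rewrite sumr_ge0.
rewrite Rint_sum// (eq_bigr (fun=> \int[m]_x F x)); last by move=> y _; exact: haar_shift.
have I0 : 0 <= \int[m]_x F x by apply: Rintegral_ge0.
rewrite lt_neqAle I0 andbT => h; apply: contraPneq h => <-.
by rewrite big1_eq; apply/negP; rewrite -ltNge; lra.
Qed.

Lemma tpoly_int_shift s y : \int[m]_x tpoly s ((x : G) - y) = \int[m]_x tpoly s x.
Proof. exact: haar_shift (@tpoly_continuous _ _ _ _ Hbohr s). Qed.

(* The bump max(0, 1 - (Lam z + Lam (-z))/e) is approximated by an even
   trigonometric polynomial, which is then shifted up and normalized. *)
Lemma mollifier (Lam : G -> R) (e : R) : continuous Lam ->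
  (forall z, 0 <= Lam z) -> Lam 0 = 0 -> 0 < e -> exists s,
  [/\ forall z, 0 <= tpoly s z, \int[m]_x tpoly s x = 1,
      forall z, tpoly s (- z) = tpoly s z &
      forall z, Lam z * tpoly s z <= e * tpoly s z + e].
Proof.
move=> cLam Lam0 Lamz e0.
pose L (z : G) : R := Lam z + Lam (- z).
have cLamN : continuous (fun z => Lam (- z)).
  by move=> z; apply: continuous_comp; [exact: opp_continuous|exact: cLam].
have cL : continuous L by move=> z; apply: (@continuousD _ _ _ Lam (fun z => Lam (- z))); [exact: cLam|exact: cLamN].
have LN z : L (- z) = L z by rewrite /L opprK addrC.
pose F (z : G) : R := Num.max 0 (1 - L z / e).
have cF : continuous F.
  move=> z; apply: (@continuous_max _ _ (cst 0) (fun z => 1 - L z / e)).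
    exact: cst_continuous.
  have := @lin_comb_continuous _ _ (fun=> 1) L 1 (- e^-1) (@cst_continuous _ _ _) cL z.
  rewrite (_ : (fun z => _) = (fun z => 1 - L z / e))//.
  by apply/funext => w; rewrite mulr1 mulNr mulrC.
have F0 z : 0 <= F z by rewrite /F le_max lexx.
have FN z : F (- z) = F z by rewrite /F LN.
have F01 : F 0 = 1.
  by rewrite /F /L oppr0 Lamz addr0 mul0r subr0; apply/max_idPr.
have LF z : Lam z * F z <= e * F z.
  rewrite /F; case: (leP 0 (1 - L z / e)) => h; last by rewrite !mulr0.
  rewrite ler_wpM2r//; move: h; rewrite subr_ge0 ler_pdivrMr// mul1r.
  by apply: le_trans; rewrite lerDl.
have I0 : 0 < \int[m]_x F x by apply: haar_pos.
set I := \int[m]_x F x in I0.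
have [B [B0 HB]] := compact_fun_bounded Hbohr cLam.
(* Replacing F by the polynomial raises Lam F by at most 2 B del, and this has to stay below e after
   division by J >= I. *)
pose del : R := e * I / (2 * (B + 1)).
have B1 : 0 < 2 * (B + 1) by rewrite mulr_gt0// ltr_wpDl.
have del0 : 0 < del by rewrite divr_gt0// mulr_gt0.
have [s0 Hs0] := tpoly_approx Hbohr cF del0.
(* Dropping the sine coefficients takes the even part; F being even, the approximation is no
   worse. *)
pose s1 := [seq (p.1.1, p.1.2, 0 : R) | p : 'rV[R]_d * R * R <- s0].
have s1E z : tpoly s1 z = (tpoly s0 z + tpoly s0 (- z)) / 2.
  rewrite !tpolyE big_map -big_split/= mulr_suml; apply: eq_bigr => p _.
  by rewrite (chN Hbohr _ z).1 (chN Hbohr _ z).2 mul0r addr0; field.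
(* A term of frequency 0 adds the constant del, which lifts the polynomial above F, hence above
   0. *)
pose s2 := ((0 : 'rV[R]_d), del, (0 : R)) :: s1.
have s2E z : tpoly s2 z = del + tpoly s1 z.
  rewrite !tpolyE big_cons/= mul0r addr0; congr (_ + _).
  have -> : chC Hbohr 0 z = 1; last by rewrite mulr1.
  have -> : chC Hbohr 0 = cst 1; last by [].
  apply: (dense_eq Hbohr); [exact: chC_continuous|exact: cst_continuous|].
  move=> x; rewrite chC_iota /dotv big1 ?cos0// => i _.
  by rewrite mxE mul0r.
have s1F z : `|F z - tpoly s1 z| <= del.
  have h1 := Hs0 z; have h2 := Hs0 (- z); rewrite FN in h2.
  move: h1 h2; rewrite s1E !ler_norml => /andP[? ?] /andP[? ?]; lra.
have FS z : F z <= tpoly s2 z.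
  by rewrite s2E; have := s1F z; rewrite ler_norml => /andP[? ?]; lra.
have SF z : tpoly s2 z <= F z + 2 * del.
  by rewrite s2E; have := s1F z; rewrite ler_norml => /andP[? ?]; lra.
set J := \int[m]_x tpoly s2 x.
have IJ : I <= J.
  apply: Rint_le => //; apply: bm_integ => //; apply: continuous_bm => //.
  exact: tpoly_continuous.
have J0 : 0 < J by apply: lt_le_trans IJ.
pose s := [seq (p.1.1, J^-1 * p.1.2, J^-1 * p.2) | p : 'rV[R]_d * R * R <- s2].
have sE z : tpoly s z = J^-1 * tpoly s2 z.
  rewrite !tpolyE big_map mulr_sumr; apply: eq_bigr => p _ /=.
  by rewrite mulrDr !mulrA.
have Ji : 0 < J^-1 by rewrite invr_gt0.
exists s; split.
- by move=> z; rewrite sE mulr_ge0 ?(ltW Ji)// (le_trans (F0 z)).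
- transitivity (\int[m]_z (J^-1 * tpoly s2 z)).
    by apply: eq_Rintegral => z _; exact: sE.
  rewrite RintZ ?mulVf ?gt_eqF//; apply: bm_integ => //; apply: continuous_bm.
  exact: tpoly_continuous.
- by move=> z; rewrite !sE !s2E !s1E opprK (addrC (tpoly s0 (- z))).
- move=> z; rewrite sE.
  have h : Lam z * tpoly s2 z <= e * tpoly s2 z + B * (2 * del).
    have := LF z; have := SF z; have := FS z.
    have Lz : Lam z <= B by rewrite (le_trans (ler_norm _)).
    have Lz0 := Lam0 z => h1 h2 h3.
    have t : 0 <= tpoly s2 z - F z by rewrite subr_ge0.
    have : Lam z * (tpoly s2 z - F z) <= B * (2 * del).
      by apply: ler_pM => //; lra.
    have : e * F z <= e * tpoly s2 z by rewrite ler_wpM2l// ltW.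
    by rewrite mulrBr; lra.
  have -> : Lam z * (J^-1 * tpoly s2 z) = J^-1 * (Lam z * tpoly s2 z) by ring.
  have : J^-1 * (Lam z * tpoly s2 z) <= J^-1 * (e * tpoly s2 z + B * (2 * del)).
    by rewrite ler_pM2l.
  move=> /le_trans; apply; rewrite mulrDr mulrCA lerD2l mulrC ler_pdivrMr//.
  have -> : B * (2 * del) = e * I * (B / (B + 1)).
    by rewrite /del; field; rewrite gt_eqF// ltr_wpDl.
  apply: (@le_trans _ _ (e * I)); last by rewrite ler_pM2l.
  rewrite ler_piMr// ?mulr_ge0 ?(ltW e0) ?(ltW I0)//.
  by rewrite ler_pdivrMr ?mul1r ?lerDl// ltr_wpDl.
Qed.

End HaarIntegral.

(** * Smooth bump functions *)

Section SmoothClass.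
Context {R : realType}.
Implicit Types f g : R -> R.

(** Derivatives are existentially quantified, so that closure of smooth functions under products or
    affine substitution is an induction that computes no iterated derivative. *)
Fixpoint ntimes_deriv (n : nat) f : Prop :=
  if n is n'.+1 then exists f', deriv_of f f' /\ ntimes_deriv n' f' else True.

Lemma smooth_realP f : smooth_real f <-> forall n, ntimes_deriv n f.
Proof.
split=> [sf n|].
  elim: n f sf => // n ih f /smooth_real_deriv[df sf'].
  by exists (derive1 f); split => //; exact: ih.
move=> H n x; have := H n.+1; move: f {H} x; elim: n => [|n ih] f x.
  by move=> [f' [df _]]; exact: deriv_of_derivable df x.
by move=> [f' [df nf']]; rewrite derive1Sn (deriv_ofE df); exact: ih.
Qed.

Lemma ntimes_derivS n f : ntimes_deriv n.+1 f -> ntimes_deriv n f.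
Proof.
elim: n f => // n ih f [f' [df /ih nf']].
by exists f'.
Qed.

Lemma ntimes_derivD n f g : ntimes_deriv n f -> ntimes_deriv n g ->
  ntimes_deriv n (fun x => f x + g x).
Proof.
elim: n f g => // n ih f g [f' [df nf]] [g' [dg ng]].
by exists (fun x => f' x + g' x); split; [exact: deriv_ofD|exact: ih].
Qed.

Lemma ntimes_derivM n f g : ntimes_deriv n f -> ntimes_deriv n g ->
  ntimes_deriv n (fun x => f x * g x).
Proof.
elim: n f g => // n ih f g nf ng.
have [f' [df nf']] := nf; have [g' [dg ng']] := ng.
exists (fun x => f x * g' x + f' x * g x); split; first exact: deriv_ofM.
by apply: ntimes_derivD; apply: ih => //; exact: ntimes_derivS.
Qed.

Lemma smooth_realD f g : smooth_real f -> smooth_real g ->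
  smooth_real (fun x => f x + g x).
Proof. by rewrite !smooth_realP => nf ng n; exact: ntimes_derivD. Qed.

Lemma smooth_realM f g : smooth_real f -> smooth_real g ->
  smooth_real (fun x => f x * g x).
Proof. by rewrite !smooth_realP => nf ng n; exact: ntimes_derivM. Qed.

Lemma smooth_real_cst c : smooth_real (fun _ : R => c).
Proof.
apply/smooth_realP => n; elim: n c => // n ih c.
by exists (fun=> 0); split; [exact: deriv_of_cst|exact: ih].
Qed.

Lemma smooth_real_affine k c f : smooth_real f ->
  smooth_real (fun x => f (k * x + c)).
Proof.
move=> /smooth_realP nf; apply/smooth_realP => n; move: (nf n) => {nf}.
elim: n f => // n ih f [f' [df nf']].
exists (fun x => k * f' (k * x + c)); split; first exact: deriv_of_comp_affine.
apply: ntimes_derivM; last exact: ih.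
by move: n {ih nf'}; apply/smooth_realP; exact: smooth_real_cst.
Qed.

Lemma smooth_real_of_deriv F f : deriv_of F f -> smooth_real f -> smooth_real F.
Proof.
move=> dF /smooth_realP nf; apply/smooth_realP => -[//|n].
by exists f.
Qed.

End SmoothClass.

Section Bump.
Context {R : realType}.

(** Monomial by monomial, from y^i / i! <= exp y. *)
Lemma poly_expR_bounded (P : {poly R}) :
  exists C : R, 0 <= C /\ forall y, 0 < y -> `|P.[y] * expR (- y)| <= C.
Proof.
exists (\sum_(i < size P) `|P`_i| * i`!%:R); split.
  by apply: sumr_ge0 => i _; rewrite mulr_ge0.
move=> y y0; rewrite horner_coef mulr_suml.
apply: le_trans (ler_norm_sum _ _ _) _; apply: ler_sum => i _.
rewrite -mulrA normrM ler_wpM2l// ger0_norm; last first.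
  by rewrite mulr_ge0 ?expR_ge0// exprn_ge0// ltW.
rewrite expRN ler_pdivrMr ?expR_gt0//.
case: (nat_of_ord i) => [|n].
  rewrite expr0 fact0 mul1r.
  by have := expR_ge1Dx y; lra.
have := expR_ge1Dxn n (ltW y0); move=> h.
have f0 : 0 < n.+1`!%:R :> R by rewrite ltr0n fact_gt0.
rewrite mulrC -ler_pdivrMr//; lra.
Qed.

(* This class is closed under differentiation, so that exp(-1/x) is smooth at 0. *)
Definition flat (P : {poly R}) (x : R) : R :=
  if 0 < x then P.[x^-1] * expR (- x^-1) else 0.

(** For x > 0 and y = 1/x, the derivative of P(y) exp(-y) in x is y^2 (P - P')(y) exp(-y). At 0,
    boundedness of y^2 P(y) exp(-y) gives |flat P h| <= C h^2, so the difference quotients tend to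
    0. *)
Lemma deriv_of_flat P : deriv_of (flat P) (flat ('X^2 * (P - P^`()))).
Proof.
move=> x; have [x0|x0|->] := ltgtP x 0.
- have -> : flat ('X^2 * (P - P^`())) x = 0 by rewrite /flat ltNge ltW.
  apply: near_eq_is_derive (deriv_of_cst 0 x).
  near=> y; rewrite /flat ltNge ltW//.
  by near: y; exact: lt_nbhsl.
- pose F (y : R) := P.[y^-1] * expR (- y^-1).
  have dV : is_derive x (1 : R) (fun y : R => y^-1) (- x^-2).
    have xn0 : id x != 0 by rewrite gt_eqF.
    have := is_deriveV xn0 (deriv_of_id x).
    by rewrite /GRing.scale/= mulr1.
  have dP : is_derive x (1 : R) (fun y : R => P.[y^-1]) (P^`().[x^-1] * (- x^-2)).
    exact: (@is_derive1_comp _ (horner P) _ _ _ _ (is_derive_poly P x^-1) dV).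
  have dE : is_derive x (1 : R) (fun y : R => expR (- y^-1)) (expR (- x^-1) * (- - x^-2)).
    have dN : is_derive x (1 : R) (fun y : R => - y^-1) (- - x^-2) := is_deriveN dV.
    exact: (@is_derive1_comp _ expR (fun y => - y^-1) x _ _ (is_derive_expR _) dN).
  have -> : flat ('X^2 * (P - P^`())) x =
      P.[x^-1] * (expR (- x^-1) * (- - x^-2)) + expR (- x^-1) * (P^`().[x^-1] * (- x^-2)).
    rewrite /flat x0 hornerM hornerXn hornerD hornerN -exprVn; ring.
  apply: near_eq_is_derive (is_deriveM dP dE).
  near=> y; rewrite /flat ifT//.
  by near: y; exact: lt_nbhsr.
- have -> : flat ('X^2 * (P - P^`())) 0 = 0 by rewrite /flat ltxx.
  have [C [C0 HC]] := poly_expR_bounded ('X^2 * P).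
  have Hb h : `|flat P h| <= C * h ^+ 2.
    rewrite /flat; case: ifPn => h0; last by rewrite normr0 mulr_ge0// sqr_ge0.
    have hi : 0 < h^-1 by rewrite invr_gt0.
    have := HC _ hi; rewrite hornerM hornerXn -mulrA normrM exprVn.
    rewrite ger0_norm; last by rewrite invr_ge0 sqr_ge0.
    by rewrite mulrC ler_pdivrMr// exprn_gt0.
  have lim0 : h^-1 *: ((flat P \o shift 0) (h *: 1) - flat P 0) @[h --> 0^'] --> (0 : R).
    apply/cvgrPdist_le => e e0.
    near=> h; rewrite /= sub0r normrN addr0.
    have -> : flat P 0 = 0 by rewrite /flat ltxx.
    have h0 : h != 0 by near: h; exact: nbhs_dnbhs_neq.
    rewrite subr0 /GRing.scale/= mulr1 normrM normfV mulrC ler_pdivrMr ?normr_gt0//.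
    apply: le_trans (Hb h) _; rewrite -(real_normK (num_real h)) expr2 mulrA ler_wpM2r//.
    have hs : `|h| <= e / (C + 1).
      near: h; apply: dnbhs0_le; rewrite divr_gt0// ltr_wpDl//.
    apply: le_trans (ler_wpM2l C0 hs) _.
    rewrite mulrCA ler_piMr ?(ltW e0)// ler_pdivrMr ?mul1r ?lerDl//.
    by rewrite ltr_wpDl.
  apply: DeriveDef; first by apply/cvg_ex; exists 0; exact: lim0.
  by apply/cvg_lim; [exact: Rhausdorff|exact: lim0].
Unshelve. all: by end_near. Qed.

Lemma smooth_flat P : smooth_real (flat P).
Proof.
apply/smooth_realP => n; elim: n P => // n ih P.
by exists (flat ('X^2 * (P - P^`()))); split; [exact: deriv_of_flat|exact: ih].
Qed.

Lemma flat1_gt0 x : 0 < x -> 0 < flat 1 x.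
Proof. by move=> x0; rewrite /flat x0 hornerC mul1r expR_gt0. Qed.

Lemma flat1_ge0 x : 0 <= flat 1 x.
Proof. by rewrite /flat; case: ifP => // _; rewrite hornerC mul1r expR_ge0. Qed.

Lemma flat1_homo x y : 0 < x -> x <= y -> flat 1 x <= flat 1 y.
Proof.
move=> x0 xy; have y0 := lt_le_trans x0 xy.
by rewrite /flat x0 y0 !hornerC !mul1r ler_expR lerN2 lef_pV2.
Qed.

(** A smooth probability density [k] on [a, b] with its distribution function [K]. The former serves
    as an approximate Dirac mass, the latter as a smoothed step. *)
Record bump (a b : R) (k K : R -> R) : Prop := Bump {
  bump_smooth : smooth_real k;
  bump_deriv : deriv_of K k;
  bump_ge0 : forall x, 0 <= k x;
  bump_supp : forall x, k x != 0 -> a <= x <= b;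
  bump_left : forall x, x <= a -> K x = 0;
  bump_right : forall x, b <= x -> K x = 1 }.

Lemma bump_exists (a b : R) : a < b -> exists k K, bump a b k K.
Proof.
move=> ab.
pose k0 x := flat 1 (1 * x - a) * flat 1 (-1 * x + b).
have sk0 : smooth_real k0.
  by apply: smooth_realM; apply: smooth_real_affine; exact: smooth_flat.
have k00 x : 0 <= k0 x by rewrite mulr_ge0// flat1_ge0.
have k0s x : k0 x != 0 -> a <= x <= b.
  rewrite mulf_eq0 negb_or mul1r mulN1r => /andP[h1 h2].
  apply/andP; split; rewrite leNgt; apply/negP => h.
    by move: h1; rewrite /flat ifF ?eqxx//; apply/negbTE; rewrite -leNgt; lra.
  by move: h2; rewrite /flat ifF ?eqxx//; apply/negbTE; rewrite -leNgt; lra.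
have [dk0 _] := smooth_real_deriv sk0.
have [L [dL L0]] := continuous_antiderivative (deriv_of_continuous dk0).
(* On the middle half [a + w, b - w] both factors of k0 are at least flat 1 w > 0, so the total mass
   can be normalized. *)
pose w := (b - a) / 4; have w0 : 0 < w by rewrite /w; lra.
have pos : 0 < L b - L a.
  have h1 : L a <= L (a + w).
    by apply: (deriv_of_nondecreasing _ dL) => [|x _]; [lra|exact: k00].
  have h2 : L (b - w) <= L b.
    by apply: (deriv_of_nondecreasing _ dL) => [|x _]; [lra|exact: k00].
  have h3 : flat 1 w * flat 1 w * (b - w) <= L (b - w) - L (a + w) + flat 1 w * flat 1 w * (a + w).
    have := @deriv_of_nondecreasing _ _ _ (a + w) (b - w) _
      (deriv_ofB dL (deriv_ofZ (flat 1 w * flat 1 w) deriv_of_id)).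
    have aw : a + w <= b - w by rewrite /w; lra.
    move=> /(_ aw) /= h; suff : L (a + w) - flat 1 w * flat 1 w * (a + w) <=
      L (b - w) - flat 1 w * flat 1 w * (b - w) by lra.
    apply: h => x /andP[x1 x2]; rewrite mulr1 subr_ge0 ler_pM ?flat1_ge0//;
      apply: flat1_homo => //; lra.
  have : 0 < flat 1 w * flat 1 w * (b - w - (a + w)).
    rewrite mulr_gt0 ?mulr_gt0 ?flat1_gt0//; rewrite /w; lra.
  by rewrite mulrBr; lra.
have Lc x y : x <= y -> (forall z, x <= z <= y -> k0 z = 0) -> L x = L y.
  move=> xy h; have H : `|L y - L x| <= 0 - 0.
    by apply: (deriv_of_dominated xy dL (deriv_of_cst 0)) => z /h ->; rewrite normr0.
  by move: H; rewrite subrr normr_le0 subr_eq0 => /eqP.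
pose c := (L b - L a)^-1.
have c0 : 0 < c by rewrite invr_gt0.
have k0z x : ~~ (a < x < b) -> k0 x = 0.
  rewrite negb_and -!leNgt /k0 mul1r mulN1r => /orP[h|h].
    by rewrite /flat ifF ?mul0r//; apply/negbTE; rewrite -leNgt; lra.
  by rewrite [X in _ * X]/flat ifF ?mulr0//; apply/negbTE; rewrite -leNgt; lra.
exists (fun x => c * k0 x), (fun x => c * (L x - L a)); split.
- by apply: smooth_realM => //; exact: smooth_real_cst.
- apply: deriv_of_ext (deriv_ofZ c (deriv_ofB dL (deriv_of_cst (L a)))) _ => x.
  by rewrite subr0.
- by move=> x; rewrite mulr_ge0// ltW.
- by move=> x; rewrite mulf_eq0 negb_or => /andP[_]; exact: k0s.
- move=> x xa; rewrite (Lc x a)// ?subrr ?mulr0// => z /andP[_ za].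
  by apply: k0z; rewrite negb_and -leNgt za.
- move=> x bx; rewrite -(Lc b x)// ?mulVf ?gt_eqF// => z /andP[bz _].
  by apply: k0z; rewrite negb_and -!leNgt bz orbT.
Qed.

End Bump.

(** * Density of functions with a modulus of continuity *)

Section BoundedConvergence.
Context {R : realType} d (T : measurableType d) (nu : {measure set T -> \bar R}).
Hypothesis nufin : (nu setT < +oo)%E.

Lemma bounded_convergence (f_ : nat -> T -> R) (f : T -> R) (C : R) :
  (forall n, measurable_fun setT (f_ n)) -> measurable_fun setT f ->
  (forall n x, `|f_ n x| <= C) -> (forall x, `|f x| <= C) ->
  (forall x, f_ n x @[n --> \oo] --> f x) ->
  forall e, 0 < e -> exists n, \int[nu]_x `|f x - f_ n x| <= e.
Proof.
move=> mf_ mf f_C fC cvgf e e0.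
have bf_ n : bounded_meas (f_ n) by split => //; exists C.
have bf : bounded_meas f by split => //; exists C.
have ic : nu.-integrable setT (EFin \o (cst C)) := bm_integ nufin (bm_cst _ C).
have [] := @dominated_convergence _ _ _ nu setT measurableT
  (fun n => EFin \o f_ n) (EFin \o f) (EFin \o cst C).
- by move=> n; exact/measurable_EFinP.
- exact/measurable_EFinP.
- by apply/aeW => x _; apply/fine_cvgP; split; [exact: nearW|exact: cvgf].
- exact: ic.
- by apply/aeW => x n _ /=; rewrite lee_fin.
move=> _ + _.
have E n : (\int[nu]_x `|(EFin \o f_ n) x - (EFin \o f) x| =
    (\int[nu]_x `|f x - f_ n x|)%:E)%E.
  rewrite /Rintegral fineK.
    by apply: eq_integral => x _ /=; rewrite distrC.
  apply: integrable_fin_num => //; apply: bm_integ => //.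
  exact: bm_norm (bmB bf (bf_ n)).
rewrite (_ : [sequence _]_n = fun n => (\int[nu]_x `|f x - f_ n x|)%:E); last first.
  by apply/funext => n; rewrite /= E.
move=> /fine_cvgP[_ /cvgrPdist_le/(_ e e0)[N _ /(_ N (leqnn N))]].
rewrite /= sub0r normrN => h; exists N; apply: le_trans h; exact: ler_norm.
Qed.

End BoundedConvergence.

(** A discrete layer-cake formula: summing the indicators of the levels 1, ..., N below y recovers y
    up to one unit. It reduces the approximation of a bounded function to that of its superlevel
    sets. *)
Lemma layer_count {R : realType} (y : R) N : 0 <= y -> y <= N%:R ->
  `|y - \sum_(k < N) (k.+1%:R < y)%R%:R| <= 1.
Proof.
move=> y0 yN.
have A n : \sum_(k < n) (k.+1%:R < y)%R%:R <= y.
  elim: n => [|n ih]; first by rewrite big_ord0.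
  rewrite big_ord_recr/=; have [h|h] := ltP n.+1%:R y; last by rewrite addr0.
  have : \sum_(k < n) (k.+1%:R < y)%R%:R <= n%:R :> R.
    apply: (@le_trans _ _ (\sum_(k < n) 1)); last by rewrite sumr_const card_ord.
    by apply: ler_sum => k _; case: (_ < y).
  by move: h; rewrite -natr1 /=; lra.
have B n : y - 1 <= \sum_(k < n) (k.+1%:R < y)%R%:R \/
    (n%:R < y /\ \sum_(k < n) (k.+1%:R < y)%R%:R = n%:R :> R).
  elim: n => [|n [ih|[ny ih]]].
  - rewrite big_ord0; have [y00|y00] := ltP 0 y; [by right|left; lra].
  - by left; rewrite big_ord_recr/= (le_trans ih)// lerDl.
  - rewrite big_ord_recr/= ih; have [h|h] := ltP n.+1%:R y.
      by right; rewrite natr1.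
    by left; rewrite addr0; move: h; rewrite -natr1; lra.
have := A N; case: (B N) => [|[]]; last by lra.
by move=> h1 h2; rewrite ler_norml; lra.
Qed.

Section Density.
Context {R : realType} (d : nat) (G : topologicalZmodType).
Variable iota : 'rV[R]_d -> G.
Hypothesis Hbohr : is_bohr_compactification iota.
Local Notation tpoly := (tpoly Hbohr).
Local Notation X := (measurableTypeR R * GB R G)%type.

(* As G need not be metrizable, the modulus in the group variable is an arbitrary
   continuous function of the difference. *)
Definition umod (V : R * G -> R) : Prop := forall e, 0 < e ->
  exists (L : R) (Lam : G -> R), [/\ 0 <= L, continuous Lam,
    (forall z, 0 <= Lam z), Lam 0 = 0 &
    forall t x s y, `|V (t, x) - V (s, y)| <= L * `|t - s| + Lam (x - y) + e].

Lemma umod_cst c : umod (fun=> c).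
Proof.
move=> e e0; exists 0, (fun=> 0); split => //; first exact: cst_continuous.
by move=> *; rewrite subrr normr0 mul0r !add0r ltW.
Qed.

Lemma umod_fst : umod fst.
Proof.
move=> e e0; exists 1, (fun=> 0); split => //; first exact: cst_continuous.
by move=> t x s y /=; rewrite mul1r addr0 lerDl ltW.
Qed.

Lemma umod_le K V W : 0 <= K -> umod V ->
  (forall p p', `|W p - W p'| <= K * `|V p - V p'|) -> umod W.
Proof.
move=> K0 uV WV e e0.
have K1 : 0 < K + 1 by rewrite ltr_wpDl.
have [L [Lam [L0 cL Lam0 Lamz H]]] := uV (e / (K + 1)) (divr_gt0 e0 K1).
exists (K * L), (fun z => K * Lam z); split.
- exact: mulr_ge0.
- have := @lin_comb_continuous _ _ Lam Lam K 0 cL cL.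
  by rewrite (_ : (fun z => _) = (fun z => K * Lam z))//; apply/funext => z; rewrite mul0r addr0.
- by move=> z; rewrite mulr_ge0.
- by rewrite Lamz mulr0.
- move=> t x s y; apply: le_trans (WV _ _) _.
  apply: le_trans (ler_wpM2l K0 (H _ _ _ _)) _.
  rewrite !mulrDr mulrA lerD2l mulrCA ler_piMr ?(ltW e0)//.
  by rewrite ler_pdivrMr// mul1r lerDl.
Qed.

Lemma umod_le2 V1 V2 W : umod V1 -> umod V2 ->
  (forall p p', `|W p - W p'| <= `|V1 p - V1 p'| + `|V2 p - V2 p'|) -> umod W.
Proof.
move=> u1 u2 HW e e0.
have e20 : 0 < e / 2 by rewrite divr_gt0.
have [L1 [Lam1 [L10 c1 p1 z1 H1]]] := u1 _ e20.
have [L2 [Lam2 [L20 c2 p2 z2 H2]]] := u2 _ e20.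
exists (L1 + L2), (fun z => 1 * Lam1 z + 1 * Lam2 z); split.
- exact: addr_ge0.
- exact: lin_comb_continuous.
- by move=> z; rewrite !mul1r addr_ge0.
- by rewrite !mul1r z1 z2 addr0.
- move=> t x s y; apply: le_trans (HW _ _) _.
  have := H1 t x s y; have := H2 t x s y; rewrite mulrDl !mul1r; lra.
Qed.

Lemma umodD V1 V2 : umod V1 -> umod V2 -> umod (fun p => V1 p + V2 p).
Proof.
move=> u1 u2; apply: umod_le2 u1 u2 _ => p p'.
by rewrite opprD addrACA ler_normD.
Qed.

Lemma umodZ c V : umod V -> umod (fun p => c * V p).
Proof.
move=> uV; apply: (umod_le (K := `|c|)) uV _ => // p p'.
by rewrite -mulrBr normrM.
Qed.

Lemma umod_sum (I : Type) (s : seq I) (V : I -> R * G -> R) :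
  (forall i, umod (V i)) -> umod (fun p => \sum_(i <- s) V i p).
Proof.
move=> uV; elim: s => [|i s ih].
  rewrite (_ : (fun p => _) = fun=> 0); first exact: umod_cst.
  by apply/funext => p; rewrite big_nil.
rewrite (_ : (fun p => _) = fun p => V i p + \sum_(j <- s) V j p).
  exact: umodD.
by apply/funext => p; rewrite big_cons.
Qed.

Lemma char_le1 l z : `|chC Hbohr l z| <= 1 /\ `|chS Hbohr l z| <= 1.
Proof.
have nc (F : G -> R) : continuous F -> continuous (fun z => `|F z|).
  move=> cF w; apply: (@continuous_comp _ _ _ F (fun y => `|y|)); first exact: cF.
  exact: norm_continuous.
split.
  apply: (dense_le Hbohr (F := fun z => `|chC Hbohr l z|)).
    by apply: nc; exact: chC_continuous.
  by move=> x; rewrite chC_iota ler_norml cos_geN1 cos_le1.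
apply: (dense_le Hbohr (F := fun z => `|chS Hbohr l z|)).
  by apply: nc; exact: chS_continuous.
by move=> x; rewrite chS_iota ler_norml sin_geN1 sin_le1.
Qed.

(** The addition formula for x = (x - y) + y writes chC x - chC y as (chC (x - y) - 1) chC y - chS
    (x - y) chS y, and similarly for chS. So |chC z - 1| + |chS z| is a modulus. *)
Lemma umod_char l : umod (fun p => chC Hbohr l p.2) /\ umod (fun p => chS Hbohr l p.2).
Proof.
pose Lam z := 1 * `|chC Hbohr l z - 1| + 1 * `|chS Hbohr l z|.
have cL : continuous Lam.
  apply: lin_comb_continuous => z.
    apply: (@continuous_comp _ _ _ (fun z => chC Hbohr l z - 1) (fun y => `|y|)).
      have := @lin_comb_continuous _ _ (chC Hbohr l) (fun=> 1) 1 (-1)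
        (@chC_continuous _ _ _ _ Hbohr l) (@cst_continuous _ _ _) z.
      rewrite (_ : (fun z => _) = (fun z => chC Hbohr l z - 1))//.
      by apply/funext => w; rewrite mul1r mulr1.
    exact: norm_continuous.
  apply: (@continuous_comp _ _ _ (chS Hbohr l) (fun y => `|y|)).
    exact: chS_continuous.
  exact: norm_continuous.
have L0 z : 0 <= Lam z by rewrite /Lam !mul1r addr_ge0.
have Lz : Lam 0 = 0 by rewrite /Lam chC0 chS0 subrr normr0 !mulr0 addr0.
have bound x y : `|chC Hbohr l x - chC Hbohr l y| <= Lam (x - y) /\
                 `|chS Hbohr l x - chS Hbohr l y| <= Lam (x - y).
  have E1 := chCD Hbohr l (x - y) y; have E2 := chSD Hbohr l (x - y) y.
  rewrite subrK in E1 E2; have [c1 s1] := char_le1 l y.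
  rewrite /Lam !mul1r; split.
    have -> : chC Hbohr l x - chC Hbohr l y = (chC Hbohr l (x - y) - 1) * chC Hbohr l y
       - chS Hbohr l (x - y) * chS Hbohr l y by rewrite E1; ring.
    by rewrite (le_trans (ler_normB _ _))// !normrM lerD// ler_piMr.
  have -> : chS Hbohr l x - chS Hbohr l y = (chC Hbohr l (x - y) - 1) * chS Hbohr l y
       + chS Hbohr l (x - y) * chC Hbohr l y by rewrite E2; ring.
  by rewrite (le_trans (ler_normD _ _))// !normrM lerD// ler_piMr.
split=> e e0; exists 0, Lam; split => // t x s y /=; rewrite mul0r add0r.
  by rewrite (le_trans (bound x y).1)// lerDl ltW.
by rewrite (le_trans (bound x y).2)// lerDl ltW.
Qed.

(** Uniform continuity on the compact group, expressed through differences: trigonometric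
    polynomials inherit a modulus from the characters, and F is within e / 3 of one of them. *)
Lemma umod_snd (F : G -> R) : continuous F -> umod (fun p => F p.2).
Proof.
move=> cF e e0; have e30 : 0 < e / 3 by rewrite divr_gt0.
have [s Hs] := tpoly_approx Hbohr cF e30.
have : umod (fun p => tpoly s p.2).
  by apply: umod_sum => p; apply: umodD; apply: umodZ; have [] := umod_char p.1.1.
move=> /(_ _ e30)[L [Lam [L0 cL Lam0 Lamz H]]]; exists L, Lam; split => // t x r y.
have h1 := Hs x; have h2 := Hs y; have h3 := H t x r y.
rewrite /= in h3 *.
have -> : F x - F y = (F x - tpoly s x) + (tpoly s x - tpoly s y) + (tpoly s y - F y) by ring.
apply: le_trans (ler_normD _ _) _; rewrite distrC in h2.
have := ler_normD (F x - tpoly s x) (tpoly s x - tpoly s y); lra.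
Qed.

Variable nu : {measure set X -> \bar R}.
Hypothesis nufin : (nu setT < +oo)%E.

(** Sets whose indicator is an L1 limit of functions with a modulus. Values in [0, 1] make products
    of approximants approximate indicators of intersections. *)
Definition appset (E : set X) : Prop := measurable E /\ forall e, 0 < e ->
  exists V : R * G -> R, [/\ umod V, measurable_fun setT (V : X -> R),
    (forall p, 0 <= V p <= 1) & \int[nu]_p `|\1_E p - V p| <= e].

Let bm01 (V : X -> R) : measurable_fun setT V -> (forall p, 0 <= V p <= 1) ->
  bounded_meas V.
Proof.
move=> mV V01; split => //; exists 1 => p.
by rewrite ler_norml; have /andP[? ?] := V01 p; lra.
Qed.

Let bm_ind (E : set X) : measurable E -> bounded_meas (\1_E : X -> R).
Proof.
move=> mE; split; first exact: measurable_indic.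
by exists 1 => p; rewrite indicE; case: (_ \in _); rewrite ?normr1 ?normr0.
Qed.

Lemma appsetC E : appset E -> appset (~` E).
Proof.
move=> [mE H]; split; first exact: measurableC.
move=> e e0; have [V [uV mV V01 HV]] := H e e0.
exists (fun p => 1 + -1 * V p); split.
- by apply: umodD; [exact: umod_cst|exact: umodZ].
- apply: measurable_funD => //; exact: measurable_funM.
- by move=> p; have /andP[? ?] := V01 p; apply/andP; split; lra.
- apply: le_trans HV; rewrite le_eqVlt; apply/orP; left; apply/eqP.
  apply: eq_Rintegral => p _; rewrite -normrN; congr `| _ |.
  rewrite !indicE in_setC; case: (p \in E) => /=; lra.
Qed.

Lemma appsetI E F : appset E -> appset F -> appset (E `&` F).
Proof.
move=> [mE HE] [mF HF]; split; first exact: measurableI.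
move=> e e0; have e20 : 0 < e / 2 by rewrite divr_gt0.
have [V [uV mV V01 HV]] := HE _ e20; have [W [uW mW W01 HW]] := HF _ e20.
have key (a b a' b' : R) : 0 <= a <= 1 -> 0 <= b' <= 1 ->
    `|a * b - a' * b'| <= `|a - a'| + `|b - b'|.
  move=> /andP[a0 a1] /andP[b0 b1].
  have -> : a * b - a' * b' = (a - a') * b' + a * (b - b') by ring.
  rewrite (le_trans (ler_normD _ _))// !normrM (ger0_norm a0) (ger0_norm b0).
  by rewrite lerD// ?ler_piMr ?ler_piMl.
exists (fun p => V p * W p); split.
- by apply: umod_le2 uV uW _ => p p'; exact: key.
- exact: measurable_funM.
- move=> p; have /andP[? ?] := V01 p; have /andP[? ?] := W01 p.
  by rewrite mulr_ge0//= mulr_ile1.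
- have iV := bm_integ nufin (bm_norm (bmB (bm_ind mE) (bm01 mV V01))).
  have iW := bm_integ nufin (bm_norm (bmB (bm_ind mF) (bm01 mW W01))).
  have -> : e = e / 2 + e / 2 by lra.
  apply: le_trans (lerD HV HW); rewrite -RintD//.
  apply: Rint_le; [|exact: integD|].
    apply/bm_integ => //; apply/bm_norm/bmB; first exact/bm_ind/measurableI.
    by apply: bmM; exact: bm01.
  move=> p; rewrite indicI; apply: key => //.
  by rewrite indicE; case: (_ \in _); rewrite /= ?lexx ?ler01.
Qed.

Lemma appset0 : appset set0.
Proof.
split=> // e e0; exists (fun=> 0); split => //.
- exact: umod_cst.
- by move=> p; rewrite lexx ler01.
- rewrite (_ : \int[nu]_p _ = 0) ?ltW//.
  rewrite -[RHS](Rint0 nu); apply: eq_Rintegral => p _.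
  by rewrite indic0 subr0 normr0.
Qed.

Lemma appsetU E F : appset E -> appset F -> appset (E `|` F).
Proof.
move=> aE aF; rewrite -[_ `|` _]setCK setCU; apply: appsetC.
by apply: appsetI; exact: appsetC.
Qed.

(* Bounded convergence turns pointwise limits of approximable indicators or of
   functions with a modulus into L1 limits. *)
Lemma appset_lim (E : set X) (f_ : nat -> X -> R) : measurable E ->
  (forall n, measurable_fun setT (f_ n)) -> (forall n x, 0 <= f_ n x <= 1) ->
  (forall x, f_ n x @[n --> \oo] --> (\1_E x : R)) ->
  (forall n e, 0 < e -> exists V : R * G -> R,
    [/\ umod V, measurable_fun setT (V : X -> R),
    (forall p, 0 <= V p <= 1) & \int[nu]_p `|f_ n p - V p| <= e]) ->
  appset E.
Proof.
move=> mE mf f01 fE H; split => // e e0.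
have e20 : 0 < e / 2 by rewrite divr_gt0.
have [||n Hn] := bounded_convergence nufin mf (bm_ind mE).1 (C := 1) _ _ fE e20.
- by move=> n x; have /andP[? ?] := f01 n x; rewrite ler_norml; lra.
- by move=> x; rewrite indicE; case: (_ \in _); rewrite ?normr1 ?normr0.
have [V [uV mV V01 HV]] := H n _ e20; exists V; split => //.
have bf : bounded_meas (f_ n) by exact: bm01.
have bV : bounded_meas (V : X -> R) by exact: bm01.
have i1 := bm_integ nufin (bm_norm (bmB (bm_ind mE) bf)).
have i2 := bm_integ nufin (bm_norm (bmB bf bV)).
have -> : e = e / 2 + e / 2 by lra.
apply: le_trans (lerD Hn HV); rewrite -RintD//.
apply: Rint_le; [|exact: integD|].
  by apply/bm_integ => //; exact/bm_norm/bmB/bV/bm_ind.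
by move=> p; rewrite (le_trans _ (ler_normD _ _))// addrA subrK.
Qed.

Lemma appset_bigcup (E : nat -> set X) : (forall n, appset (E n)) ->
  appset (\bigcup_n E n).
Proof.
move=> aE; pose U n := \big[setU/set0]_(i < n) E i.
have aU n : appset (U n).
  rewrite /U; elim: n => [|n ih]; first by rewrite big_ord0; exact: appset0.
  by rewrite big_ord_recr; exact: appsetU.
apply: (@appset_lim _ (fun n => \1_(U n))).
- by apply: bigcup_measurable => n _; case: (aE n).
- by move=> n; apply: measurable_indic; case: (aU n).
- by move=> n x; rewrite indicE; case: (_ \in _); rewrite /= ?lexx ?ler01.
- move=> x; apply: cvg_near_cst; rewrite !indicE.
  have [h|h] := pselect ((\bigcup_n E n) x).
    rewrite (mem_set h); have [n _ Enx] := h.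
    near=> k; rewrite indicE mem_set//.
    rewrite /U -bigcup_mkord; exists n => //=.
    by near: k; exact: nbhs_infty_gt.
  rewrite (memNset h); near=> k; rewrite indicE memNset// => Ux; apply: h.
  by move: Ux; rewrite /U -bigcup_mkord => -[n _ Enx]; exists n.
- by move=> n e e0; exact: (aU n).2.
Unshelve. all: by end_near. Qed.

(** Stability under complements and countable unions makes the sets with approximable preimage a
    sigma-algebra. *)
Lemma appset_sigma (U : Type) (f : X -> U) (C : set (set U)) :
  (forall A, C A -> appset (f @^-1` A)) ->
  forall A, <<s C >> A -> appset (f @^-1` A).
Proof.
move=> HC; apply: smallest_sub; last by [].
split.
- by rewrite /= preimage_set0; exact: appset0.
- move=> A aA /=; rewrite setTD preimage_setC; exact: appsetC.
- by move=> A aA /=; rewrite preimage_bigcup; exact: appset_bigcup.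
Qed.

(** The truncated ramps min(1, n (V - a)^+) inherit a modulus from V and converge pointwise to the
    indicator of {V > a}; such half-lines generate the Borel sets. *)
Lemma appset_real (V : R * G -> R) : umod V -> measurable_fun setT (V : X -> R) ->
  forall A : set R, measurable A -> appset ((V : X -> R) @^-1` A).
Proof.
move=> uV mV A mA.
have {}mA : <<s @RGenOInfty.G R >> A.
  suff : (@RGenOInfty.G R).-sigma.-measurable A by [].
  by rewrite -RGenOInfty.measurableE.
apply: appset_sigma mA => {}A [a ->].
have mE : measurable ((V : X -> R) @^-1` `]a, +oo[).
  by rewrite -[_ @^-1` _]setTI; apply: mV => //; exact: measurable_itv.
pose cl (x : R) := Num.max 0 (Num.min 1 x).
have cl01 x : 0 <= cl x <= 1.
  by rewrite /cl le_max lexx/= ge_max ler01/= ge_min lexx.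
have clL x y : `|cl x - cl y| <= `|x - y|.
  have clE z : [\/ cl z = 0 /\ z <= 0, cl z = z /\ 0 <= z /\ z <= 1 | cl z = 1 /\ 1 <= z].
    rewrite /cl; have [z1|z1] := leP 1 z.
      by apply: Or33; split => //; apply/max_idPr.
    have [z0|z0] := leP 0 z; [apply: Or32|apply: Or31]; split => //.
      by split => //; exact: ltW.
    exact: ltW.
  have h1 := ler_norm (x - y); have := ler_norm (- (x - y)); rewrite normrN => h2.
  rewrite ler_norml.
  by case: (clE x) => [[->]|[->]|[->]] ?; case: (clE y) => [[->]|[->]|[->]] ?;
    apply/andP; split; lra.
pose W n (p : R * G) := cl (n%:R * (V p - a)).
have uW n : umod (W n).
  apply: (umod_le (K := n%:R) _ uV) => // p p'.
  apply: le_trans (clL _ _) _; rewrite -mulrBr normrM ger0_norm//.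
  by rewrite opprB addrA subrK.
have mW n : measurable_fun setT (W n : X -> R).
  apply: measurable_maxr => //; apply: measurable_minr => //.
  by apply: measurable_funM => //; exact: measurable_funB.
apply: (appset_lim mE mW) => [n x|x|n e e0]; first exact: cl01.
- apply: cvg_near_cst; rewrite indicE.
  have [Vx|Vx] := ltP a (V x); last first.
    near=> n; rewrite memNset/=; last by rewrite in_itv/= andbT; apply/negP; rewrite -leNgt.
    have h : n%:R * (V x - a) <= 0 by rewrite mulr_ge0_le0// subr_le0.
    by rewrite /W /cl; apply/max_idPl; rewrite ge_min h orbT.
  near=> n; rewrite mem_set/=; last by rewrite in_itv/= andbT.
  have h : 1 <= n%:R * (V x - a).
    rewrite -ler_pdivrMr ?subr_gt0//.
    by near: n; exact: nbhs_infty_ger.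
  by rewrite /W /cl (min_idPl h); apply/max_idPr.
- exists (W n); split => //; first by move=> p; exact: cl01.
  rewrite (_ : \int[nu]_p _ = 0) ?ltW//.
  rewrite -[RHS](Rint0 nu); apply: eq_Rintegral => p _.
  by rewrite subrr normr0.
Unshelve. all: by end_near. Qed.

Lemma appset_all (E : set X) : measurable E -> appset E.
Proof.
rewrite [X in X E]measurable_prod_measurableType -[E]preimage_id => mE.
apply: (appset_sigma (f := id)) mE => _ [A mA [B mB <-]].
have -> : id @^-1` (A `*` B) = ((fst : X -> R) @^-1` A) `&` ((snd : X -> GB R G) @^-1` B).
  by [].
apply: appsetI; first by apply: (appset_real umod_fst) => //; exact: measurable_fst.
apply: appset_sigma mB => {}B [F [cF [V [oV ->]]]].
apply: (appset_real (V := fun p => F p.2)); first exact: umod_snd.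
  by apply: measurableT_comp measurable_snd; exact: continuous_measurable_GB.
exact: open_measurable.
Qed.

(** w + M is cut into layers of height D, at uniform cost D, and the indicator of each superlevel
    set is replaced by an approximant. *)
Theorem umod_dense (w : X -> R) : bounded_meas w -> forall e, 0 < e ->
  exists V : R * G -> R, [/\ umod V, bounded_meas (V : X -> R) &
    \int[nu]_p `|w p - V p| <= e].
Proof.
move=> [mw [M wM]] e e0.
have M0 : 0 <= M by apply: le_trans (wM (0, 0)).
have nu0 : 0 <= fine (nu setT) by apply: fine_ge0; exact: measure_ge0.
pose c := fine (nu setT).
(* Makes D (c + 1) <= e / 2, where c is the total mass and D = (2M + 1) / (N + 1). *)
have [N HN] : exists N : nat, (2 * M + 1) * (c + 1) * 2 / e < N.+1%:R.
  exists (Num.truncn ((2 * M + 1) * (c + 1) * 2 / e)); by rewrite truncnS_gt.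
pose D := (2 * M + 1) / N.+1%:R.
have N0 : 0 < N.+1%:R :> R by rewrite ltr0n.
have M1 : 0 < 2 * M + 1 by rewrite ltr_wpDl// mulr_ge0.
have c1 : 0 < c + 1 by rewrite ltr_wpDl.
have D0 : 0 < D by rewrite divr_gt0.
have Dc : D * c <= e / 2.
  have : D * (c + 1) <= e / 2.
    rewrite /D mulrAC ler_pdivrMr// -ler_pdivrMl ?divr_gt0//.
    by rewrite invf_div mulrC; apply/ltW; apply: le_lt_trans HN; lra.
  by rewrite mulrDr mulr1; lra.
pose E (k : 'I_N.+1) := [set p : X | k.+1%:R < (w p + M) / D].
have mE k : measurable (E k).
  rewrite (_ : E k = (fun p => (w p + M) / D) @^-1` `]k.+1%:R, +oo[); last first.
    by apply/seteqP; split => p /=; rewrite in_itv/= andbT.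
  rewrite -[_ @^-1` _]setTI; apply: (measurable_funM (measurable_funD mw _) _) => //.
(* The weights D of the N + 1 layers add up to 2M + 1, whence this tolerance. *)
have H k : exists V : R * G -> R, [/\ umod V, measurable_fun setT (V : X -> R),
    (forall p, 0 <= V p <= 1) & \int[nu]_p `|\1_(E k) p - V p| <= e / 2 / (2 * M + 1)].
  by apply: (appset_all (mE k)).2; rewrite !divr_gt0.
have {}/choice[V HV] := H.
pose W p := - M + D * \sum_k V k p.
have bV k : bounded_meas (V k : X -> R) by have [_ mV V01 _] := HV k; exact: bm01.
have bW : bounded_meas (W : X -> R).
  by apply: bmD; [exact: bm_cst|apply: bmM; [exact: bm_cst|exact: bm_sum]].
exists W; split => //.
  apply: umodD; [exact: umod_cst|apply: umodZ; apply: umod_sum => k].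
  by have [] := HV k.
have bw : bounded_meas w by split => //; exists M.
pose S p := D + D * \sum_k `|\1_(E k) p - V k p|.
have iD k : integ nu (fun p => `|\1_(E k) p - V k p|).
  by apply: bm_integ => //; exact: bm_norm (bmB (bm_ind (mE k)) (bV k)).
have iS : integ nu S.
  apply: integD; first exact/bm_integ/bm_cst.
  by apply: integZ; exact: integ_sum.
apply: (@le_trans _ _ (\int[nu]_p S p)).
  apply: Rint_le => //; first exact/bm_integ/bm_norm/bmB.
  move=> p.
  have y0 : 0 <= (w p + M) / D.
    rewrite divr_ge0 ?(ltW D0)//; have := wM p; rewrite ler_norml => /andP[]; lra.
  have yN : (w p + M) / D <= N.+1%:R.
    rewrite ler_pdivrMr// /D mulrC divfK ?gt_eqF//.
    by have := wM p; rewrite ler_norml => /andP[]; lra.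
  have := layer_count y0 yN; set n := \sum_(k < _) _ => Hn.
  have nE : n = \sum_(k < N.+1) \1_(E k) p.
    apply: eq_bigr => k _; rewrite indicE.
    have [h|h] := boolP (k.+1%:R < (w p + M) / D); first by rewrite mem_set.
    by rewrite memNset//; exact/negP.
  have -> : w p - W p = D * ((w p + M) / D - n) + D * (n - \sum_k V k p).
    have Dy : D * ((w p + M) / D) = w p + M by rewrite mulrC divfK ?gt_eqF.
    by rewrite /W !mulrBr Dy; ring.
  rewrite (le_trans (ler_normD _ _))// normrM (gtr0_norm D0) normrM (gtr0_norm D0) /S lerD//.
    by rewrite ler_piMr// ltW.
  rewrite ler_pM2l// nE -sumrB; exact: ler_norm_sum.
rewrite RintD; [|exact/bm_integ/bm_cst|by apply: integZ; exact: integ_sum].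
rewrite (RintZ D (integ_sum _ iD)).
rewrite Rint_sum// Rintegral_cst//.
have -> : e = e / 2 + e / 2 by lra.
apply: lerD => //.
have : \sum_k \int[nu]_p `|\1_(E k) p - V k p| <= \sum_(k < N.+1) e / 2 / (2 * M + 1).
  by apply: ler_sum => k _; have [] := HV k.
rewrite sumr_const card_ord => /(ler_wpM2l (ltW D0))/le_trans; apply.
rewrite -[_ *+ N.+1]mulr_natr /D le_eqVlt; apply/orP; left; apply/eqP.
have Nn : N.+1%:R != 0 :> R by rewrite gt_eqF. have Mn : 2 * M + 1 != 0 by rewrite gt_eqF. move: Nn Mn; move: (N.+1%:R : R) (2 * M + 1) => a b a0 b0. by field; rewrite ?a0 ?b0.
Qed.

End Density.

Definition finite_restriction d (T : measurableType d) (R : realType)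
    (mu : {measure set T -> \bar R}) (D : set T) (mD : measurable D)
    (muD : (mu D < +oo)%E) : {finite_measure set T -> \bar R} :=
  mfrestr mD muD.

(** * Entropy solutions on a bounded time interval *)

Section FiniteProduct.
Context d1 d2 (T1 : measurableType d1) (T2 : measurableType d2) (R : realType).
Variables (m1 : {finite_measure set T1 -> \bar R})
          (m2 : {finite_measure set T2 -> \bar R}).

(** The product measure under its own name, so that finiteness can be attached to it and [nuT] can
    in turn be multiplied with itself. *)
Definition finite_product : set (T1 * T2)%type -> \bar R := (m1 \x m2)%E.

HB.instance Definition _ := Measure.on finite_product.

Let finite_product_fin : fin_num_fun finite_product.
Proof.
move=> A mA; rewrite ge0_fin_numE ?measure_ge0//.
apply: (@le_lt_trans _ _ (finite_product setT)); first by rewrite le_measure ?inE.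
apply: (finite_prod (m1 := m1) (m2 := m2));
  by rewrite -ge0_fin_numE ?measure_ge0// fin_num_measure.
Qed.

HB.instance Definition _ :=
  Measure_isFinite.Build _ _ _ finite_product finite_product_fin.

End FiniteProduct.

Section RestrictedMeasure.
Context {R : realType} (G : topologicalZmodType).
Variable m : probability (GB R G) R.
Local Notation leb := (@lebesgue_measure R).
Local Notation X := (measurableTypeR R * GB R G)%type.
Local Notation mu := (leb \x m)%E.

Variable T : R.

Lemma leb_itv_fin : (leb `[0%R, T] < +oo)%E.
Proof. by rewrite lebesgue_measure_itv/=; case: ifP; rewrite ?ltry. Qed.

(** Lebesgue measure cut down to [0, T]. Test functions supported there do not see the difference,
    and on a finite measure every bounded measurable function is integrable. *)
Definition lebT : {finite_measure set (measurableTypeR R) -> \bar R} :=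
  @finite_restriction _ (measurableTypeR R) R leb _ (measurable_itv `[0, T]) leb_itv_fin.

Definition nuT : {finite_measure set X -> \bar R} := finite_product lebT m.

Lemma lebT_fin : (lebT setT < +oo)%E.
Proof. by rewrite -ge0_fin_numE ?measure_ge0// fin_num_measure. Qed.

Lemma nuT_fin : (nuT setT < +oo)%E.
Proof. by rewrite -ge0_fin_numE ?measure_ge0// fin_num_measure. Qed.

Lemma integral_lebT (h : R -> \bar R) :
  (forall t, ~ (0 <= t <= T) -> h t = 0%E) ->
  (\int[leb]_t h t = \int[lebT]_t h t)%E.
Proof.
move=> h0.
have E : h = h \_ `[0, T].
  apply/funext => t; rewrite patchE; case: ifPn => // /negP tT.
  apply: h0 => h1; apply: tT; apply/mem_set; by rewrite /= in_itv.
rewrite E -!integral_mkcond; apply: eq_measure_integral => A mA sA.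
by rewrite /= /lebT /mfrestr /mrestr setIidl.
Qed.

Lemma nuTE (A : set X) : measurable A -> A `<=` [set p | 0 <= p.1 <= T] ->
  mu A = nuT A.
Proof.
move=> mA sA; rewrite /nuT /product_measure1.
apply: integral_lebT => t tT /=.
rewrite (_ : xsection A t = set0) ?measure0//.
apply/seteqP; split => // x; rewrite /xsection/= inE => /sA /=.
by move=> h; exact: tT.
Qed.

Local Notation Dom := (@Dom R (GB R G) : set X).

Lemma measurable_Dom : measurable Dom.
Proof.
rewrite (_ : Dom = fst @^-1` `]0, +oo[); last first.
  by apply/seteqP; split => p /=; rewrite in_itv/= andbT.
by rewrite -[_ @^-1` _]setTI; exact: measurable_fst.
Qed.

Lemma integral_Dom_nuT (F : X -> \bar R) :
  (forall p, F p != 0%E -> 0 < p.1 <= T) ->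
  (\int[mu]_(p in Dom) F p = \int[nuT]_p F p)%E.
Proof.
move=> F0.
have E (D : set X) : (forall p, 0 < p.1 <= T -> D p) -> F = F \_ D.
  move=> HD; apply/funext => p; rewrite patchE; case: ifPn => // /negP pD.
  apply/eqP/negPn/negP => /F0 h; apply: pD; apply/mem_set; exact: HD.
pose D := [set p : X | 0 <= p.1 <= T].
have E1 := E Dom (fun p h => (andP h).1).
have E2 : F = F \_ D.
  by apply: E => p /andP[p0 pT]; rewrite /D/= pT (ltW p0).
rewrite integral_mkcond -E1 [in LHS]E2 -integral_mkcond.
rewrite [in RHS]E2 -[RHS]integral_mkcond.
by apply: eq_measure_integral => A mA sA; exact: nuTE.
Qed.

(** F is to be written with the given solution, measurable only on [Dom], and F' with an everywhere
    defined representative; the time support of F' allows passing to the finite measure [nuT]. *)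
Lemma integral_Dom_transfer (F F' : X -> R) :
  measurable_fun Dom F -> measurable_fun setT F' ->
  {ae mu, forall p, Dom p -> F p = F' p} ->
  (forall p, F' p != 0 -> 0 < p.1 <= T) ->
  (\int[mu]_(p in Dom) (F p)%:E = \int[nuT]_p (F' p)%:E)%E.
Proof.
move=> mF mF' FF' F0.
rewrite -integral_Dom_nuT; last by move=> p; rewrite eqe; exact: F0.
apply: ae_eq_integral.
- exact: measurable_Dom.
- exact/measurable_EFinP.
- by apply/measurable_EFinP; exact: measurable_funTS.
- by apply: filterS FF' => p h Dp; rewrite h.
Qed.

End RestrictedMeasure.

Section CompactSupport.
Context {R : realType}.
Implicit Types th : R -> R.

Lemma supp_bounded th (a b : R) : continuous th ->
  (forall t, th t != 0 -> a <= t <= b) -> exists C, 0 <= C /\ forall t, `|th t| <= C.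
Proof.
move=> cth supp; have [C [C0 HC]] := continuous_bounded_itv (`|a| + `|b|) cth.
exists C; split => // t; have [->|/supp/andP[at_ tb]] := eqVneq (th t) 0.
  by rewrite normr0.
apply: HC; have := ler_norm (- a); have := ler_norm b; rewrite normrN ler_norml.
have := normr_ge0 a; have := normr_ge0 b; lra.
Qed.

Lemma supp_deriv th th' (a b : R) : deriv_of th th' ->
  (forall t, th t != 0 -> a <= t <= b) -> forall t, th' t != 0 -> a <= t <= b.
Proof.
move=> dth supp t; apply: contraNT => tab.
have zero s : ~~ (a <= s <= b) -> th s = 0.
  by move=> h; apply/eqP; apply: contraNT h => /supp.
have [_ <-] := dth t; have [_ <-] := deriv_of_cst 0 t.
apply/eqP; apply: near_eq_derive; move: tab; rewrite negb_and -!ltNge => /orP[h|h].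
  near=> s; apply: zero; rewrite negb_and -!ltNge; apply/orP; left.
  by near: s; exact: lt_nbhsl.
near=> s; apply: zero; rewrite negb_and -!ltNge; apply/orP; right.
by near: s; exact: lt_nbhsr.
Unshelve. all: by end_near. Qed.

End CompactSupport.

Section CleanSolutions.
Context {R : realType} (d : nat) (G : topologicalZmodType).
Variable iota : 'rV[R]_d -> G.
Hypothesis Hbohr : is_bohr_compactification iota.
Variable m : probability (GB R G) R.
Local Notation tpoly := (tpoly Hbohr).
Local Notation X := (measurableTypeR R * GB R G)%type.
Local Notation Dom := (@Dom R (GB R G) : set X).
Local Notation mu := (@lebesgue_measure R \x m)%E.
Variables (f : 'I_d -> R -> R) (A sigma beta : 'I_d -> 'I_d -> R -> R).
Hypothesis Hdecomp : forall i j (x : R),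
  amat A i j x = \sum_k sigma i k x * sigma j k x.

Lemma tensor_bm th P (a b : R) : continuous th ->
  (forall t, th t != 0 -> a <= t <= b) -> continuous P ->
  bounded_meas (tensor th P : X -> R).
Proof.
move=> cth supp cP; apply: bmM.
  have [C [_ HC]] := supp_bounded cth supp.
  split; last by exists C => p; exact: HC.
  by apply: measurableT_comp; [exact: continuous_measurable_fun|exact: measurable_fst].
have [mP [C HC]] := continuous_bm Hbohr cP; split; last by exists C => p; exact: HC.
by apply: measurableT_comp mP _; exact: measurable_snd.
Qed.

(** The information that doubling takes from a solution: real-valued weak formulations over the
    finite measure [nuT], for tensor test functions whose time support lies in [a, b] with 0 < a and
    b <= T. *)
Record clean_solution (w' : X -> R) (T : R) (g : 'I_d -> X -> R) : Prop :=
  CleanSolution {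
  clean_gmeas : forall k, measurable_fun setT (g k);
  clean_gL2 : forall k, integ (nuT m T) (fun p => g k p ^+ 2);
  clean_chain : forall th (a b : R) s, smooth_real th -> 0 < a -> b <= T ->
    (forall t, th t != 0 -> a <= t <= b) ->
    weak_chain (nuT m T) sigma w' g (tensor th (tpoly s))
      (fun i => tensor th (tpoly (tder i s)));
  clean_entropy : forall th (a b : R) s, smooth_real th -> 0 < a -> b <= T ->
    (forall t, th t != 0 -> a <= t <= b) ->
    (forall p, 0 <= tensor th (tpoly s) p) ->
    weak_entropy (nuT m T) (fun i => derive1 (f i)) sigma w' g
      (tensor th (tpoly s)) (tensor (derive1 th) (tpoly s))
      (fun i => tensor th (tpoly (tder i s)))
      (fun i j => tensor th (tpoly (tder i (tder j s)))) }.

(** The representative is w clipped to [-M, M] and set to 0 off [Dom]; it is the same for all T. The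
    fields g are cut off after time T, to be square integrable and measurable everywhere, hence
    depend on T. *)
Lemma entropy_solution_clean w w0 :
  entropy_solution iota m f A sigma beta w w0 ->
  exists M (w' : X -> R), [/\ 0 < M, measurable_fun setT w',
    (forall p, `|w' p| <= M), {ae mu, forall p, Dom p -> w p = w' p} &
    forall T, exists g, clean_solution w' T g].
Proof.
move=> [[mw [M0 HM0]] [g [g2 _ chain entropy _]]].
have {}HM0 : {ae mu, forall p : X, Dom p -> `|w p| <= M0} := HM0.
pose M := `|M0| + 1.
have M0M : M0 <= M by rewrite /M (le_trans (ler_norm _))// lerDl.
have Mpos : 0 < M by rewrite ltr_wpDl.
pose clip (x : R) := Num.max (- M) (Num.min M x).
have clipM x : `|clip x| <= M.
  rewrite ler_norml /clip le_max lexx/= ge_max ge_min lexx/= andbT; lra.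
have clipE x : `|x| <= M -> clip x = x.
  rewrite ler_norml /clip => /andP[h1 h2].
  by rewrite (min_idPr h2) (max_idPr h1).
have mD : measurable Dom by exact: measurable_Dom.
pose w' : X -> R := (clip \o w) \_ Dom.
have mclip : measurable_fun Dom (clip \o w : X -> R).
  by apply: measurable_maxr => //; apply: measurable_minr.
have mw' : measurable_fun setT w' by apply/(measurable_restrictT _ mD).
have w'M p : `|w' p| <= M.
  by rewrite /w' patchE; case: ifP => _; rewrite ?clipM// normr0 ltW.
have ww' : {ae mu, forall p, Dom p -> w p = w' p}.
  apply: filterS HM0 => p h Dp; rewrite /w' patchE mem_set//= clipE//.
  exact: le_trans (h Dp) M0M.
exists M, w'; split => // T.
pose DT : set X := Dom `&` [set p | p.1 <= T].
have mDT : measurable DT.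
  apply: measurableI => //.
  rewrite (_ : [set p : X | _] = fst @^-1` `]-oo, T]); last first.
    by apply/seteqP; split => p /=; rewrite in_itv.
  by rewrite -[_ @^-1` _]setTI; exact: measurable_fst.
have DTsub : DT `<=` Dom by move=> p [].
pose g' k : X -> R := g k \_ DT.
have mg k : measurable_fun Dom (g k : X -> R) by have [] := g2 k.
have mg' k : measurable_fun setT (g' k).
  by apply/(measurable_restrictT _ mDT); apply: measurable_funS (mg k).
have g'2 k : integ (nuT m T) (fun p => g' k p ^+ 2).
  apply/integrableP; split; first by apply/measurable_EFinP; exact: measurable_funX.
  rewrite (eq_integral (fun p => (g' k p ^+ 2)%:E)); last first.
    by move=> p _ /=; rewrite ger0_norm// sqr_ge0.
  rewrite -integral_Dom_nuT; last first.
    move=> p; rewrite eqe expf_eq0/= /g' patchE; case: ifP; last by rewrite eqxx.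
    by move=> /set_mem[/= p0 pT] _; rewrite p0.
  apply: le_lt_trans (g2 k).2; apply: ge0_le_integral => //.
  - by move=> p _; rewrite lee_fin sqr_ge0.
  - by apply/measurable_EFinP; apply: measurable_funTS; exact: measurable_funX.
  - by apply/measurable_EFinP; apply: measurable_funX; exact: mg.
  - move=> p _; rewrite lee_fin /g' patchE; case: ifP => // _.
    by rewrite expr0n sqr_ge0.
exists g'.
have Tfin := nuT_fin m T.
have meas_th th P : continuous th -> continuous P ->
    measurable_fun setT (tensor th P : X -> R).
  move=> cth cP; apply: measurable_funM.
    by apply: measurableT_comp; [exact: continuous_measurable_fun|exact: measurable_fst].
  by apply: measurableT_comp measurable_snd; exact: continuous_measurable_GB.
have meas_comp (h : R -> R) : continuous h -> measurable_fun Dom (h \o w : X -> R).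
  by move=> ch; apply: measurableT_comp mw; exact: continuous_measurable_fun.
have meas_comp' (h : R -> R) : continuous h -> measurable_fun setT (h \o w').
  by move=> ch; apply: measurableT_comp mw'; exact: continuous_measurable_fun.
have bm_comp' (h : R -> R) : continuous h -> bounded_meas (h \o w').
  move=> ch; split; first exact: meas_comp'.
  by have [C [_ HC]] := continuous_bounded_itv M ch; exists C => p; exact: HC.
split => //.
- move=> th a b s sth a0 bT supp psi bf cpsi dbf k.
  have [dth sth'] := smooth_real_deriv sth; have cth := deriv_of_continuous dth.
  have tf := test_fun_tensor Hbohr s sth a0 supp.
  have cb i : continuous (bf i k) by exact: deriv_of_continuous (dbf i k).
  have suppT t : th t != 0 -> 0 < t <= T by move=> /supp/andP[? ?]; apply/andP; split; lra.
  have := chain psi cpsi bf dbf k _ tf.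
  have -> : (\int[mu]_(p in Dom)
      (\sum_i bf i k (w p) * pd iota (Some i) (tensor th (tpoly s)) p)%:E =
      \int[nuT m T]_p (\sum_i bf i k (w' p) * tensor th (tpoly (tder i s)) p)%:E)%E.
    under eq_integral => p _.
      under eq_bigr => i _ do rewrite (pd_space Hbohr th s i).2.
      over.
    apply: integral_Dom_transfer.
    - apply: measurable_sum => i; apply: measurable_funM; first exact: meas_comp (cb i).
      by apply: measurable_funTS; apply: meas_th => //; exact: tpoly_continuous.
    - apply: measurable_sum => i; apply: measurable_funM; first exact: meas_comp' (cb i).
      by apply: meas_th => //; exact: tpoly_continuous.
    - by apply: filterS ww' => p h Dp; rewrite h.
    - move=> p; have [t0|/suppT//] := eqVneq (th p.1) 0.
      by rewrite big1 ?eqxx// => i _; rewrite /tensor t0 mul0r mulr0.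
  have -> : (\int[mu]_(p in Dom) (psi (w p) * g k p * tensor th (tpoly s) p)%:E =
      \int[nuT m T]_p (psi (w' p) * g' k p * tensor th (tpoly s) p)%:E)%E.
    apply: integral_Dom_transfer.
    - apply: measurable_funM.
        by apply: measurable_funM; [exact: meas_comp|exact: mg].
      by apply: measurable_funTS; apply: meas_th => //; exact: tpoly_continuous.
    - apply: measurable_funM.
        by apply: measurable_funM; [exact: meas_comp'|exact: mg'].
      by apply: meas_th => //; exact: tpoly_continuous.
    - apply: filterS ww' => p h Dp; rewrite h//.
      have [t0|/suppT/andP[_ pT]] := eqVneq (th p.1) 0.
        by rewrite /tensor t0 mul0r !mulr0.
      by rewrite /g' patchE mem_set.
    - move=> p; have [t0|/suppT//] := eqVneq (th p.1) 0.
      by rewrite /tensor t0 mul0r mulr0 eqxx.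
  by move=> E; rewrite /Rintegral E fineN.
- move=> th a b s sth a0 bT supp pos eta eta1 eta2 q r d0 d1 c2 eta20 dq dr.
  have [dth sth'] := smooth_real_deriv sth; have cth := deriv_of_continuous dth.
  have cth' := deriv_of_continuous (smooth_real_deriv sth').1.
  have tf := test_fun_tensor Hbohr s sth a0 supp.
  have suppT t : th t != 0 -> 0 < t <= T by move=> /supp/andP[? ?]; apply/andP; split; lra.
  have supp' := supp_deriv dth supp.
  have suppT' t : derive1 th t != 0 -> 0 < t <= T by move=> /supp'/andP[? ?]; apply/andP; split; lra.
  have E1 := deriv_ofE d0; have E2 := deriv_ofE d1.
  have cq i : continuous (q i) by exact: deriv_of_continuous (dq i).
  have cr i j : continuous (r i j) by exact: deriv_of_continuous (dr i j).
  have ceta := deriv_of_continuous d0.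
  have dr' (i j : 'I_d) (x : R) : is_derive x (1 : R) (r i j) (eta1 x * amat A i j x).
    by rewrite Hdecomp; exact: dr.
  have H := entropy eta (convex_of_deriv2 d0 d1 eta20) (C2_of_deriv2 d0 d1 c2) q r.
  rewrite E1 E2 in H.
  have := H dq dr' _ tf pos.
  have -> : (\int[mu]_(p in Dom)
      (eta2 (w p) * (\sum_k g k p ^+ 2) * tensor th (tpoly s) p)%:E =
      \int[nuT m T]_p (eta2 (w' p) * (\sum_k g' k p ^+ 2) * tensor th (tpoly s) p)%:E)%E.
    apply: integral_Dom_transfer.
    - apply: measurable_funM.
        apply: measurable_funM; first exact: meas_comp.
        by apply: measurable_sum => k; apply: measurable_funX; exact: mg.
      by apply: measurable_funTS; apply: meas_th => //; exact: tpoly_continuous.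
    - apply: measurable_funM.
        apply: measurable_funM; first exact: meas_comp'.
        by apply: measurable_sum => k; apply: measurable_funX; exact: mg'.
      by apply: meas_th => //; exact: tpoly_continuous.
    - apply: filterS ww' => p h Dp; rewrite h//.
      have [t0|/suppT/andP[_ pT]] := eqVneq (th p.1) 0.
        by rewrite /tensor t0 mul0r !mulr0.
      congr (_ * _ * _); apply: eq_bigr => k _.
      by rewrite /g' patchE mem_set.
    - move=> p; have [t0|/suppT//] := eqVneq (th p.1) 0.
      by rewrite /tensor t0 mul0r mulr0 eqxx.
  set RHS := (X in (_ <= X)%E).
  have -> : RHS = (\int[nuT m T]_p (eta (w' p) * tensor (derive1 th) (tpoly s) p +
      \sum_i q i (w' p) * tensor th (tpoly (tder i s)) p +
      \sum_i \sum_j r i j (w' p) * tensor th (tpoly (tder i (tder j s))) p)%:E)%E.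
    rewrite /RHS; under eq_integral => p _.
      rewrite (pd_time iota (tpoly s) dth).2.
      under eq_bigr => i _ do rewrite (pd_space Hbohr th s i).2.
      under [X in _ + X]eq_bigr => i _.
        under eq_bigr => j _ do rewrite (pd_space Hbohr th s j).2
          (pd_space Hbohr th (tder j s) i).2.
        over.
      over.
    apply: integral_Dom_transfer.
    - apply: measurable_funD; first apply: measurable_funD.
      + apply: measurable_funM; first exact: meas_comp.
        by apply: measurable_funTS; apply: meas_th => //; exact: tpoly_continuous.
      + apply: measurable_sum => i; apply: measurable_funM; first exact: meas_comp (cq i).
        by apply: measurable_funTS; apply: meas_th => //; exact: tpoly_continuous.
      + apply: measurable_sum => i; apply: measurable_sum => j.
        apply: measurable_funM; first exact: meas_comp (cr i j).
        by apply: measurable_funTS; apply: meas_th => //; exact: tpoly_continuous.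
    - apply: measurable_funD; first apply: measurable_funD.
      + apply: measurable_funM; first exact: meas_comp'.
        by apply: meas_th => //; exact: tpoly_continuous.
      + apply: measurable_sum => i; apply: measurable_funM; first exact: meas_comp' (cq i).
        by apply: meas_th => //; exact: tpoly_continuous.
      + apply: measurable_sum => i; apply: measurable_sum => j.
        apply: measurable_funM; first exact: meas_comp' (cr i j).
        by apply: meas_th => //; exact: tpoly_continuous.
    - by apply: filterS ww' => p h Dp; rewrite h.
    - move=> p; have [t0|/suppT//] := eqVneq (th p.1) 0.
      have [t0'|/suppT'//] := eqVneq (derive1 th p.1) 0.
      rewrite /tensor t0' mul0r mulr0 add0r.
      rewrite big1 ?add0r; last by move=> i _; rewrite t0 mul0r mulr0.
      rewrite big1 ?eqxx// => i _; rewrite big1// => j _.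
      by rewrite t0 mul0r mulr0.
  have bt th0 s0 : continuous th0 -> (forall t, th0 t != 0 -> a <= t <= b) ->
      bounded_meas (tensor th0 (tpoly s0) : X -> R).
    by move=> c0 s00; apply: tensor_bm c0 s00 _; exact: tpoly_continuous.
  (* [fine] respects the order between finite values, so both sides must be finite: the left one by
     square integrability of g', the right one by boundedness. *)
  move=> Hle; rewrite /Rintegral fine_le//; apply: integrable_fin_num => //.
    apply: (@integ_ext _ _ _ (nuT m T)
      (fun p => (eta2 (w' p) * tensor th (tpoly s) p) * \sum_k g' k p ^+ 2)).
      by move=> p; rewrite mulrAC.
    apply: integM; last exact: integ_sum.
    by apply: bmM; [exact: bm_comp'|exact: bt].
  apply: bm_integ => //; apply: bmD; first apply: bmD.
  + by apply: bmM; [exact: bm_comp'|exact: bt].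
  + by apply: bm_sum => i; apply: bmM; [exact: bm_comp' (cq i)|exact: bt].
  + apply: bm_sum => i; apply: bm_sum => j.
    by apply: bmM; [exact: bm_comp' (cr i j)|exact: bt].
Qed.

End CleanSolutions.

(** * Letting the doubled variables collapse *)

Section SpaceTimeDoubling.
Context {R : realType} (d : nat) (G : topologicalZmodType).
Variable iota : 'rV[R]_d -> G.
Hypothesis Hbohr : is_bohr_compactification iota.
Variable m : probability (GB R G) R.
Local Notation tpoly := (tpoly Hbohr).
Local Notation X := (measurableTypeR R * GB R G)%type.
Variables (f : 'I_d -> R -> R) (sigma : 'I_d -> 'I_d -> R -> R).
Hypothesis Hf : forall i, smooth_real (f i).
Hypothesis Hsigma : forall i k, smooth_real (sigma i k).

Variables (M T : R) (u v : X -> R) (g h : 'I_d -> X -> R).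
Hypotheses (M0 : 0 < M) (mu : measurable_fun setT u) (mv : measurable_fun setT v)
  (uM : forall p, `|u p| <= M) (vM : forall p, `|v p| <= M).
Hypotheses (Hu : clean_solution Hbohr m f sigma u T g)
  (Hv : clean_solution Hbohr m f sigma v T h).
Local Notation nu := (nuT m T).

Lemma bm_time (th : R -> R) (a b : R) (tm : X * X -> R) : continuous th ->
  (forall t, th t != 0 -> a <= t <= b) -> measurable_fun setT tm ->
  bounded_meas (fun z => th (tm z)).
Proof.
move=> cth supp mtm; have [C [_ HC]] := supp_bounded cth supp.
split; last by exists C => p; exact: HC.
by apply: measurableT_comp mtm; exact: continuous_measurable_fun.
Qed.

Lemma meas_time_add : measurable_fun setT (fun z : X * X => z.1.1 + z.2.1 : R).
Proof.
apply: measurable_funD.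
  by apply: measurableT_comp; [exact: measurable_fst|exact: measurable_fst].
by apply: measurableT_comp; [exact: measurable_fst|exact: measurable_snd].
Qed.

Lemma meas_time_sub : measurable_fun setT (fun z : X * X => z.1.1 - z.2.1 : R).
Proof.
apply: measurable_funB.
  by apply: measurableT_comp; [exact: measurable_fst|exact: measurable_fst].
by apply: measurableT_comp; [exact: measurable_fst|exact: measurable_snd].
Qed.

Variables (al ka : R -> R) (S : seq ('rV[R]_d * R * R)) (a0 a1 c : R).
Hypotheses (sal : smooth_real al) (ska : smooth_real ka)
  (al0 : forall t, 0 <= al t) (ka0 : forall t, 0 <= ka t)
  (alsupp : forall t, al t != 0 -> a0 <= t <= a1)
  (kasupp : forall t, ka t != 0 -> - c <= t <= c)
  (ca0 : c < a0) (a1T : a1 + c <= 2 * T)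
  (S0 : forall z, 0 <= tpoly S z).

Let dal : deriv_of al (derive1 al). Proof. exact: (smooth_real_deriv sal).1. Qed.
Let dka : deriv_of ka (derive1 ka). Proof. exact: (smooth_real_deriv ska).1. Qed.

Let P s (z : X * X) : R := tpoly s ((z.1.2 : G) - (z.2.2 : G)).
(** The t- and s-derivatives of [TH] are TA + TK and TA - TK. Their sum 2 TA is free of the
    derivative of [ka], which is not controlled as c tends to 0. *)
Let TH (z : X * X) : R := al (z.1.1 + z.2.1) * ka (z.1.1 - z.2.1).
Let TA (z : X * X) : R := derive1 al (z.1.1 + z.2.1) * ka (z.1.1 - z.2.1).
Let TK (z : X * X) : R := al (z.1.1 + z.2.1) * derive1 ka (z.1.1 - z.2.1).

Let th1 (s t : R) : R := al (1 * t + s) * ka (1 * t - s).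
Let th2 (t s : R) : R := al (1 * s + t) * ka (-1 * s + t).

Let sth1 s : smooth_real (th1 s).
Proof. by apply: smooth_realM; exact: smooth_real_affine. Qed.
Let sth2 t : smooth_real (th2 t).
Proof. by apply: smooth_realM; exact: smooth_real_affine. Qed.

(** From t + s in [a0, a1] and t - s in [-c, c]. With [ca0] and [a1T], each time variable then stays
    in a compact part of (0, T]. *)
Let supp_th t s : al (t + s) * ka (t - s) != 0 ->
  ((a0 - c) / 2 <= t <= (a1 + c) / 2) /\ ((a0 - c) / 2 <= s <= (a1 + c) / 2).
Proof.
rewrite mulf_eq0 negb_or => /andP[/alsupp/andP[? ?] /kasupp/andP[? ?]].
by split; apply/andP; split; lra.
Qed.

Let supp1 s t : th1 s t != 0 -> (a0 - c) / 2 <= t <= (a1 + c) / 2.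
Proof. by rewrite /th1 mul1r => /supp_th[]. Qed.
Let supp2 t s : th2 t s != 0 -> (a0 - c) / 2 <= s <= (a1 + c) / 2.
Proof. by rewrite /th2 mul1r mulN1r addrC (addrC (- s)) => /supp_th[]. Qed.

Let dth1 s : derive1 (th1 s) = fun t => derive1 al (t + s) * ka (t - s) + al (t + s) * derive1 ka (t - s).
Proof.
rewrite (deriv_ofE (deriv_ofM (deriv_of_comp_affine 1 s dal) (deriv_of_comp_affine 1 (- s) dka))).
by apply/funext => t; rewrite !mul1r addrC.
Qed.

Let dth2 t : derive1 (th2 t) = fun s => derive1 al (t + s) * ka (t - s) - al (t + s) * derive1 ka (t - s).
Proof.
rewrite (deriv_ofE (deriv_ofM (deriv_of_comp_affine 1 t dal) (deriv_of_comp_affine (-1) t dka))).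
by apply/funext => s; rewrite !mul1r !mulN1r (addrC s) (addrC (- s)); ring.
Qed.

Let E1 s y S' : tensor (th1 s) (tpoly (tshift Hbohr y S')) =
  fun p => TH (p, (s, y)) * P S' (p, (s, y)).
Proof.
by apply/funext => p; rewrite /tensor tshiftE /TH /P /th1/= !mul1r.
Qed.

Let E2 t x S' : tensor (th2 t) (tpoly (trefl Hbohr x S')) =
  fun p => TH ((t, x), p) * P S' ((t, x), p).
Proof.
apply/funext => p; rewrite /tensor treflE /TH /P /th2/= !mul1r mulN1r.
by rewrite (addrC p.1) (addrC (- p.1)).
Qed.

Let bTH : bounded_meas TH.
Proof.
apply: bmM.
  exact: bm_time (deriv_of_continuous dal) alsupp meas_time_add.
exact: bm_time (deriv_of_continuous dka) kasupp meas_time_sub.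
Qed.

Let bTA : bounded_meas TA.
Proof.
apply: bmM.
  apply: bm_time meas_time_add; last exact: supp_deriv dal alsupp.
  exact: deriv_of_continuous (smooth_real_deriv (smooth_real_deriv sal).2).1.
exact: bm_time (deriv_of_continuous dka) kasupp meas_time_sub.
Qed.

Let bTK : bounded_meas TK.
Proof.
apply: bmM.
  exact: bm_time (deriv_of_continuous dal) alsupp meas_time_add.
apply: bm_time meas_time_sub; last exact: supp_deriv dka kasupp.
exact: deriv_of_continuous (smooth_real_deriv (smooth_real_deriv ska).2).1.
Qed.

Let bP s : bounded_meas (P s). Proof. exact: tpoly_diff_bm. Qed.

Let a0c : 0 < (a0 - c) / 2. Proof. by rewrite divr_gt0// subr_gt0. Qed.
Let a1c : (a1 + c) / 2 <= T. Proof. by rewrite ler_pdivrMr// mulrC. Qed.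

(** For frozen (s, y) the test function is [th1 s] times a translate of S, for frozen (t, x) it is
    [th2 t] times a reflection of S. Differentiating a reflection changes the sign, which yields the
    - px and - pxx required by [doubling]. *)
Lemma space_time_doubling : 0 <= \int[(nu \x nu)%E]_z
  (`|u z.1 - v z.2| * (2 * derive1 al (z.1.1 + z.2.1) * ka (z.1.1 - z.2.1) *
     tpoly S ((z.1.2 : G) - (z.2.2 : G)))).
Proof.
have cf' i : continuous (derive1 (f i) : R -> R).
  exact: deriv_of_continuous (smooth_real_deriv (smooth_real_deriv (@Hf i)).2).1.
have dsig i k := (smooth_real_deriv (@Hsigma i k)).1.
have cdsig i k : continuous (derive1 (sigma i k) : R -> R).
  exact: deriv_of_continuous (smooth_real_deriv (smooth_real_deriv (@Hsigma i k)).2).1.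
have := @doubling R d _ X nu (nuT_fin m T) (fun i => derive1 (f i)) sigma
  (fun i k => derive1 (sigma i k)) cf' dsig cdsig M u v g h M0 mu mv uM vM
  (clean_gmeas Hu) (clean_gmeas Hv) (clean_gL2 Hu) (clean_gL2 Hv)
  (fun z => TH z * P S z) (fun z => (TA z + TK z) * P S z)
  (fun z => (TA z - TK z) * P S z) (fun i z => TH z * P (tder i S) z)
  (fun i j z => TH z * P (tder i (tder j S)) z).
have -> : (fun z : X * X => `|u z.1 - v z.2| * (2 * derive1 al (z.1.1 + z.2.1) *
      ka (z.1.1 - z.2.1) * tpoly S ((z.1.2 : G) - (z.2.2 : G)))) =
    (fun z => `|u z.1 - v z.2| * ((TA z + TK z) * P S z + (TA z - TK z) * P S z)).
  by apply/funext => z; rewrite /TA /TK /P; ring.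
apply.
- by apply: bmM.
- by apply: bmM => //; exact: bmD.
- by apply: bmM => //; exact: bmB.
- by move=> i; apply: bmM.
- by move=> i j; apply: bmM.
- move=> z; rewrite mulr_ge0 ?mulr_ge0 ?al0 ?ka0 ?S0 //.
- move=> [s y]; have := clean_entropy Hu (s := tshift Hbohr y S) (@sth1 s) a0c a1c (@supp1 s).
  rewrite !E1 dth1.
  have -> : (fun i => tensor (th1 s) (tpoly (tder i (tshift Hbohr y S)))) =
      (fun i p => TH (p, (s, y)) * P (tder i S) (p, (s, y))).
    by apply/funext => i; rewrite tder_tshift E1.
  have -> : (fun i j => tensor (th1 s) (tpoly (tder i (tder j (tshift Hbohr y S))))) =
      (fun i j p => TH (p, (s, y)) * P (tder i (tder j S)) (p, (s, y))).
    by apply/funext => i; apply/funext => j; rewrite !tder_tshift E1.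
  have -> : tensor (fun t => derive1 al (t + s) * ka (t - s) + al (t + s) * derive1 ka (t - s))
      (tpoly (tshift Hbohr y S)) = fun p => (TA (p, (s, y)) + TK (p, (s, y))) * P S (p, (s, y)).
    by apply/funext => p; rewrite /tensor tshiftE /TA /TK /P.
  by apply => p; rewrite mulr_ge0 ?mulr_ge0 ?al0 ?ka0 ?S0.
- move=> [t x]; have := clean_entropy Hv (s := trefl Hbohr x S) (@sth2 t) a0c a1c (@supp2 t).
  rewrite !E2 dth2.
  have -> : (fun i => tensor (th2 t) (tpoly (tder i (trefl Hbohr x S)))) =
      (fun i p => - (TH ((t, x), p) * P (tder i S) ((t, x), p))).
    apply/funext => i; rewrite tder_trefl E2; apply/funext => p.
    by rewrite /P toppE mulrN.
  have -> : (fun i j => tensor (th2 t) (tpoly (tder i (tder j (trefl Hbohr x S))))) =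
      (fun i j p => TH ((t, x), p) * P (tder i (tder j S)) ((t, x), p)).
    apply/funext => i; apply/funext => j; rewrite !tder_trefl tder_topp E2.
    by apply/funext => p; rewrite /P !toppE opprK.
  have -> : tensor (fun s => derive1 al (t + s) * ka (t - s) - al (t + s) * derive1 ka (t - s))
      (tpoly (trefl Hbohr x S)) = fun p => (TA ((t, x), p) - TK ((t, x), p)) * P S ((t, x), p).
    by apply/funext => p; rewrite /tensor treflE /TA /TK /P.
  by apply => p; rewrite mulr_ge0 ?mulr_ge0 ?al0 ?ka0 ?S0.
- move=> [s y]; have := clean_chain Hu (tshift Hbohr y S) (@sth1 s) a0c a1c (@supp1 s).
  rewrite !E1.
  have -> // : (fun i => tensor (th1 s) (tpoly (tder i (tshift Hbohr y S)))) =
      (fun i p => TH (p, (s, y)) * P (tder i S) (p, (s, y))).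
  by apply/funext => i; rewrite tder_tshift E1.
- move=> [t x] i; have := clean_chain Hv (trefl Hbohr x (tder i S)) (@sth2 t) a0c a1c (@supp2 t).
  rewrite !E2.
  have -> // : (fun j => tensor (th2 t) (tpoly (tder j (trefl Hbohr x (tder i S))))) =
      (fun j p => - (TH ((t, x), p) * P (tder i (tder j S)) ((t, x), p))).
  apply/funext => j; rewrite tder_trefl E2; apply/funext => p.
  by rewrite /P toppE tder_comm mulrN.
Qed.

End SpaceTimeDoubling.

(** * Time integrals and marginals of the doubled kernel *)

Section SupportLipschitz.
Context {R : realType}.

(** On [-N, N] the derivative is bounded, and th vanishes from |x| = N on. So th is unchanged by
    clamping its argument to [-N, N], and clamping is 1-Lipschitz. *)
Lemma supp_lipschitz (th dth : R -> R) (a b : R) : deriv_of th dth -> continuous dth ->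
  (forall t, th t != 0 -> a <= t <= b) ->
  exists L, 0 <= L /\ forall x y, `|th x - th y| <= L * `|x - y|.
Proof.
move=> dthP cdth supp; pose N : R := `|a| + `|b| + 1.
have [L [L0 HL]] := lipschitz_of_deriv N dthP cdth.
have N1 : 1 <= N by rewrite /N; have := normr_ge0 a; have := normr_ge0 b; lra.
have z x : N <= `|x| -> th x = 0.
  move=> xN; apply/eqP/negPn/negP => /supp/andP[ax xb].
  have : `|x| <= `|a| + `|b|.
    rewrite ler_norml; have := ler_norm (- a); have := ler_norm b; rewrite normrN.
    have := normr_ge0 a; have := normr_ge0 b; lra.
  by move: xN; rewrite /N; lra.
pose cl (x : R) : R := Num.max (- N) (Num.min N x).
have clE x : [\/ cl x = - N /\ x <= - N, cl x = x /\ - N <= x <= N | cl x = N /\ N <= x].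
  rewrite /cl; have [xN|xN] := leP N x.
    by apply: Or33; split => //; apply/max_idPr; lra.
  have [Nx|Nx] := leP (- N) x; [apply: Or32|apply: Or31]; split => //.
    by lra.
  exact: ltW.
have clN x : `|cl x| <= N.
  by case: (clE x) => [[-> _]|[-> h]|[-> _]]; rewrite ?ler_norml// ?h//; lra.
have thcl x : th (cl x) = th x.
  case: (clE x) => [[-> xN]|[-> //]|[-> xN]].
    have h1 : N <= `|- N| by rewrite normrN ger0_norm; lra.
    have h2 : N <= `|x| by have := ler_norm (- x); rewrite normrN; lra.
    by rewrite (z _ h1) (z _ h2).
  have h1 : N <= `|N| by rewrite ger0_norm; lra.
  have h2 : N <= `|x| by have := ler_norm x; lra.
  by rewrite (z _ h1) (z _ h2).
exists L; split => // x y; rewrite -(thcl x) -(thcl y).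
apply: le_trans (HL _ _ (clN x) (clN y)) _; rewrite ler_wpM2l//.
have h1 := ler_norm (x - y); have := ler_norm (- (x - y)); rewrite normrN => h2.
rewrite ler_norml; case: (clE x) => [[-> ?]|[-> ?]|[-> ?]]; case: (clE y) => [[-> ?]|[-> ?]|[-> ?]]; lra.
Qed.

End SupportLipschitz.

Section TimeIntegrals.
Context {R : realType}.
Variable T : R.
Hypothesis T0 : 0 < T.

Lemma Rintegral_lebT (F f : R -> R) : deriv_of F f -> continuous f ->
  \int[lebT T]_t f t = F T - F 0.
Proof.
move=> dF cf.
have m0T : measurable (`[0%R, T] : set (measurableTypeR R)) by exact: measurable_itv.
have E : (\int[lebT T]_t (f t)%:E = \int[lebesgue_measure]_(t in `[0%R, T]) (f t)%:E)%E.
  have mf : measurable_fun setT (f : measurableTypeR R -> R) by exact: continuous_measurable_fun.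
  rewrite [RHS]integral_mkcond (integral_lebT (T := T)); last first.
    by move=> t h; rewrite patchE ifF//; apply/negP => /set_mem; rewrite /= in_itv.
  apply: ae_eq_integral => //.
  - exact/measurable_EFinP.
  - apply/(measurable_restrictT _ m0T); apply: measurable_funTS; exact/measurable_EFinP.
  - exists (~` `[0%R, T]); split.
    + exact: measurableC.
    + by rewrite /= /lebT /= /mfrestr /mrestr setICl measure0.
    + move=> t /=; apply: contra_not => h _; rewrite patchE ifT//; exact/mem_set.
rewrite /Rintegral E (continuous_FTC2 (F := F))//.
- exact: continuous_subspaceT.
- split.
  + by move=> x _; exact: deriv_of_derivable dF x.
  + apply: cvg_at_right_filter; exact: (deriv_of_continuous dF).
  + apply: cvg_at_left_filter; exact: (deriv_of_continuous dF).
- by move=> x _; rewrite (deriv_ofE dF).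
Qed.

End TimeIntegrals.


Lemma bump_itv {R : realType} (a b : R) (k K : R -> R) : bump a b k K ->
  forall x, 0 <= K x <= 1.
Proof.
move=> B x.
have mono s t : s <= t -> K s <= K t.
  by move=> st; apply: deriv_of_nondecreasing st (bump_deriv B) _ => y _; exact: bump_ge0 B y.
apply/andP; split.
  have [xa|/ltW ax] := leP x a; first by rewrite (bump_left B xa).
  by rewrite -(bump_left B (lexx a)); exact: mono.
have [bx|/ltW xb] := leP b x; first by rewrite (bump_right B bx).
by rewrite -(bump_right B (lexx b)); exact: mono.
Qed.

Section TensorIntegral.
Context {R : realType} (G : topologicalZmodType).
Variable m : probability (GB R G) R.
Variable T : R.
Local Notation X := (measurableTypeR R * GB R G)%type.
Local Notation nu := (nuT m T).

Lemma prob_fin : (m setT < +oo)%E.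
Proof. by rewrite probability_setT ltry. Qed.

Lemma Rint_tensor (k : measurableTypeR R -> R) (Q : GB R G -> R) :
  bounded_meas k -> bounded_meas Q ->
  \int[nu]_p (k p.1 * Q p.2) = (\int[lebT T]_t k t) * (\int[m]_x Q x).
Proof.
move=> bk bQ; have ik := bm_integ (lebT_fin T) bk; have iQ := bm_integ prob_fin bQ.
have /Rfubini1 := integ_tensor ik iQ; rewrite /= => <-.
under [X in X = _]eq_Rintegral => t _ do rewrite (RintZ _ iQ) mulrC.
by rewrite (RintZ _ ik) mulrC.
Qed.

End TensorIntegral.

Section Marginals.
Context {R : realType} (d : nat) (G : topologicalZmodType).
Variable iota : 'rV[R]_d -> G.
Hypothesis Hbohr : is_bohr_compactification iota.
Variable m : probability (GB R G) R.
Hypothesis Hhaar : is_haar m.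
Local Notation tpoly := (tpoly Hbohr).
Local Notation X := (measurableTypeR R * GB R G)%type.
Variables (T c : R) (ka K : R -> R) (S : seq ('rV[R]_d * R * R)).
Hypotheses (T0 : 0 < T) (B : bump (- c) c ka K)
  (S1 : \int[m]_x tpoly S x = 1)
  (SN : forall z, tpoly S (- z) = tpoly S z).
Local Notation nu := (nuT m T).

Let W (z : X * X) : R := ka (z.1.1 - z.2.1) * tpoly S ((z.1.2 : G) - (z.2.2 : G)).

Let cka : continuous ka.
Proof. exact: deriv_of_continuous (smooth_real_deriv (bump_smooth B)).1. Qed.

Let bm_ka (th : R -> R) : continuous th -> bounded_meas ((fun t => ka (th t)) : measurableTypeR R -> R).
Proof.
move=> cth; have [C [_ HC]] := supp_bounded cka (bump_supp B).
split; last by exists C => t; exact: HC.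
apply: continuous_measurable_fun => t; apply: continuous_comp; [exact: cth|exact: cka].
Qed.

Let S1l y : \int[m]_x tpoly S ((x : G) - y) = 1.
Proof. by rewrite (tpoly_int_shift Hbohr Hhaar). Qed.

Let S1r x : \int[m]_y tpoly S (x - (y : G)) = 1.
Proof.
by rewrite -(S1l x); apply: eq_Rintegral => y _; rewrite -SN opprB.
Qed.

Let ctr (y : G) : continuous (fun x : G => tpoly S (x - y)).
Proof.
move=> x; apply: continuous_comp; first exact: addr_continuousl.
exact: (@tpoly_continuous _ _ _ _ Hbohr S).
Qed.

Let ctl (x : G) : continuous (fun y : G => tpoly S (x - y)).
Proof.
rewrite (_ : (fun y => _) = fun y => tpoly S (y - x)); first exact: ctr.
by apply/funext => y; rewrite -SN opprB.
Qed.

Lemma time_kernel_int_l t : \int[lebT T]_s ka (t - s) = K t - K (t - T).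
Proof.
have dF := deriv_ofN (deriv_of_refl t (bump_deriv B)).
have := @Rintegral_lebT _ T T0 _ (fun s => ka (t - s)) (deriv_of_ext dF (fun s => opprK _)).
rewrite subr0 => ->; first by rewrite opprK addrC.
move=> s; apply: continuous_comp; last exact: cka.
exact: deriv_of_continuous (deriv_of_refl t deriv_of_id) _.
Qed.

Lemma time_kernel_int_r s : \int[lebT T]_t ka (t - s) = K (T - s) - K (- s).
Proof.
have := @Rintegral_lebT _ T T0 _ _ (deriv_of_shift s (bump_deriv B)).
rewrite sub0r; apply => t; apply: continuous_comp; last exact: cka.
exact: deriv_of_continuous (deriv_of_shift s deriv_of_id) _.
Qed.

(** By invariance of Haar measure and evenness of S the space factor has integral 1, which leaves
    the time factor. The value lies between 0 and 1, and equals 1 when c <= p.1 <= T - c; mass is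
    lost only near the ends of [0, T]. *)
Lemma kernel_marginal_l (p : X) : \int[nu]_q W (p, q) = K p.1 - K (p.1 - T).
Proof.
rewrite -time_kernel_int_l -[RHS]mulr1 -(S1r p.2).
apply: Rint_tensor.
  by apply: bm_ka; exact: deriv_of_continuous (deriv_of_refl _ deriv_of_id).
exact: (@continuous_bm _ _ _ _ Hbohr (fun y : G => tpoly S ((p.2 : G) - y)) (@ctl p.2)).
Qed.

Lemma kernel_marginal_r (q : X) : \int[nu]_p W (p, q) = K (T - q.1) - K (- q.1).
Proof.
rewrite -time_kernel_int_r -[RHS]mulr1 -(S1l q.2).
apply: Rint_tensor.
  by apply: bm_ka; exact: deriv_of_continuous (deriv_of_shift _ deriv_of_id).
exact: (@continuous_bm _ _ _ _ Hbohr (fun x : G => tpoly S (x - (q.2 : G))) (@ctr q.2)).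
Qed.

Lemma kernel_time_marginal (p : X) : \int[nu]_q ka (p.1 - q.1) = K p.1 - K (p.1 - T).
Proof.
rewrite -time_kernel_int_l -[RHS]mulr1.
have E : \int[m]_x (fun=> 1 : R) x = 1.
  by rewrite /Rintegral integral_cst// mul1e; exact: (congr1 fine (probability_setT m)).
rewrite -[in RHS]E -(@Rint_tensor _ _ m T (fun s => ka (p.1 - s)) (fun=> 1)).
- by apply: eq_Rintegral => q _; rewrite mulr1.
- by apply: bm_ka; exact: deriv_of_continuous (deriv_of_refl _ deriv_of_id).
- exact: bm_cst.
Qed.

Lemma W_bm : bounded_meas W.
Proof.
apply: bmM; last exact: tpoly_diff_bm.
exact: bm_time cka (bump_supp B) (@meas_time_sub _ _).
Qed.

Lemma ka_bm : bounded_meas (fun z : X * X => ka (z.1.1 - z.2.1)).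
Proof. exact: bm_time cka (bump_supp B) (@meas_time_sub _ _). Qed.

Let nufin := nuT_fin m T.
Let nu2fin : ((nu \x nu)%E setT < +oo)%E. Proof. exact: finite_prod. Qed.

Lemma marginal_l (F : X -> R) : bounded_meas F ->
  \int[(nu \x nu)%E]_z (F z.1 * W z) = \int[nu]_p (F p * (K p.1 - K (p.1 - T))).
Proof.
move=> bF.
have i2 : integ (nu \x nu)%E (fun z => F z.1 * W z).
  by apply: bm_integ => //; apply: bmM W_bm; exact: bm_lift1.
rewrite -(Rfubini1 i2); apply: eq_Rintegral => p _ /=.
rewrite RintZ ?kernel_marginal_l//; apply: bm_integ => //; exact: bm_section1 W_bm.
Qed.

Lemma marginal_le_l (F : X -> R) : bounded_meas F -> (forall p, 0 <= F p) ->
  \int[(nu \x nu)%E]_z (F z.1 * W z) <= \int[nu]_p F p.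
Proof.
move=> bF F0; rewrite marginal_l//; apply: Rint_le.
- have i2 : integ (nu \x nu)%E (fun z => F z.1 * W z).
    by apply: bm_integ => //; apply: bmM W_bm; exact: bm_lift1.
  apply: integ_ext (Rfubini1_integ i2) => p /=.
  rewrite RintZ ?kernel_marginal_l//; apply: bm_integ => //; exact: bm_section1 W_bm.
- exact: bm_integ.
- move=> p; rewrite ler_piMr//.
  by have := bump_itv B p.1; have := bump_itv B (p.1 - T); lra.
Qed.

Lemma marginal_le_r (F : X -> R) : bounded_meas F -> (forall p, 0 <= F p) ->
  \int[(nu \x nu)%E]_z (F z.2 * W z) <= \int[nu]_p F p.
Proof.
move=> bF F0.
have i2 : integ (nu \x nu)%E (fun z => F z.2 * W z).
  by apply: bm_integ => //; apply: bmM W_bm; exact: bm_lift2.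
have E q : \int[nu]_p (F (p, q).2 * W (p, q)) = F q * (K (T - q.1) - K (- q.1)).
  rewrite /= RintZ ?kernel_marginal_r//; apply: bm_integ => //; exact: bm_section2 W_bm.
rewrite -(Rfubini2 i2); apply: Rint_le.
- exact: Rfubini2_integ i2.
- exact: bm_integ.
- move=> q; rewrite E ler_piMr//.
  by have := bump_itv B (T - q.1); have := bump_itv B (- q.1); lra.
Qed.

(** The mollifier bound Lam S <= e S + e has a term without the factor S, so the mass of the time
    kernel alone must be bounded too. *)
Lemma ka_marginal_le :
  \int[(nu \x nu)%E]_z ka (z.1.1 - z.2.1) <= \int[nu]_p (fun=> 1 : R) p.
Proof.
have i2 : integ (nu \x nu)%E (fun z => ka (z.1.1 - z.2.1)) by apply: bm_integ => //; exact: ka_bm.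
rewrite -(Rfubini1 i2); apply: Rint_le.
- exact: Rfubini1_integ i2.
- exact/bm_integ/bm_cst.
- move=> p; rewrite /= kernel_time_marginal.
  by have := bump_itv B p.1; have := bump_itv B (p.1 - T); lra.
Qed.

End Marginals.

(** * The dissipation inequality on the diagonal *)

Section ErrorEstimates.
Context {R : realType}.

(** Used with a = |u(t,x) - v(s,y)|, b = |u(t,x) - v(t,x)|, w = |v(t,x) - v(s,y)|; n1 and n2 are |v
    - V| at the two points and q = |V(t,x) - V(s,y)|; dA = al'(t + s), dB = al'(2t), k = ka(t - s),
    P = S(x - y). The bound is linear in kernel integrals with known marginals. *)
Lemma collapse_error (a b w n1 n2 q dA dB A M e k P : R) :
  0 <= k -> 0 <= P -> 0 <= A -> 0 <= e -> 0 <= b <= 2 * M ->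
  `|a - b| <= w -> w <= n1 + n2 + q -> q * P <= 3 * e * P + e ->
  `|dA - dB| <= e -> `|dA| <= A ->
  a * (2 * dA * k * P) <= b * (2 * dB) * (k * P) +
    (2 * A * (n1 * (k * P) + n2 * (k * P) + (3 * e * (k * P) + e * k)) +
     4 * M * e * (k * P)).
Proof.
move=> k0 P0 A0 e0 /andP[b0 bM] abw wn hq hd hA.
have step1 : a * dA <= b * dB + A * w + 2 * M * e.
  have h1 : (a - b) * dA <= w * A.
    by apply: le_trans (ler_norm _) _; rewrite normrM; apply: ler_pM; rewrite ?normr_ge0.
  have h2 : b * (dA - dB) <= 2 * M * e.
    apply: le_trans (ler_norm _) _; rewrite normrM (ger0_norm b0).
    by apply: ler_pM => //; rewrite normr_ge0.
  lra.
have step2 : w * P <= (n1 + n2) * P + (3 * e * P + e).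
  by apply: le_trans (ler_wpM2r P0 wn) _; rewrite mulrDl lerD2l.
have s1 := ler_wpM2r (mulr_ge0 k0 P0) step1.
have s2 := ler_wpM2l (mulr_ge0 A0 k0) step2.
lra.
Qed.

Lemma modulus_error (l q e P : R) : 0 <= P -> q <= e + l + e -> l * P <= e * P + e ->
  q * P <= 3 * e * P + e.
Proof. by move=> P0 h1 h2; apply: le_trans (ler_wpM2r P0 h1) _; lra. Qed.

Lemma total_error (i1 i2 i3 i4 A M e tau : R) : 0 <= A -> 0 < M -> 0 < e ->
  i1 <= e -> i2 <= e -> i3 <= tau -> i4 <= tau ->
  2 * A * (i1 + i2 + (3 * e * i3 + e * i4)) + 4 * M * e * i3 <=
  e * (2 * A * (2 + 4 * tau) + 4 * M * tau).
Proof.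
move=> A0 M0 e0 h1 h2 h3 h4.
have e3 := ler_wpM2l (ltW e0) h3; have e4 := ler_wpM2l (ltW e0) h4.
have m3 := ler_wpM2l (ltW M0) e3.
have h : i1 + i2 + (3 * e * i3 + e * i4) <= e * (2 + 4 * tau) by lra.
have := ler_wpM2l A0 h; lra.
Qed.

Lemma dist_diff_le (x y z : R) : `| `|x - z| - `|x - y| | <= `|y - z|.
Proof.
have := ler_dist_dist (x - z) (x - y); rewrite (_ : x - z - (x - y) = y - z)//; ring.
Qed.

End ErrorEstimates.

Section TimeDissipation.
Context {R : realType} (d : nat) (G : topologicalZmodType).
Variable iota : 'rV[R]_d -> G.
Hypothesis Hbohr : is_bohr_compactification iota.
Variable m : probability (GB R G) R.
Hypothesis Hhaar : is_haar m.
Local Notation tpoly := (tpoly Hbohr).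
Local Notation X := (measurableTypeR R * GB R G)%type.
Variables (f : 'I_d -> R -> R) (sigma : 'I_d -> 'I_d -> R -> R).
Hypothesis Hf : forall i, smooth_real (f i).
Hypothesis Hsigma : forall i k, smooth_real (sigma i k).

Variables (M T : R) (u v : X -> R) (g h : 'I_d -> X -> R).
Hypotheses (M0 : 0 < M) (mu : measurable_fun setT u) (mv : measurable_fun setT v)
  (uM : forall p, `|u p| <= M) (vM : forall p, `|v p| <= M).
Hypotheses (Hu : clean_solution Hbohr m f sigma u T g)
  (Hv : clean_solution Hbohr m f sigma v T h).
Local Notation nu := (nuT m T).

Variables (al : R -> R) (a0 a1 : R).
Hypotheses (sal : smooth_real al) (al0 : forall t, 0 <= al t)
  (alsupp : forall t, al t != 0 -> a0 <= t <= a1) (a00 : 0 < a0) (a1T : a1 < 2 * T)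
  (T0 : 0 < T).

Let dal : deriv_of al (derive1 al). Proof. exact: (smooth_real_deriv sal).1. Qed.
Let ddal : deriv_of (derive1 al) (derive1 (derive1 al)).
Proof. exact: (smooth_real_deriv (smooth_real_deriv sal).2).1. Qed.
Let cddal : continuous (derive1 (derive1 al) : R -> R).
Proof.
exact: deriv_of_continuous (smooth_real_deriv (smooth_real_deriv (smooth_real_deriv sal).2).2).1.
Qed.
Let dalsupp t : derive1 al t != 0 -> a0 <= t <= a1.
Proof. exact: (supp_deriv dal alsupp). Qed.

Let D (p : X) : R := `|u p - v p|.
Let B (p : X) : R := 2 * derive1 al (2 * p.1).
Let tau : R := \int[nu]_p (fun=> 1 : R) p.

Let bu : bounded_meas u. Proof. by split => //; exists M. Qed.
Let bv : bounded_meas v. Proof. by split => //; exists M. Qed.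
Let bD : bounded_meas D. Proof. exact: bm_norm (bmB bu bv). Qed.
Let bB : bounded_meas B.
Proof.
have [C [_ HC]] := supp_bounded (deriv_of_continuous ddal) dalsupp.
split; last first.
  by exists (2 * C) => p; rewrite /B normrM ger0_norm// ler_pM2l.
apply: measurable_funM; first exact: measurable_cst.
apply: (@measurableT_comp _ _ _ _ _ _ (derive1 al)).
  exact: (continuous_measurable_fun (deriv_of_continuous ddal)).
by apply: measurable_funM; [exact: measurable_cst|exact: measurable_fst].
Qed.

(** The order of choices matters: V approximates v within e, its modulus determines S, and only then
    is c taken small. V, S and [ka] are uncontrolled in size, but they enter the error only through
    |v - V| in L1 and kernel masses at most tau, so the final constant depends on none of them. *)
Lemma time_dissipation_epsilon (A Lp e : R) : 0 <= Lp ->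
  (forall t, `|derive1 al t| <= A) ->
  (forall s t, `|derive1 al s - derive1 al t| <= Lp * `|s - t|) -> 0 < e ->
  0 <= \int[nu]_p (D p * B p) + e * (2 * A * (2 + 4 * tau) + 4 * M * tau).
Proof.
move=> Lp0 HA HL e0.
have A0 : 0 <= A by apply: le_trans (HA 0).
have [V [uV bV HV]] := umod_dense Hbohr (nuT_fin m T) bv e0.
have [L [Lam [L0 cLam Lam0 Lamz HVm]]] := uV e e0.
have [S [S0 S1 SN SL]] := mollifier Hbohr Hhaar cLam Lam0 Lamz e0.
(* The first two bounds keep the support of al'(2t) inside [c, T - c]; the last two make the
   variation over |t - s| <= c at most e, for the time part of the modulus of V and for al'. *)
have [c [c0 ca0 caT cL cLp]] : exists c : R,
    [/\ 0 < c, c <= a0 / 2, c <= T - a1 / 2, L * c <= e & Lp * c <= e].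
  have mul_le (l x : R) : 0 <= l -> x <= e / (l + 1) -> l * x <= e.
    move=> l0 xe; have : x * (l + 1) <= e by rewrite -ler_pdivlMr// ltr_wpDl.
    have [x0|x0] := leP 0 x; first by lra.
    by move=> _; apply: le_trans (ltW e0); rewrite mulr_ge0_le0// ltW.
  exists (Num.min (Num.min (a0 / 2) (T - a1 / 2)) (Num.min (e / (L + 1)) (e / (Lp + 1)))).
  split.
  - have h1 : 0 < a0 / 2 by rewrite divr_gt0.
    have h2 : 0 < T - a1 / 2 by rewrite subr_gt0 ltr_pdivrMr// mulrC.
    by rewrite !lt_min h1 h2 !divr_gt0 ?ltr_wpDl.
  - by rewrite !ge_min lexx ?orbT.
  - by rewrite !ge_min lexx ?orbT.
  - by apply: mul_le => //; rewrite !ge_min lexx ?orbT.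
  - by apply: mul_le => //; rewrite !ge_min lexx ?orbT.
have cc : - c < c by lra.
have [ka [K Bk]] : exists k K, bump (- c) c k K by exact: bump_exists.
pose W (z : X * X) : R := ka (z.1.1 - z.2.1) * tpoly S ((z.1.2 : G) - (z.2.2 : G)).
pose k2 (z : X * X) : R := ka (z.1.1 - z.2.1).
pose N (p : X) : R := `|v p - V p|.
have bN : bounded_meas N by exact: bm_norm (bmB bv bV).
have bW : bounded_meas W by exact: (W_bm Hbohr S Bk).
have bk : bounded_meas k2 by exact: (ka_bm G Bk).
have nu2fin : ((nu \x nu)%E setT < +oo)%E by apply: finite_prod; exact: nuT_fin.
have ca : c < a0 by have := a00; lra.
have ac : a1 + c <= 2 * T by lra.
have J0 := space_time_doubling Hf Hsigma M0 mu mv uM vM Hu Hv sal (bump_smooth Bk) al0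
  (bump_ge0 Bk) alsupp (bump_supp Bk) ca ac S0.
pose E (z : X * X) : R := 2 * A * (N z.1 * W z + N z.2 * W z + (3 * e * W z + e * k2 z)) +
   4 * M * e * W z.
have pt z : `|u z.1 - v z.2| * (2 * derive1 al (z.1.1 + z.2.1) * ka (z.1.1 - z.2.1) *
     tpoly S ((z.1.2 : G) - (z.2.2 : G))) <= (D z.1 * B z.1) * W z + E z.
  case: z => [[t x] [s y]].
  rewrite /E /D /B /N /W /k2 /=; set k := ka _; set P := tpoly S _.
  have k0 : 0 <= k by exact: bump_ge0 Bk _.
  have P0 : 0 <= P by exact: S0.
  (* Off the support of the time kernel both sides vanish; on it |t - s| <= c is available. *)
  have [k00|/eqP k00] := eqVneq k 0.
    by rewrite k00 !(mul0r, mulr0) !(addr0, mulr0).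
  have tsc : `|t - s| <= c.
    by rewrite ler_norml; apply: (bump_supp Bk); apply/eqP.
  apply: (@collapse_error _ _ _ `|v (t, x) - v (s, y)| _ _ `|V (t, x) - V (s, y)|) => //.
  - exact: ltW.
  - rewrite normr_ge0/= (le_trans (ler_normB _ _))// mulr2n mulrDl mul1r.
    by apply: lerD; [exact: uM|exact: vM].
  - exact: dist_diff_le.
  - rewrite (_ : v (t, x) - v (s, y) = (v (t, x) - V (t, x)) - (v (s, y) - V (s, y)) +
      (V (t, x) - V (s, y))); last by ring.
    by apply: le_trans (ler_normD _ _) _; rewrite lerD2r ler_normB.
  - apply: (@modulus_error _ (Lam ((x : G) - y))) => //.
    apply: le_trans (HVm _ _ _ _) _; rewrite !lerD2r.
    by apply: le_trans cL; exact: ler_wpM2l.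
  - apply: le_trans (HL _ _) _; apply: le_trans cLp; apply: ler_wpM2l => //.
    by rewrite (_ : _ - _ = - (t - s)) ?normrN//; ring.
have IW : \int[(nu \x nu)%E]_z W z <= tau.
  have := marginal_le_l Hhaar T0 Bk S1 SN (bm_cst _ (1 : R)) (fun _ => ler01).
  by under eq_Rintegral do rewrite mul1r.
have Ik : \int[(nu \x nu)%E]_z k2 z <= tau by exact: (ka_marginal_le m T0 Bk).
have IN1 : \int[(nu \x nu)%E]_z (N z.1 * W z) <= e.
  apply: le_trans HV; apply: (marginal_le_l Hhaar T0 Bk S1 SN bN) => p; exact: normr_ge0.
have IN2 : \int[(nu \x nu)%E]_z (N z.2 * W z) <= e.
  apply: le_trans HV; apply: (marginal_le_r Hhaar T0 Bk S1 bN) => p; exact: normr_ge0.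
(* Where al'(2t) is nonzero, c <= t <= T - c, so the marginal is exactly 1 and the main term loses
   nothing. *)
have IDB : \int[(nu \x nu)%E]_z ((D z.1 * B z.1) * W z) = \int[nu]_p (D p * B p).
  rewrite (marginal_l Hhaar T0 Bk S1 SN (bmM bD bB)); apply: eq_Rintegral => p _.
  have [->|B0] := eqVneq (B p) 0; first by rewrite !mulr0 mul0r.
  have /dalsupp/andP[h1 h2] : derive1 al (2 * p.1) != 0.
    by apply: contra_neq B0 => B0; rewrite /B B0 mulr0.
  have h3 : c <= p.1 by rewrite (le_trans ca0)// ler_pdivrMr// mulrC.
  have h4 : p.1 - T <= - c.
    by rewrite lerNr opprB (le_trans caT)// lerD2l lerN2 ler_pdivlMr// mulrC.
  by rewrite (bump_right Bk h3) (bump_left Bk h4) subr0 mulr1.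
have iW := bm_integ nu2fin bW; have ik := bm_integ nu2fin bk.
have iN1 : integ (nu \x nu)%E (fun z => N z.1 * W z).
  by apply: bm_integ => //; apply: bmM bW; exact: bm_lift1.
have iN2 : integ (nu \x nu)%E (fun z => N z.2 * W z).
  by apply: bm_integ => //; apply: bmM bW; exact: bm_lift2.
have iDB : integ (nu \x nu)%E (fun z => (D z.1 * B z.1) * W z).
  apply: bm_integ => //; apply: bmM bW; by apply: (@bm_lift1 _ _ _ _ _ (fun p => D p * B p)); exact: bmM bD bB.
have iwk := integD (integZ (3 * e) iW) (integZ e ik).
have iNW := integD (integD iN1 iN2) iwk.
have iE : integ (nu \x nu)%E E by exact: integD (integZ (2 * A) iNW) (integZ (4 * M * e) iW).
have IE : \int[(nu \x nu)%E]_z E z <= e * (2 * A * (2 + 4 * tau) + 4 * M * tau).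
  have -> : \int[(nu \x nu)%E]_z E z = 2 * A * (\int[(nu \x nu)%E]_z (N z.1 * W z) +
      \int[(nu \x nu)%E]_z (N z.2 * W z) + (3 * e * \int[(nu \x nu)%E]_z W z +
      e * \int[(nu \x nu)%E]_z k2 z)) + 4 * M * e * \int[(nu \x nu)%E]_z W z.
    rewrite /E (RintD (integZ (2 * A) iNW) (integZ (4 * M * e) iW)) (RintZ _ iNW) (RintZ _ iW).
    rewrite (RintD (integD iN1 iN2) iwk) (RintD iN1 iN2).
    by rewrite (RintD (integZ (3 * e) iW) (integZ e ik)) (RintZ _ iW) (RintZ _ ik).
  move: (\int[_]_z (N z.1 * W z)) (\int[_]_z (N z.2 * W z)) (\int[_]_z W z)
    (\int[_]_z k2 z) IN1 IN2 IW Ik => i1 i2 i3 i4 IN1 IN2 IW Ik.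
  exact: total_error.
rewrite -IDB; apply: le_trans J0 _; apply: le_trans (_ : _ <= \int[(nu \x nu)%E]_z ((D z.1 * B z.1) * W z + E z)) _.
  apply: Rint_le => //; last exact: integD.
  have -> : (fun z => `|u z.1 - v z.2| * (2 * derive1 al (z.1.1 + z.2.1) * ka (z.1.1 - z.2.1) *
      tpoly S ((z.1.2 : G) - (z.2.2 : G)))) =
    (fun z : X * X => `|u z.1 - v z.2| * ((2 * derive1 al (z.1.1 + z.2.1)) * W z)).
    by apply/funext => z; congr (_ * _); rewrite /W mulrA.
  apply: bm_integ => //; apply: bmM.
    by apply: bm_norm; apply: bmB; [exact: bm_lift1|exact: bm_lift2].
  apply: bmM bW; apply: bmM; first exact: bm_cst.
  exact: bm_time (deriv_of_continuous ddal) dalsupp (@meas_time_add _ _).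
by rewrite (RintD iDB iE) lerD2l.
Qed.

Lemma time_dissipation : 0 <= \int[nu]_p (`|u p - v p| * derive1 al (2 * p.1)).
Proof.
have [A [A0 HA]] := supp_bounded (deriv_of_continuous ddal) dalsupp.
have [Lp [Lp0 HL]] := supp_lipschitz ddal cddal dalsupp.
have tau0 : 0 <= tau by apply: Rintegral_ge0.
have key e := time_dissipation_epsilon (e := e) Lp0 HA HL.
have E : \int[nu]_p (D p * B p) = 2 * \int[nu]_p (`|u p - v p| * derive1 al (2 * p.1)).
  rewrite -RintZ.
    by apply: eq_Rintegral => p _; rewrite /D /B; ring.
  apply: bm_integ; first exact: nuT_fin.
  apply: bmM => //.
  have [C [_ HC]] := supp_bounded (deriv_of_continuous ddal) dalsupp.
  split; last by exists C => p.
  apply: (@measurableT_comp _ _ _ _ _ _ (derive1 al)).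
    exact: (continuous_measurable_fun (deriv_of_continuous ddal)).
  by apply: measurable_funM; [exact: measurable_cst|exact: measurable_fst].
rewrite E in key; set I := Rintegral _ _ _ in key *.
set J : R := 2 * A * (2 + 4 * tau) + 4 * M * tau in key.
have J0 : 0 <= J by rewrite addr_ge0// !mulr_ge0 ?addr_ge0// ?mulr_ge0// ltW.
rewrite leNgt; apply/negP => I0.
(* With this e the error e J is at most - I, so 2 I + e J <= I < 0. *)
have e0 : 0 < - I / (J + 1) by rewrite divr_gt0 ?oppr_gt0// ltr_wpDl.
have := key _ e0; apply/negP; rewrite -ltNge.
have : - I / (J + 1) * J <= - I.
  rewrite -mulrA ger_pMr ?oppr_gt0// mulrC ler_pdivrMr ?ltr_wpDl//; lra.
lra.
Qed.

End TimeDissipation.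

(** * From averages against bumps to almost every time *)

Section LebesguePoints.
Context {R : realType}.
Local Notation leb := (@lebesgue_measure R).

Lemma bump_scale (a b r tau : R) (k K : R -> R) : 0 < r -> bump a b k K ->
  bump (tau + r * a) (tau + r * b) (fun t => r^-1 * k (r^-1 * t + - (r^-1 * tau)))
    (fun t => K (r^-1 * t + - (r^-1 * tau))).
Proof.
move=> r0 B; have rV0 : 0 < r^-1 by rewrite invr_gt0.
have E t : r^-1 * t + - (r^-1 * tau) = (t - tau) / r by rewrite -mulrBr mulrC.
split.
- by apply: smooth_realM; [exact: smooth_real_cst|apply: smooth_real_affine; exact: bump_smooth B].
- exact: deriv_of_comp_affine (bump_deriv B).
- by move=> x; rewrite mulr_ge0 ?(bump_ge0 B)// ltW.
- move=> t; rewrite mulf_eq0 negb_or E => /andP[_ /(bump_supp B)].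
  by rewrite ler_pdivlMr// ler_pdivrMr// -[tau + _ <= t]lerBrDl -[t <= tau + _]lerBlDl ![r * _]mulrC.
- by move=> t h; rewrite E; apply: (bump_left B); rewrite ler_pdivrMr// mulrC lerBlDl.
- by move=> t h; rewrite E; apply: (bump_right B); rewrite ler_pdivlMr// mulrC lerBrDl.
Qed.

Lemma bump_int (a b T : R) (k K : R -> R) : 0 < T -> 0 <= a -> b <= T -> bump a b k K ->
  \int[lebT T]_t k t = 1.
Proof.
move=> T0 a0 bT B; rewrite (Rintegral_lebT T0 (bump_deriv B)).
  by rewrite (bump_right B bT) (bump_left B a0) subr0.
exact: deriv_of_continuous (smooth_real_deriv (bump_smooth B)).1.
Qed.

Lemma bump_bm (a b : R) (k K : R -> R) : bump a b k K ->
  bounded_meas (k : measurableTypeR R -> R).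
Proof.
move=> B; have ck := deriv_of_continuous (smooth_real_deriv (bump_smooth B)).1.
have [C [_ HC]] := supp_bounded ck (bump_supp B).
by split; [exact: continuous_measurable_fun|exists C].
Qed.

(** At a Lebesgue point tau, a bump rescaled to radius r around tau is at most Ck / r on the ball,
    so its average of |D - D tau| is controlled by the mean over the ball. If D tau exceeded D0, a
    small r would contradict the bound on bump averages. *)
Lemma ae_le_of_bumps (D : measurableTypeR R -> R) (D0 : R) : bounded_meas D ->
  (forall a b k K T, 0 < a -> a < b -> b < T -> bump a b k K ->
     \int[lebT T]_t (k t * D t) <= D0) ->
  {ae leb, forall t, 0 < t -> D t <= D0}.
Proof.
move=> bD H; have [mD [C HC]] := bD.
have locD : locally_integrable setT D.
  split => //; first exact: openT.
  move=> K _ cK; apply: (@le_lt_trans _ _ (\int[leb]_(x in K) (cst C%:E) x)%E).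
    apply: ge0_le_integral => //=.
    - exact: compact_measurable.
    - apply/measurable_EFinP; apply: measurableT_comp => //; exact: measurable_funTS.
    - by move=> x _; rewrite lee_fin.
  rewrite integral_cst; last exact: compact_measurable.
  apply: lte_mul_pinfty => //; first by rewrite lee_fin (le_trans _ (HC 0)).
  exact: compact_finite_measure.
have [k [K B]] : exists k K, bump (- 2^-1) (2^-1 : R) k K.
  by apply: bump_exists; lra.
have [Ck0 [Ck00 HCk0]] := supp_bounded (deriv_of_continuous (smooth_real_deriv (bump_smooth B)).1) (bump_supp B).
pose Ck : R := Ck0 + 1.
have Ckpos : 0 < Ck by rewrite ltr_wpDl.
have HCk t : k t <= Ck by rewrite (le_trans (ler_norm _))// (le_trans (HCk0 t))// lerDl.
have LP : {ae leb, forall t, lebesgue_pt D t} := lebesgue_differentiation locD.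
move: LP; apply: filterS; first exact: (ae_filter_ringOfSetsType leb).
move=> tau ptau tau0.
rewrite leNgt; apply/negP => Dtau.
pose del : R := D tau - D0; have del0 : 0 < del by rewrite subr_gt0.
(* The ball has length 2r, so a mean below eps bounds the bump average strictly by (Ck / r) (2 r)
   eps = del. *)
pose eps : R := del / (2 * Ck); have eps0 : 0 < eps by rewrite divr_gt0// mulr_gt0.
have [r [r0 [rtau dr]]] : exists r : R, 0 < r /\ (r < tau /\ (davg D tau r < eps%:E)%E).
  have n1 : nbhs (0 : \bar R)%E [set y | (y < eps%:E)%E].
    by apply: open_nbhs_nbhs; split; [exact: open_ereal_lt_ereal|rewrite /= lte_fin].
  apply: (@filter_ex _ _ (at_right_proper_filter (0 : R))).
  apply: filterI; first exact: nbhs_right_gt.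
  by apply: filterI; [exact: nbhs_right_lt|exact: (ptau _ n1)].
have Br := bump_scale tau r0 B; set kr := (fun t => r^-1 * _) in Br.
pose T : R := tau + r.
have T0 : 0 < T by rewrite addr_gt0.
have a0 : 0 < tau + r * - 2^-1 by lra.
have aT : tau + r * 2^-1 < T by rewrite /T; lra.
have ab : tau + r * - 2^-1 < tau + r * 2^-1 by lra.
have HI := H _ _ _ _ T a0 ab aT Br.
have bkr := bump_bm Br; have I1 := bump_int T0 (ltW a0) (ltW aT) Br.
have ikD : integ (lebT T) (fun t => kr t * D t).
  by apply: bm_integ; [exact: lebT_fin|exact: bmM].
have ik : integ (lebT T) kr by apply: bm_integ; [exact: lebT_fin|].
have ikDt : integ (lebT T) (fun t => kr t * `|D t - D tau|).
  apply: bm_integ; [exact: lebT_fin|apply: bmM => //; apply: bm_norm; apply: bmB => //; exact: bm_cst].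
have step1 : del <= \int[lebT T]_t (kr t * `|D t - D tau|).
  apply: (@le_trans _ _ (\int[lebT T]_t (D tau * kr t - kr t * D t))).
    by rewrite (RintB (integZ (D tau) ik) ikD) (RintZ _ ik) I1 mulr1 lerD2l lerN2.
  apply: Rint_le => //; first exact: integB (integZ _ ik) ikD.
  move=> t; rewrite mulrC -mulrBr ler_wpM2l ?(bump_ge0 Br)//.
  by rewrite distrC ler_norm.
have kr0 t : kr t != 0 -> ball tau r t.
  move=> /(bump_supp Br)/andP[h1 h2]; rewrite /ball/= ltr_norml; apply/andP; split; lra.
have step2 : (del%:E <= (Ck / r)%:E * \int[leb]_(t in ball tau r) `|D t - D tau|%:E)%E.
  apply: (@le_trans _ _ (\int[lebT T]_t (kr t * `|D t - D tau|)%:E)%E).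
    apply: le_trans (_ : (del%:E <= (\int[lebT T]_t (kr t * `|D t - D tau|))%:E)%E) _.
      by rewrite lee_fin.
    by rewrite /Rintegral fineK//; exact: integrable_fin_num.
  rewrite -(integral_lebT (T := T)); last first.
    move=> t tT; have [->|/(bump_supp Br)/andP[h1 h2]] := eqVneq (kr t) 0; first by rewrite mul0r.
    by exfalso; apply: tT; apply/andP; split; lra.
  rewrite -ge0_integralZl//.
  - rewrite [leRHS]integral_mkcond; apply: ge0_le_integral => //.
    + by move=> t _; rewrite lee_fin mulr_ge0 ?(bump_ge0 Br).
    + apply/measurable_EFinP; exact: (integ_meas ikDt).
    + apply/(measurable_restrictT _ (measurable_ball _ _)).
      by apply: measurable_funTS; apply/measurable_EFinP; apply: measurable_funM => //;
        apply: measurableT_comp => //; exact: measurable_funB.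
    + move=> t _; rewrite patchE; case: ifPn => tb.
        rewrite -EFinM lee_fin ler_wpM2r// /kr mulrC ler_pdivrMr// divfK ?gt_eqF//.
      have [->|/kr0/mem_set] := eqVneq (kr t) 0; first by rewrite mul0r.
      by rewrite (negbTE tb).
  - exact: measurable_ball.
  - apply/measurable_EFinP; apply: measurable_funTS; apply: measurableT_comp => //.
    exact: measurable_funB.
  - by rewrite lee_fin divr_ge0// ltW.
move: dr; rewrite /davg /iavg lebesgue_measure_ball ?ltW//.
have -> : (\int[leb]_(y in ball tau r) `|((center (D tau) \o D) y)%:E| =
    \int[leb]_(t in ball tau r) `|D t - D tau|%:E)%E by apply: eq_integral.
have : (0 <= \int[leb]_(t in ball tau r) `|D t - D tau|%:E)%E.
  by apply: integral_ge0 => t _; rewrite lee_fin.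
have r2 : 0 < r *+ 2 by rewrite mulrn_wgt0.
rewrite inver gt_eqF//; move: step2; case: (integral _ _ _) => [I| |] //=.
  rewrite -!EFinM !lee_fin lte_fin => h1 _ h2.
  have h3 : I < eps * (r *+ 2) by rewrite -ltr_pdivrMr// mulrC.
  have h4 : del * r <= Ck * I by rewrite -ler_pdivlMr// mulrAC.
  have h5 : eps * (2 * Ck) = del by rewrite /eps divfK// gt_eqF// mulr_gt0.
  have : Ck * I < Ck * (eps * (r *+ 2)) by rewrite ltr_pM2l.
  rewrite (_ : Ck * (eps * (r *+ 2)) = eps * (2 * Ck) * r); last by rewrite -mulr_natr; ring.
  by rewrite h5 ltNge h4.
by move=> _ _; rewrite gt0_muley ?lte_fin ?invr_gt0.
Qed.

End LebesguePoints.

(** * Contraction in L1 *)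

Section L1Distance.
Context d (T : measurableType d) (R : realType) (m : {measure set T -> \bar R}).

Let mm (f g : T -> R) : measurable_fun setT f -> measurable_fun setT g ->
  measurable_fun setT (fun x => `|f x - g x|%:E).
Proof.
by move=> mf mg; apply/measurable_EFinP; apply: measurableT_comp => //; exact: measurable_funB.
Qed.

Lemma L1_dist_triangle (a b c : T -> R) : measurable_fun setT a ->
  measurable_fun setT b -> measurable_fun setT c ->
  (\int[m]_x `|a x - c x|%:E <= \int[m]_x `|a x - b x|%:E + \int[m]_x `|b x - c x|%:E)%E.
Proof.
move=> ma mb mc.
rewrite -ge0_integralD//; try exact: mm.
apply: ge0_le_integral => //.
- exact: mm.
- by apply: emeasurable_funD; exact: mm.
- by move=> x _; rewrite -EFinD lee_fin ler_distD.
Qed.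

Lemma L1_dist_ae_eq (a a' b b' : T -> R) : measurable_fun setT a ->
  measurable_fun setT a' -> measurable_fun setT b -> measurable_fun setT b' ->
  {ae m, forall x, a x = a' x} -> {ae m, forall x, b x = b' x} ->
  (\int[m]_x `|a x - b x|%:E = \int[m]_x `|a' x - b' x|%:E)%E.
Proof.
move=> ma ma' mb mb' aa bb.
apply: ae_eq_integral => //; try exact: mm.
by move: aa bb; apply: filterS2 => x -> -> _.
Qed.

End L1Distance.

(** By Tonelli the measures of the sections of a null set integrate to 0, so almost every section is
    null. *)
Lemma ae_xsection d1 d2 (T1 : measurableType d1) (T2 : measurableType d2) (R : realType)
    (m1 : {sigma_finite_measure set T1 -> \bar R})
    (m2 : {sigma_finite_measure set T2 -> \bar R}) (P : T1 * T2 -> Prop) :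
  {ae (m1 \x m2)%E, forall p, P p} ->
  {ae m1, forall t, {ae m2, forall x, P (t, x)}}.
Proof.
move=> [N [mN N0 sN]].
have mx := measurable_fun_xsection m2 mN.
have /(ae_eq_integral_abs m1 measurableT mx) : (\int[m1]_t `|m2 (xsection N t)| = 0)%E.
  rewrite -N0 /product_measure1; apply: eq_integral => t _.
  by rewrite gee0_abs.
apply: filterS => t /(_ I) /= h; exists (xsection N t); split => //.
  exact: measurable_xsection.
by move=> x /= nP; rewrite /xsection/= inE; apply: sN.
Qed.

Section Contraction.
Context {R : realType} (d : nat) (G : topologicalZmodType).
Variable iota : 'rV[R]_d -> G.
Hypothesis Hbohr : is_bohr_compactification iota.
Variable m : probability (GB R G) R.
Hypothesis Hhaar : is_haar m.
Local Notation X := (measurableTypeR R * GB R G)%type.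
Local Notation leb := (@lebesgue_measure R).
Variables (f : 'I_d -> R -> R) (sigma : 'I_d -> 'I_d -> R -> R).
Hypothesis Hf : forall i, smooth_real (f i).
Hypothesis Hsigma : forall i k, smooth_real (sigma i k).

Variables (M : R) (u v : X -> R).
Hypotheses (M0 : 0 < M) (mu : measurable_fun setT u) (mv : measurable_fun setT v)
  (uM : forall p, `|u p| <= M) (vM : forall p, `|v p| <= M).

Definition slice_dist (t : measurableTypeR R) : R := \int[m]_x `|u (t, x) - v (t, x)|.
Local Notation D := slice_dist.

Let bu : bounded_meas u. Proof. by split => //; exists M. Qed.
Let bv : bounded_meas v. Proof. by split => //; exists M. Qed.
Let bF : bounded_meas (fun p => `|u p - v p|). Proof. exact: bm_norm (bmB bu bv). Qed.

Lemma slice_dist_bm : bounded_meas D.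
Proof.
split.
  have iF : integ (lebT 1 \x m)%E (fun p => `|u p - v p|).
    by apply: bm_integ => //; exact: (nuT_fin m 1).
  exact: integ_meas (Rfubini1_integ iF).
exists (\int[m]_x (fun=> 2 * M) x) => t; apply: Rint_norm_le.
- by apply: bm_integ; [exact: prob_fin|exact: bm_section1 bF].
- by apply: bm_integ; [exact: prob_fin|exact: bm_cst].
- move=> x; rewrite normr_id (le_trans (ler_normB _ _))//.
  by have := uM (t, x); have := vM (t, x); lra.
Qed.

Lemma slice_distE t : ((D t)%:E = \int[m]_x `|u (t, x) - v (t, x)|%:E)%E.
Proof.
rewrite /D /Rintegral fineK//; apply: integrable_fin_num => //.
by apply: bm_integ; [exact: prob_fin|exact: bm_section1 bF].
Qed.

Hypotheses (Hu : forall T, exists g, clean_solution Hbohr m f sigma u T g)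
  (Hv : forall T, exists g, clean_solution Hbohr m f sigma v T g).

(** Apply [time_dissipation] to al(t) = K0(t/2) - K1(t/2), a smoothed indicator: it is nonnegative
    because the second step begins after the first has ended, and al'(2t) = (k0 t - k1 t) / 2. *)
Lemma slice_dist_bumps a0 b0 a1 b1 T (k0 K0 k1 K1 : R -> R) :
  0 < a0 -> a0 < b0 -> b0 <= a1 -> a1 < b1 -> b1 < T ->
  bump a0 b0 k0 K0 -> bump a1 b1 k1 K1 ->
  \int[lebT T]_t (k1 t * D t) <= \int[lebT T]_t (k0 t * D t).
Proof.
move=> a00 ab0 ba ab1 bT B0 B1.
have T0 : 0 < T by lra.
pose al (t : R) : R := K0 (2^-1 * t + 0) + -1 * K1 (2^-1 * t + 0).
have dal : deriv_of al (fun t => 2^-1 * k0 (2^-1 * t + 0) + -1 * (2^-1 * k1 (2^-1 * t + 0))).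
  apply: deriv_ofD; first exact: deriv_of_comp_affine (bump_deriv B0).
  exact: deriv_ofZ (deriv_of_comp_affine _ _ (bump_deriv B1)).
have sal : smooth_real al.
  apply: smooth_realD; first exact: smooth_real_affine (smooth_real_of_deriv (bump_deriv B0) (bump_smooth B0)).
  apply: smooth_realM; first exact: smooth_real_cst.
  exact: smooth_real_affine (smooth_real_of_deriv (bump_deriv B1) (bump_smooth B1)).
have al0 t : 0 <= al t.
  rewrite /al addr0; set s := 2^-1 * t.
  have [i0 i1] := (bump_itv B0 s, bump_itv B1 s).
  have [sa|/ltW as_] := leP s a1; first by rewrite (bump_left B1 sa); lra.
  by rewrite (bump_right B0 (le_trans ba as_)); lra.
have alsupp t : al t != 0 -> 2 * a0 <= t <= 2 * b1.
  rewrite /al addr0; set s := 2^-1 * t => h.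
  have [sa|as_] := leP s a0.
    by move: h; rewrite (bump_left B0 sa) (bump_left B1) ?mulr0 ?addr0 ?eqxx//; lra.
  have [bs|sb] := leP b1 s.
    by move: h; rewrite (bump_right B1 bs) (bump_right B0) ?mulN1r ?subrr ?eqxx//; lra.
  by move: as_ sb; rewrite /s; lra.
have a20 : 0 < 2 * a0 by lra.
have b2T : 2 * b1 < 2 * T by lra.
have [g Hg] := Hu T; have [h Hh] := Hv T.
have := time_dissipation Hhaar Hf Hsigma M0 mu mv uM vM Hg Hh sal al0 alsupp a20 b2T T0.
rewrite (deriv_ofE dal).
have bk0 := bump_bm B0; have bk1 := bump_bm B1.
have bk : bounded_meas (fun t : measurableTypeR R => k0 t - k1 t) by exact: bmB.
pose F (p : X) : R := (k0 p.1 - k1 p.1) * `|u p - v p|.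
have iF : integ (lebT T \x m)%E F.
  apply: bm_integ; first exact: (nuT_fin m T).
  by apply: bmM bF; exact: (@bm_lift1 _ _ _ _ _ (fun t => k0 t - k1 t)).
have -> : (fun p : X => `|u p - v p| * (2^-1 * k0 (2^-1 * (2 * p.1) + 0) +
    -1 * (2^-1 * k1 (2^-1 * (2 * p.1) + 0)))) = fun p => 2^-1 * F p.
  by apply/funext => p; rewrite /F addr0 mulKf//; ring.
have -> : \int[nuT m T]_p (2^-1 * F p) = 2^-1 * \int[(lebT T \x m)%E]_p F p by exact: RintZ.
rewrite pmulr_rge0// -(Rfubini1 iF).
have E t : \int[m]_x F (t, x) = k0 t * D t - k1 t * D t.
  rewrite /F /= RintZ ?mulrBl//.
  by apply: bm_integ; [exact: prob_fin|exact: bm_section1 bF].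
under eq_Rintegral => t _ do rewrite E.
have ik (k : measurableTypeR R -> R) : bounded_meas k -> integ (lebT T) (fun t => k t * D t).
  by move=> bk'; apply: bm_integ; [exact: lebT_fin|exact: bmM slice_dist_bm].
by rewrite (RintB (ik _ bk0) (ik _ bk1)) subr_ge0.
Qed.

(** On the support of k, D agrees almost everywhere with min(D, c), and k has mass 1. *)
Lemma slice_dist_initial (k K : R -> R) (a b T delta c : R) : 0 < a -> a < b ->
  b < delta -> b < T -> bump a b k K ->
  {ae leb, forall t, 0 < t < delta -> D t <= c} ->
  \int[lebT T]_t (k t * D t) <= c.
Proof.
move=> a0 ab bd bT B Hc; have [mD [C HC]] := slice_dist_bm.
have bD' : bounded_meas (fun t => Num.min (D t) c).
  split; first by apply: measurable_minr => //; exact: measurable_cst.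
  exists (C + `|c|) => t; have := HC t; rewrite minElt; case: ifP => _ h.
    by rewrite (le_trans h)// lerDl.
  by rewrite lerDr (le_trans _ h).
have i (k' : measurableTypeR R -> R) : bounded_meas k' -> integ (lebT T) (fun t => k t * k' t).
  by move=> bk'; apply: bm_integ; [exact: lebT_fin|exact: bmM (bump_bm B) bk'].
have z (h : R -> R) t : ~ (0 <= t <= T) -> (k t * h t)%:E = 0%E.
  move=> tT; have [->|/(bump_supp B)/andP[h1 h2]] := eqVneq (k t) 0; first by rewrite mul0r.
  by exfalso; apply: tT; apply/andP; split; lra.
have -> : \int[lebT T]_t (k t * D t) = \int[lebT T]_t (k t * Num.min (D t) c).
  rewrite /Rintegral -!(integral_lebT (T := T)) //; last 2 first.
  - by move=> t; exact: (z (fun t => Num.min (D t) c)).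
  - by move=> t; exact: z.
  congr fine; apply: ae_eq_integral => //.
  - apply/measurable_EFinP; exact: integ_meas (i _ slice_dist_bm).
  - apply/measurable_EFinP; exact: integ_meas (i _ bD').
  - move: Hc; apply: filterS; first exact: (ae_filter_ringOfSetsType leb).
    move=> t h _.
    have [->|/(bump_supp B)/andP[h1 h2]] := eqVneq (k t) 0; first by rewrite !mul0r.
    by rewrite min_l// h//; apply/andP; split; lra.
have T0 : 0 < T by lra.
rewrite -[leRHS]mulr1 -(bump_int T0 (ltW a0) (ltW bT) B) -RintZ; last first.
  by apply: bm_integ; [exact: lebT_fin|exact: bump_bm B].
apply: Rint_le; [exact: i| |].
- by apply: integZ; apply: bm_integ; [exact: lebT_fin|exact: bump_bm B].
- by move=> t; rewrite mulrC ler_wpM2r ?(bump_ge0 B)// ge_min lexx orbT.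
Qed.

(** Any bump is compared with an earlier one placed inside (0, delta), whose average the initial
    condition bounds by c0 + e. *)
Lemma slice_dist_contraction (c0 : R) :
  (forall e, 0 < e -> exists delta, 0 < delta /\
     {ae leb, forall t, 0 < t < delta -> D t <= c0 + e}) ->
  {ae leb, forall t, 0 < t -> D t <= c0}.
Proof.
move=> Hinit; apply: ae_le_of_bumps slice_dist_bm _ => a b k K T a0 ab bT B.
(* b' is at most a / 2 and delta / 2: the auxiliary bump on [b' / 2, b'] must end both before the
   given bump begins and before delta. *)
apply/ler_addgt0Pr => e /Hinit[delta [delta0 Hd]].
have [b' [b'0 b'a b'd]] : exists b' : R, [/\ 0 < b', b' <= a / 2 & b' <= delta / 2].
  exists (Num.min (a / 2) (delta / 2)).
  by rewrite lt_min !ge_min !lexx ?orbT !divr_gt0.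
have a'0 : 0 < b' / 2 by rewrite divr_gt0.
have ab' : b' / 2 < b' by rewrite ltr_pdivrMr// ltr_pMr// ltr1n.
have [k0 [K0 B0]] := bump_exists ab'.
have bd : b' < delta by lra.
have bT' : b' < T by lra.
have ba : b' <= a by lra.
have h1 := slice_dist_initial a'0 ab' bd bT' B0 Hd.
have h2 := slice_dist_bumps a'0 ab' ba ab bT B0 B.
exact: le_trans h2 h1.
Qed.

End Contraction.

Lemma Linf_prod_section (R : realType) (G : topologicalZmodType)
    (m : probability (GB R G) R) (w : R * GB R G -> R) (t : R) :
  Linf_prod m w -> 0 < t -> measurable_fun setT (fun x => w (t, x)).
Proof.
move=> [mw _] t0; pose i (x : GB R G) : measurableTypeR R * GB R G := (t, x).
apply: (measurable_comp (F := @Dom R (GB R G) : set (measurableTypeR R * GB R G)) (g := i)).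
- exact: measurable_Dom.
- by move=> _ [x _ <-].
- exact: mw.
- exact: pair1_measurable.
Qed.

Theorem theorem3p2 (R : realType) (d : nat) (G : topologicalZmodType)
  (iota : 'rV[R]_d -> G) (m : probability (GB R G) R)
  (f : 'I_d -> R -> R) (A sigma beta : 'I_d -> 'I_d -> R -> R)
  (Hbohr : is_bohr_compactification iota)
  (Hhaar : is_haar m)
  (Hf : forall i, smooth_real (f i))
  (HA : forall i j, smooth_real (A i j))
  (HAsym : forall i j (x : R), A i j x = A j i x)
  (Hnonneg : forall (x : R) (xi : 'I_d -> R),
      0 <= \sum_i \sum_j xi i * amat A i j x * xi j)
  (Hsigma : forall i k, smooth_real (sigma i k))
  (Hdecomp : forall i j (x : R), amat A i j x = \sum_k sigma i k x * sigma j k x)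
  (Hbeta : forall i k (x : R), is_derive x 1 (beta i k) (sigma i k x))
  (u v : R * GB R G -> R) (u0 v0 : GB R G -> R) :
  Linf_G m u0 -> Linf_G m v0 ->
  entropy_solution iota m f A sigma beta u u0 ->
  entropy_solution iota m f A sigma beta v v0 ->
  {ae (@lebesgue_measure R), forall t : R, 0 < t ->
     (\int[m]_x `|u (t, x) - v (t, x)|%:E
      <= \int[m]_x `|u0 x - v0 x|%:E)%E }.
Proof.
move=> [mu0 _] [mv0 _] su sv.
pose leb := @lebesgue_measure R.
have FF : Filter (nbhs (almost_everywhere leb)) := ae_filter_ringOfSetsType leb.
have aeI (P Q : R -> Prop) : {ae leb, forall t, P t} -> {ae leb, forall t, Q t} ->
    {ae leb, forall t, P t /\ Q t} := @filterI _ _ FF P Q.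
have [M1 [u' [M10 mu' uM1 uu' Hu]]] := entropy_solution_clean Hbohr Hdecomp su.
have [M2 [v' [M20 mv' vM2 vv' Hv]]] := entropy_solution_clean Hbohr Hdecomp sv.
have M0 : 0 < M1 + M2 by rewrite addr_gt0.
have uM p : `|u' p| <= M1 + M2 by rewrite (le_trans (uM1 p))// lerDl ltW.
have vM p : `|v' p| <= M1 + M2 by rewrite (le_trans (vM2 p))// lerDr ltW.
have [Lu [_ [_ _ _ _ iu]]] := su; have [Lv [_ [_ _ _ _ iv]]] := sv.
have meas_slice (w : measurableTypeR R * GB R G -> R) t : measurable_fun setT w ->
    measurable_fun setT (fun x => w (t, x)).
  by move=> mw; exact: measurableT_comp.
have uu1 : {ae leb, forall t, 0 < t -> {ae m, forall x, u (t, x) = u' (t, x)}}.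
  move: (ae_xsection uu'); apply: filterS => t h t0; move: h.
  by apply: filterS => x; exact.
have vv1 : {ae leb, forall t, 0 < t -> {ae m, forall x, v (t, x) = v' (t, x)}}.
  move: (ae_xsection vv'); apply: filterS => t h t0; move: h.
  by apply: filterS => x; exact.
(* If the right-hand side is infinite the claim is immediate; otherwise it is the real number c0. *)
have [->|fin0] := eqVneq (\int[m]_x `|u0 x - v0 x|%:E)%E +oo%E.
  by apply: filterE => t _; exact: leey.
pose c0 : R := fine (\int[m]_x `|u0 x - v0 x|%:E)%E.
have c0E : (c0%:E = \int[m]_x `|u0 x - v0 x|%:E)%E.
  by rewrite fineK// ge0_fin_numE ?integral_ge0// lt_neqAle fin0 leey.
rewrite -c0E.
have E t : (\int[m]_x `|u' (t, x) - v' (t, x)|%:E = (slice_dist m u' v' t)%:E)%E.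
  by rewrite (slice_distE m mu' mv' uM vM).
have key : {ae leb, forall t, 0 < t -> slice_dist m u' v' t <= c0}.
  apply: (slice_dist_contraction Hhaar Hf Hsigma M0 mu' mv' uM vM Hu Hv) => e e0.
  have e20 : 0 < e / 2 by rewrite divr_gt0.
  have [du [du0 {}iu]] := iu _ e20; have [dv [dv0 {}iv]] := iv _ e20.
  exists (Num.min du dv); split; first by rewrite lt_min du0.
  have iu1 : {ae leb, forall t, 0 < t < du -> (\int[m]_x `|u (t, x) - u0 x|%:E < (e / 2)%:E)%E} := iu.
  have iv1 : {ae leb, forall t, 0 < t < dv -> (\int[m]_x `|v (t, x) - v0 x|%:E < (e / 2)%:E)%E} := iv.
  move: (aeI _ _ (aeI _ _ iu1 iv1) (aeI _ _ uu1 vv1)).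
  apply: filterS => t [[hu hv] [eu ev]] /andP[t0]; rewrite lt_min => /andP[tu tv].
  rewrite -lee_fin -E.
  have t0u : 0 < t < du by rewrite t0.
  have t0v : 0 < t < dv by rewrite t0.
  move: (hu t0u) (hv t0v) => {}hu {}hv.
  have id0 (w : GB R G -> R) : {ae m, forall x, w x = w x} by apply: filterE.
  rewrite (L1_dist_ae_eq (Linf_prod_section Lu t0) (meas_slice _ t mu') mu0 mu0 (eu t0) (id0 u0)) in hu.
  rewrite (L1_dist_ae_eq (Linf_prod_section Lv t0) (meas_slice _ t mv') mv0 mv0 (ev t0) (id0 v0)) in hv.
  (* The path from u' to v' goes through u0 and v0: the outer pieces cost e / 2 each by the initial
     conditions, the middle one is c0. *)
  have h1 := L1_dist_triangle m (meas_slice _ t mu') mu0 (meas_slice _ t mv').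
  have h2 := L1_dist_triangle m mu0 mv0 (meas_slice _ t mv').
  apply: (le_trans h1); apply: (le_trans (leeD2l _ h2)).
  rewrite -c0E; have -> : c0 + e = e / 2 + (c0 + e / 2) by rewrite addrCA -splitr.
  rewrite EFinD [(c0 + _)%:E]EFinD; apply: leeD; first exact: ltW.
  apply: leeD => //; apply: ltW.
  by under eq_integral => x _ do rewrite distrC.
move: (aeI _ _ key (aeI _ _ uu1 vv1)); apply: filterS => t [hk [eu ev]] t0.
rewrite (L1_dist_ae_eq (Linf_prod_section Lu t0) (meas_slice _ t mu')
  (Linf_prod_section Lv t0) (meas_slice _ t mv') (eu t0) (ev t0)).
by rewrite E lee_fin; exact: hk.
Qed.
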